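(* Let $1\le p<+\infty$ and consider a network with $n$ vertices and $m$ edges with associated matrices $\Psi$, $\mathbb A$, $\mathbb B$, and let $v=v_i$ be the control vertex, represented by the $i$-th canonical basis vector of $\mathbb C^n$. If $t\ge\min\{m,n\}=:l$, then the exact reachability space of the controlled transport problem in the network $$\dot x(t,s)=x'(t,s)\ (s\in[0,1],\,t\ge0),\qquad x(t,1)=\mathbb B\,x(t,0)+u(t)\cdot\Psi v\ (t\ge0),\qquad x(0,s)=0\ (s\in[0,1])$$ equals $$e\mathcal R^{\mathrm{BC}}_t=e\mathcal R^{\mathrm{BC}}=L^p[0,1]\otimes\operatorname{span}\{\Psi v,\mathbb B\Psi v,\dots,\mathbb B^{l-1}\Psi v\}=L^p[0,1]\otimes\Psi\operatorname{span}\{v,\mathbb Av,\dots,\mathbb A^{l-1}v\}.$$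
   Context: Network. A finite directed network has vertices $v_1,\dots,v_n$ and edges $e_1,\dots,e_m$. If edge $e_i$ starts at vertex $v_j$ it carries a weight $w_{ij}\in[0,1]$. The transposed weighted outgoing incidence matrix $\Psi\in \mathrm M_{m\times n}(\mathbb C)$ is $\Psi_{ij}:=w_{ij}$ if $e_i$ starts at $v_j$ and $0$ otherwise; it is assumed column stochastic (the weights of the edges leaving any given vertex sum to $1$). The transposed weighted adjacency matrix $\mathbb A\in \mathrm M_n(\mathbb C)$ has entry $\mathbb A_{ij}$ equal to the weight $w_{kj}$ of the edge $e_k$ leading from $v_j$ to $v_i$ (the sum of such weights if there are several), and $0$ if there is none. The transposed weighted adjacency matrix of the line graph $\mathbb B\in \mathrm M_m(\mathbb C)$ is $\mathbb B_{ij}:=w_{ik}$ if $e_j$ ends at a vertex $v_k$ at which $e_i$ starts, and $0$ otherwise. In particular $\Psi\mathbb A=\mathbb B\Psi$. Control system. The problem is the abstract boundary control system $\dot x=A_mx$, $Qx=Bu$, $x(0)=0$ with: $X:=L^p([0,1],\mathbb C^m)$; $U:=\mathbb C$; $A_m:=\operatorname{diag}(\frac d{ds})_{m\times m}$ with $D(A_m):=\{f\in W^{1,p}([0,1],\mathbb C^m):f(1)\in\operatorname{rg}\Psi\}$; boundary space $\partial X:=\operatorname{rg}\Psi\subseteq\mathbb C^m$; $Q:D(A_m)\to\partial X$, $Qf:=f(1)-\mathbb Bf(0)$; $B:=\Psi v$, viewed in $\mathcal L(\mathbb C,\partial X)$; $A\subset A_m$ with $D(A)=\ker Q$. $A$ generates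 a strongly continuous semigroup $(T(t))_{t\ge0}$ on $X$. For $\lambda\in\rho(A)$, $Q_\lambda:=(Q|_{\ker(\lambda-A_m)})^{-1}:\partial X\to\ker(\lambda-A_m)\subseteq X$ exists and is bounded, and $B_\lambda:=Q_\lambda B$. $B$ is $p$-boundary admissible, i.e. $\int_0^tT(t-s)B_\lambda u(s)\,ds\in D(A)$ for all $u\in L^p([0,t],U)$, and the controllability map is $\mathcal B_t^{\mathrm{BC}}u:=(\lambda-A)\int_0^tT(t-s)B_\lambda u(s)\,ds$ (independent of $\lambda\in\rho(A)$). $e\mathcal R^{\mathrm{BC}}_t:=\operatorname{rg}(\mathcal B^{\mathrm{BC}}_t)$, $e\mathcal R^{\mathrm{BC}}:=\bigcup_{t\ge0}\operatorname{rg}(\mathcal B^{\mathrm{BC}}_t)$. For $f\in L^p[0,1]$, $d\in\mathbb C^m$, $(f\otimes d)(s):=f(s)d$; for a subspace $V\subseteq\mathbb C^m$, $L^p[0,1]\otimes V$ is the set of finite sums of $f\otimes d$ with $f\in L^p[0,1]$, $d\in V$. *)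

(* Defs.v *)
From HB Require Import structures.
From mathcomp Require Import all_boot all_order all_algebra.
From mathcomp Require Import complex.
From mathcomp Require Import all_classical all_reals all_analysis.

Set Implicit Arguments.
Unset Strict Implicit.
Unset Printing Implicit Defensive.

Import Order.TTheory GRing.Theory Num.Theory.
Import numFieldNormedType.Exports.

Local Open Scope classical_set_scope.
Local Open Scope ring_scope.
Local Open Scope complex_scope.

(* A Banach space that is a space of classes of functions modulo a.e. equality
   is presented by a vector space V of representatives, the set X of the
   representatives of its elements, and the seminorm N on X; two elements of X
   represent the same vector when N (x - y) = 0. (Unbounded) operators are
   given by their graphs, as relations on representatives. *)
Section SeminormedSpace.
Context {R : realType} {V : lmodType R[i]}.
Variables (X : set V) (N : V -> R).
Implicit Types (x y z : V) (A : V -> V -> Prop) (T : R -> V -> V).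

Definition same x y : Prop := N (x - y) = 0.

Definition bounded_linear (S : V -> V) : Prop :=
  [/\ forall x, X x -> X (S x),
      forall (a : R[i]) x y, X x -> X y ->
        same (S (a *: x + y)) (a *: S x + S y)
    & exists M : R, forall x, X x -> N (S x) <= M * N x].

Definition strongly_continuous_semigroup T : Prop :=
  [/\ forall t, 0 <= t -> bounded_linear (T t),
      forall x, X x -> same (T 0 x) x,
      forall s t x, 0 <= s -> 0 <= t -> X x ->
        same (T (s + t) x) (T s (T t x))
    & forall x t, X x -> 0 <= t ->
        N (T s x - T t x) @[s --> within [set s | 0 <= s] (nbhs t)] --> (0 : R)].

Definition generator T x y : Prop :=
  [/\ X x, X y
    & N ((h^-1)%:C *: (T h x - x) - y) @[h --> (0 : R)^'+] --> (0 : R)].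

Definition generates A T : Prop := forall x y, A x y <-> generator T x y.

Definition resolvent_set A : set R[i] := [set lam |
  exists S : V -> V,
    [/\ bounded_linear S,
        forall y, X y -> exists z, A (S y) z /\ same (lam *: S y - z) y
      & forall x z, A x z -> same (S (lam *: x - z)) x]].

Definition simple_with_integral (D : set R) (h : R -> V) (z : V) : Prop :=
  exists (k : nat) (E : 'I_k -> set R) (x : 'I_k -> V),
    [/\ forall j, [/\ measurable (E j), E j `<=` D & X (x j)],
        h = (fun s => \sum_j (\1_(E j) s)%:C *: x j)
      & z = \sum_j (fine (lebesgue_measure (E j)))%:C *: x j].

Definition bochner_integral (D : set R) (G : R -> V) (z : V) : Prop :=
  [/\ X z, forall s, D s -> X (G s)
    & exists (h : nat -> R -> V) (I : nat -> V),
      [/\ forall k, simple_with_integral D (h k) (I k),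
          {ae lebesgue_measure, forall s : R, D s ->
             N (G s - h k s) @[k --> \oo] --> (0 : R)},
          (\int[lebesgue_measure]_(s in D) (N (G s - h k s))%:E)%E
             @[k --> \oo] --> (0%E : \bar R)
        & N (I k - z) @[k --> \oo] --> (0 : R)]].

End SeminormedSpace.

Section LebesgueSobolev.
Context {R : realType}.
Variable p : R.
Implicit Type D : set R.

Definition Lp D : set (R -> R[i]) := [set f : R -> R[i] |
  [/\ measurable_fun D (fun s : R => complex.Re (f s)),
      measurable_fun D (fun s : R => complex.Im (f s))
    & ('N[lebesgue_measure]_(p%:E)[(fun s : R => (Normc.normc (f s))%:E) \_ D]
         < +oo)%E]].

Definition cintegral D (f : R -> R[i]) : R[i] :=
  (\int[lebesgue_measure]_(s in D) complex.Re (f s))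
  +i* (\int[lebesgue_measure]_(s in D) complex.Im (f s)).

Variable m : nat.
Implicit Types f g F : R -> 'cV[R[i]]_m.

Definition Lpv : set (R -> 'cV[R[i]]_m) :=
  [set f : R -> 'cV[R[i]]_m | forall j, Lp `[0, 1] (fun s => f s j 0)].

(* All norms on C^m are equivalent, so the choice of the norm
   |d| = \sum_j |d_j| on the values only changes the norm of L^p([0,1], C^m)
   to an equivalent one. *)
Definition Lpv_norm f : R :=
  fine ('N[lebesgue_measure]_(p%:E)
          [(fun s : R => (\sum_j Normc.normc (f s j 0))%R%:E) \_ `[0%R, 1%R]])%E.

Definition test_function (phi : R -> R) : Prop :=
  [/\ forall s, derivable phi s 1, continuous (derive1 phi)
    & exists a b : R, [/\ 0 < a, b < 1
        & forall s, s \notin `[a, b] -> phi s = 0]].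

Definition weak_derivative f g : Prop :=
  forall phi, test_function phi -> forall j,
    cintegral `[0, 1] (fun s => f s j 0 * (derive1 phi s)%:C) =
    - cintegral `[0, 1] (fun s => g s j 0 * (phi s)%:C).

(* Boundary values of a W^{1,p} function are those of its continuous
   representative. *)
Definition continuous_representative f F : Prop :=
  (forall j, {within `[0, 1], continuous (fun s : R => complex.Re (F s j 0))} /\
             {within `[0, 1], continuous (fun s : R => complex.Im (F s j 0))}) /\
  {ae lebesgue_measure, forall s : R, s \in `[0, 1] -> F s = f s}.

(* L^p[0,1] \otimes W *)
Definition Lp_tensor (W : set 'cV[R[i]]_m) : set (R -> 'cV[R[i]]_m) :=
  [set f | Lpv f /\
    exists (k : nat) (g : 'I_k -> R -> R[i]) (d : 'I_k -> 'cV[R[i]]_m),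
      (forall j, Lp `[0, 1] (g j) /\ W (d j)) /\
      same Lpv_norm f (fun s => \sum_j g j s *: d j)].

End LebesgueSobolev.

Arguments Lpv {R} p {m}.
Arguments Lpv_norm {R} p {m}.

(* Vertices are 'I_n, edges are 'I_m; loops and multiple edges are allowed. *)
Record network (R : realType) (n m : nat) := Network {
  src : 'I_m -> 'I_n;
  tgt : 'I_m -> 'I_n;
  wgt : 'I_m -> R;
  wgt_itv : forall e, 0 <= wgt e <= 1;
  wgt_stochastic : forall j, \sum_(e | src e == j) wgt e = 1 }.

Section ControlledNetwork.
Context {R : realType} {n m : nat}.
Variables (p : R) (Net : network R n m).
Local Notation C := R[i].
Local Notation V := (R -> 'cV[C]_m).
Implicit Types (f g : V) (d : 'cV[C]_m).

Definition Psi : 'M[C]_(m, n) :=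
  \matrix_(e, j) (if src Net e == j then (wgt Net e)%:C else 0).

Definition adjA : 'M[C]_n :=
  \matrix_(i, j) \sum_(e | (src Net e == j) && (tgt Net e == i)) (wgt Net e)%:C.

Definition adjB : 'M[C]_m :=
  \matrix_(e, e') (if tgt Net e' == src Net e then (wgt Net e)%:C else 0).

Definition boundary_space : set 'cV[C]_m := range (fun y : 'cV[C]_n => Psi *m y).

(* graph of A_m *)
Definition op_Am f g : Prop :=
  [/\ Lpv p f, Lpv p g, weak_derivative f g
    & exists2 F, continuous_representative f F & boundary_space (F 1)].

(* Q f = d, for f in D(A_m) *)
Definition op_Q f d : Prop :=
  (exists g, op_Am f g) /\
  exists2 F, continuous_representative f F & d = F 1 - adjB *m F 0.

(* graph of A *)
Definition op_A f g : Prop := op_Am f g /\ op_Q f 0.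

Definition ker_Am (lam : C) : set V := [set f | op_Am f (lam *: f)].

(* Ql is the inverse of Q restricted to ker (lam - A_m). *)
Definition is_Qlam (lam : C) (Ql : 'cV[C]_m -> V) : Prop :=
  (forall d, boundary_space d -> ker_Am lam (Ql d) /\ op_Q (Ql d) d) /\
  (forall f d, ker_Am lam f -> op_Q f d -> same (Lpv_norm p) (Ql d) f).

Variables (T : R -> V -> V) (lam : C) (Ql : 'cV[C]_m -> V) (v : 'cV[C]_n).

Definition op_B (c : C) : 'cV[C]_m := c *: (Psi *m v).

Definition op_Blam (c : C) : V := Ql (op_B c).

(* graph of the controllability map at time t *)
Definition controllability_map (t : R) (u : R -> C) f : Prop :=
  exists z Az : V,
    [/\ bochner_integral (Lpv p) (Lpv_norm p) `[0, t]
          (fun s => T (t - s) (op_Blam (u s))) z,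
        op_A z Az
      & same (Lpv_norm p) f (lam *: z - Az)].

Definition exact_reach (t : R) : set V := [set f | Lpv p f /\
  exists2 u, Lp p `[0, t] u & controllability_map t u f].

Definition exact_reach_all : set V :=
  \bigcup_(t in [set t : R | 0 <= t]) exact_reach t.

End ControlledNetwork.

(* Main.v *)
Require Import Defs.
From HB Require Import structures.
From mathcomp Require Import all_boot all_order all_algebra.
From mathcomp Require Import complex.
From mathcomp Require Import all_classical all_reals all_analysis.
From mathcomp Require Import measurable_realfun ring lra.

(** Between two vertices the system only translates with unit speed, and what
    leaves an edge at s = 0 re-enters the network at s = 1 through B. So extend
    a state x to all rho >= 0 by [ext B x], whose value at rho is
    B ^ floor(rho) x (rho - floor(rho)); the free evolution should be
    T r x = ext B x (r + .) on [0, 1].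

    The semigroup is known through its generator only, and this formula is
    obtained by differentiating windows, that is, integrals of [ext B x] over
    intervals. For y in D(A) the integral of ext B (T s y) over
    [a + r - s, b + r - s] is left continuous in s and has right derivative 0,
    because ext B y is absolutely continuous; so it is constant
    ([window_transport_domain]). The resolvent carries this to all states
    ([window_transport], [semigroup_shift]).

    Let d = Psi v, and let F be the continuous representative of Q_lam d. Its
    extension K = ext B F satisfies K' = lam K, except that it jumps by
    - B ^ k d at k + 1. For an input u, [state] is the integral
    z of u(r) K (t - r + .) over r in [0, t]. Every jump of K contributes a
    translate of u to the derivative of z, so that z' = lam z - f where the
    [profile] f is the sum over k of u (t - 1 - k + .) B ^ k d, u being
    extended by 0; moreover z 1 = B z 0. Hence z is in D(A) and
    (lam - A) z = f ([state_op_A]). The function z is the Bochner integral that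
    defines the controllability map: simple functions that converge to the
    integrand come from simple inputs and from freezing the orbit on short time
    intervals ([controlled_state_bochner]), and the integral is unique because
    windows are bounded linear functionals that determine a class
    ([bochner_window], [controlled_state_unique]). So the states that are
    reached at time t are exactly the profiles ([exact_reachP]).

    The rest is linear algebra. By Cayley-Hamilton, for B or, through
    B Psi = Psi A, for A, all B ^ k d lie in the span of the first
    l = min (m, n) of them ([reach_span]); so a profile is in
    L^p (x) span. Conversely, if t >= l, then the windows
    t - 1 - k <= r < t - k with k < l are disjoint parts of [0, t], and the
    coefficients of
    d, B d, ..., B ^ (l - 1) d in a profile can be prescribed independently
    ([profile_windows]). *)

Set Implicit Arguments.
Unset Strict Implicit.
Unset Printing Implicit Defensive.
Import Order.TTheory GRing.Theory Num.Theory.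
Import numFieldNormedType.Exports.
Local Open Scope classical_set_scope.
Local Open Scope ring_scope.
Local Open Scope complex_scope.

(** * Complex-valued functions on the line *)

Section ComplexNumbers.
Context {R : rcfType}.
Implicit Types x y : R[i].

Lemma ReD x y : complex.Re (x + y) = complex.Re x + complex.Re y.
Proof. by case: x; case: y. Qed.
Lemma ImD x y : complex.Im (x + y) = complex.Im x + complex.Im y.
Proof. by case: x; case: y. Qed.
Lemma ReN x : complex.Re (- x) = - complex.Re x.
Proof. by case: x. Qed.
Lemma ImN x : complex.Im (- x) = - complex.Im x.
Proof. by case: x. Qed.
Lemma Re_mulc x y : complex.Re (x * y) =
  complex.Re x * complex.Re y - complex.Im x * complex.Im y.
Proof. by case: x; case: y. Qed.
Lemma Im_mulc x y : complex.Im (x * y) =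
  complex.Re x * complex.Im y + complex.Im x * complex.Re y.
Proof. by case: x; case: y. Qed.
Lemma complex_eq x y : complex.Re x = complex.Re y ->
  complex.Im x = complex.Im y -> x = y.
Proof. by case: x => a b; case: y => c d /= -> ->. Qed.

Lemma normc_ge0 x : 0 <= Normc.normc x.
Proof. by case: x => a b; exact: sqrtr_ge0. Qed.
Lemma normcD x y : Normc.normc (x + y) <= Normc.normc x + Normc.normc y.
Proof. exact: le_normcD. Qed.
Lemma normcB x y : Normc.normc (x - y) <= Normc.normc x + Normc.normc y.
Proof. by rewrite -(normcN y); exact: le_normcD. Qed.
Lemma normc_real (a : R) : Normc.normc a%:C = `|a|.
Proof. by rewrite /Normc.normc /= expr0n addr0 sqrtr_sqr. Qed.
Lemma normRe_le x : `|complex.Re x| <= Normc.normc x.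
Proof.
by case: x => a b /=; rewrite -sqrtr_sqr ler_wsqrtr// lerDl sqr_ge0.
Qed.
Lemma normIm_le x : `|complex.Im x| <= Normc.normc x.
Proof.
by case: x => a b /=; rewrite -sqrtr_sqr ler_wsqrtr// lerDr sqr_ge0.
Qed.
Lemma normc_le x : Normc.normc x <= `|complex.Re x| + `|complex.Im x|.
Proof.
case: x => a b /=; rewrite -[leRHS]ger0_norm ?addr_ge0// -[leRHS]sqrtr_sqr.
rewrite ler_wsqrtr// sqrrD !real_normK ?num_real// -addrA lerD2l lerDr.
by rewrite mulrn_wge0// mulr_ge0.
Qed.
Lemma normc_sum (I : Type) (r : seq I) (F : I -> R[i]) :
  Normc.normc (\sum_(i <- r) F i) <= \sum_(i <- r) Normc.normc (F i).
Proof.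
elim: r => [|i r IH]; first by rewrite !big_nil Normc.normc0.
by rewrite !big_cons (le_trans (normcD _ _))// lerD2l.
Qed.

End ComplexNumbers.

Section ComplexIntegral.
Context {R : realType}.
Local Notation C := R[i].
Local Notation mu := (@lebesgue_measure R).
Implicit Types (D : set R) (f g : R -> C).

Definition cmeas D f : Prop :=
  measurable_fun D (fun s : R => complex.Re (f s)) /\
  measurable_fun D (fun s : R => complex.Im (f s)).

Definition cintegrable D f : Prop :=
  mu.-integrable D (fun s : R => (complex.Re (f s))%:E) /\
  mu.-integrable D (fun s : R => (complex.Im (f s))%:E).

Lemma cintegrable_cmeas D f : cintegrable D f -> cmeas D f.
Proof.
by move=> [f1 f2]; split; apply/measurable_EFinP; [move: f1|move: f2];
  move=> /measurable_int.
Qed.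

Lemma cmeasS D E f : measurable E -> D `<=` E -> cmeas E f -> cmeas D f.
Proof.
by move=> mE DE [f1 f2]; split; [move: f1|move: f2]; exact: measurable_funS.
Qed.

Lemma cmeas_cst D (c : C) : cmeas D (fun _ => c).
Proof. by split; exact: measurable_cst. Qed.

Lemma cmeasD D f g : cmeas D f -> cmeas D g -> cmeas D (fun s => f s + g s).
Proof.
move=> [f1 f2] [g1 g2]; split.
  by under eq_fun do rewrite ReD; exact: measurable_funD.
by under eq_fun do rewrite ImD; exact: measurable_funD.
Qed.

Lemma cmeasM D f g : cmeas D f -> cmeas D g -> cmeas D (fun s => f s * g s).
Proof.
move=> [f1 f2] [g1 g2]; split.
  by under eq_fun do rewrite Re_mulc; apply: measurable_funB; apply: measurable_funM.
by under eq_fun do rewrite Im_mulc; apply: measurable_funD; apply: measurable_funM.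
Qed.

Lemma cmeasZ D (c : C) f : cmeas D f -> cmeas D (fun s => c * f s).
Proof. by move=> mf; apply: cmeasM => //; exact: cmeas_cst. Qed.

Lemma cmeas_normc D f : cmeas D f ->
  measurable_fun D (fun s : R => Normc.normc (f s)).
Proof.
move=> [f1 f2]; have -> : (fun s => Normc.normc (f s)) =
  Num.sqrt \o (fun s => complex.Re (f s) ^+ 2 + complex.Im (f s) ^+ 2).
  by apply/funext => s /=; case: (f s).
apply: measurableT_comp.
  by apply: continuous_measurable_fun; exact: sqrt_continuous.
by apply: measurable_funD; exact: measurable_funX.
Qed.

Lemma cintegrable_le D f (g : R -> R) : measurable D -> cmeas D f ->
  mu.-integrable D (EFin \o g) -> (forall s, D s -> Normc.normc (f s) <= g s) ->
  cintegrable D f.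
Proof.
move=> mD [f1 f2] ig fg; split; apply: le_integrable ig => //.
- exact/measurable_EFinP.
- move=> s Ds /=; rewrite lee_fin (le_trans (normRe_le _))// (le_trans (fg _ Ds))//.
  exact: ler_norm.
- exact/measurable_EFinP.
- move=> s Ds /=; rewrite lee_fin (le_trans (normIm_le _))// (le_trans (fg _ Ds))//.
  exact: ler_norm.
Qed.

Lemma cintegrable_normc D f : measurable D -> cintegrable D f ->
  mu.-integrable D (EFin \o (fun s => Normc.normc (f s))).
Proof.
move=> mD fi; have [fm1 fm2] := cintegrable_cmeas fi; have [f1 f2] := fi.
have := integrableD (mu:=mu) mD (integrable_abse f1) (integrable_abse f2).
apply: le_integrable => //.
  by apply/measurable_EFinP; exact: cmeas_normc.
move=> s Ds /=; rewrite lee_fin ger0_norm ?normc_ge0//.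
by rewrite (le_trans (normc_le _))// ler_norm.
Qed.

Lemma cintegrableS D E f : measurable E -> measurable D -> D `<=` E ->
  cintegrable E f -> cintegrable D f.
Proof.
by move=> mE mD DE [f1 f2]; split; [move: f1|move: f2]; exact: integrableS.
Qed.

Lemma cintegrable0 D : measurable D -> cintegrable D (fun _ => 0).
Proof. by move=> mD; split; exact: integrable0. Qed.

Lemma cintegrableD D f g : measurable D -> cintegrable D f -> cintegrable D g ->
  cintegrable D (fun s => f s + g s).
Proof.
move=> mD [f1 f2] [g1 g2]; split.
  by under eq_fun do rewrite ReD EFinD; exact: integrableD.
by under eq_fun do rewrite ImD EFinD; exact: integrableD.
Qed.

Lemma cintegralD D f g : measurable D -> cintegrable D f -> cintegrable D g ->
  cintegral D (fun s => f s + g s) = cintegral D f + cintegral D g.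
Proof.
move=> mD [f1 f2] [g1 g2]; apply: complex_eq; rewrite ?ReD ?ImD /=.
  by under eq_Rintegral do rewrite ReD; rewrite RintegralD.
by under eq_Rintegral do rewrite ImD; rewrite RintegralD.
Qed.

Lemma cintegrableZ D c f : measurable D -> cintegrable D f ->
  cintegrable D (fun s => c * f s).
Proof.
move=> mD [f1 f2]; split.
  under eq_fun do rewrite Re_mulc EFinB !EFinM.
  by apply: integrableB => //; apply: integrableZl.
under eq_fun do rewrite Im_mulc EFinD !EFinM.
by apply: integrableD => //; apply: integrableZl.
Qed.

Lemma cintegralZ D c f : measurable D -> cintegrable D f ->
  cintegral D (fun s => c * f s) = c * cintegral D f.
Proof.
move=> mD [f1 f2].
have aux (a : R) (h : R -> R) : mu.-integrable D (EFin \o h) ->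
    mu.-integrable D (EFin \o (fun s => a * h s)).
  by move=> hi; have := integrableZl (mu:=mu) mD a hi; apply: eq_integrable.
apply: complex_eq; rewrite /cintegral ?Re_mulc ?Im_mulc /=.
  under eq_Rintegral do rewrite Re_mulc.
  by rewrite RintegralB ?RintegralZl//; exact: aux.
under eq_Rintegral do rewrite Im_mulc.
by rewrite RintegralD ?RintegralZl//; exact: aux.
Qed.

Lemma eq_cintegral D f g : (forall s, D s -> f s = g s) ->
  cintegral D f = cintegral D g.
Proof.
by move=> fg; rewrite /cintegral; congr Complex; apply: eq_Rintegral => s;
  rewrite inE => Ds; rewrite fg.
Qed.

Lemma eq_cintegrable D f g : measurable D -> (forall s, D s -> f s = g s) ->
  cintegrable D f -> cintegrable D g.
Proof.
move=> mD fg [f1 f2]; split; [move: f1|move: f2]; apply: eq_integrable => // s;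
  by rewrite inE => Ds; rewrite fg.
Qed.

Lemma cintegral0 D : cintegral D (fun _ => 0) = 0.
Proof. by rewrite /cintegral /Rintegral /= !integral0. Qed.

Lemma cintegralN D f : measurable D -> cintegrable D f ->
  cintegral D (fun s => - f s) = - cintegral D f.
Proof.
move=> mD fi; rewrite -[RHS]mulN1r -cintegralZ//; apply: eq_cintegral => s _.
by rewrite mulN1r.
Qed.

Lemma cintegrableN D f : measurable D -> cintegrable D f ->
  cintegrable D (fun s => - f s).
Proof.
move=> mD /(cintegrableZ (-1) mD); apply: eq_cintegrable => // s _.
by rewrite mulN1r.
Qed.

Lemma cintegrable_sum D (I : Type) (r : seq I) (F : I -> R -> C) :
  measurable D -> (forall i, cintegrable D (F i)) ->
  cintegrable D (fun s => \sum_(i <- r) F i s).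
Proof.
move=> mD mF; elim: r => [|i r IH].
  by under eq_fun do rewrite big_nil; exact: cintegrable0.
by under eq_fun do rewrite big_cons; exact: cintegrableD.
Qed.

Lemma cintegral_sum D (I : Type) (r : seq I) (F : I -> R -> C) :
  measurable D -> (forall i, cintegrable D (F i)) ->
  cintegral D (fun s => \sum_(i <- r) F i s) = \sum_(i <- r) cintegral D (F i).
Proof.
move=> mD mF; elim: r => [|i r IH].
  by under eq_fun do rewrite big_nil; rewrite big_nil cintegral0.
under eq_fun do rewrite big_cons.
by rewrite cintegralD// ?IH ?big_cons//; exact: cintegrable_sum.
Qed.

(** Real and imaginary part are estimated separately, which costs the factor
    2. *)
Lemma normc_cintegral_le D f : measurable D -> cintegrable D f ->
  Normc.normc (cintegral D f) <= 2 * \int[mu]_(s in D) Normc.normc (f s).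
Proof.
move=> mD fi; have [f1 f2] := fi; rewrite (le_trans (normc_le _))//= mulr_natl mulr2n.
have ni := cintegrable_normc mD fi.
apply: lerD; (apply: le_trans; [exact: le_normr_Rintegral|]);
  apply: le_Rintegral => //; try exact: integrable_norm.
- by move=> s Ds; exact: normRe_le.
- by move=> s Ds; exact: normIm_le.
Qed.

End ComplexIntegral.

(** * Translations and concatenation of intervals *)

Section RealLine.
Context {R : realType}.
Local Notation mu := (@lebesgue_measure R).
Implicit Types (a b c : R) (f g : R -> R).

Lemma measurable_translate (c : R) : measurable_fun setT (fun s : R => s + c).
Proof. by apply: measurable_funD => //; exact: measurable_id. Qed.

Lemma translate_itv (c : R) (ba bb : bool) (a b : R) :
  (fun s => s + c) @^-1` [set` Interval (BSide ba (a + c)) (BSide bb (b + c))] =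
  [set` Interval (BSide ba a) (BSide bb b)].
Proof.
by apply/seteqP; split => s /=; rewrite !in_itv/=; case: ba; case: bb;
  rewrite /= ?lerD2r ?ltrD2r.
Qed.

(** Lebesgue measure is the only measure that gives every interval its length,
    and a translation preserves lengths. *)
Lemma lebesgue_measure_translate (c : R) (A : set R) : measurable A ->
  mu ((fun s => s + c) @^-1` A) = mu A.
Proof.
move=> mA.
have mt : measurable_fun setT (fun s : measurableTypeR R => s + c : measurableTypeR R).
  exact: measurable_translate.
pose nu : {measure set (measurableTypeR R) -> \bar R} :=
  measure_function_pushforward__canonical__measure_function_Measure mu mt.
apply/esym/(@lebesgue_measure_unique R nu) => //= _ [[a b]] _ <-.
rewrite /nu /= /pushforward -[a](subrK c) -[b](subrK c) translate_itv !lebesgue_measure_itv/=.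
by rewrite !lte_fin !subrK ltrD2r -!EFinB opprB addrA subrK.
Qed.

Lemma measurable_fun_translate d (T : measurableType d) (c : R) (D : set R)
    (f : R -> T) : measurable_fun D f ->
  measurable_fun ((fun s => s + c) @^-1` D) (fun s => f (s + c)).
Proof.
move=> mf mD Y mY.
have mD' : measurable D.
  rewrite (_ : D = (fun s => s - c) @^-1` ((fun s => s + c) @^-1` D)); last first.
    by apply/seteqP; split => s /=; rewrite subrK.
  rewrite -[_ @^-1` _]setTI; exact: measurable_translate.
have := mf mD' Y mY => mDY.
rewrite (_ : _ `&` _ = (fun s => s + c) @^-1` (D `&` f @^-1` Y)) //.
by rewrite -[_ @^-1` _]setTI; exact: measurable_translate.
Qed.

Lemma ge0_integral_translate (c : R) (D : set R) (f : R -> \bar R) :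
  measurable D -> measurable_fun D f -> (forall s, D s -> (0 <= f s)%E) ->
  (\int[mu]_(s in (fun s : R => (s + c)%R) @^-1` D) f (s + c)%R = \int[mu]_(s in D) f s)%E.
Proof.
move=> mD mf f0.
have mt : measurable_fun setT (fun s : measurableTypeR R => s + c : measurableTypeR R).
  exact: measurable_translate.
have := @ge0_integral_pushforward _ _ (measurableTypeR R) (measurableTypeR R) R
  (fun s : measurableTypeR R => s + c : measurableTypeR R) mt mu D f mD mf.
move=> <-; last by move=> s; rewrite inE; exact: f0.
apply: eq_measure_integral => A mA _; exact: lebesgue_measure_translate.
Qed.

Lemma integral_translate (c : R) (D : set R) (f : R -> \bar R) :
  measurable D -> measurable_fun D f ->
  (\int[mu]_(s in (fun s : R => (s + c)%R) @^-1` D) f (s + c)%R = \int[mu]_(s in D) f s)%E.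
Proof.
move=> mD mf; rewrite integralE [RHS]integralE.
rewrite -(@ge0_integral_translate c D (f ^\+)%E)//; last exact: measurable_funepos.
rewrite -(@ge0_integral_translate c D (f ^\-)%E)//; last exact: measurable_funeneg.
by congr (_ - _)%E; apply: eq_integral => s _; rewrite ?funeposE ?funenegE.
Qed.

Lemma integrable_translate (c : R) (D : set R) (f : R -> \bar R) :
  measurable D -> mu.-integrable D f ->
  mu.-integrable ((fun s => s + c) @^-1` D) (fun s => f (s + c)).
Proof.
move=> mD /integrableP[mf foo]; apply/integrableP; split.
  exact: measurable_fun_translate.
by rewrite (@ge0_integral_translate c D (fun s => `|f s|)%E)//; exact: measurableT_comp.
Qed.

Lemma integrable_itv_translate (c a b : R) (f : R -> \bar R) :
  mu.-integrable `[a + c, b + c] f -> mu.-integrable `[a, b] (fun s => f (s + c)).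
Proof. by move=> fi; rewrite -(translate_itv c); exact: integrable_translate. Qed.

Lemma Rintegral_itv_translate (c a b : R) (f : R -> R) :
  measurable_fun `[a + c, b + c] f ->
  \int[mu]_(s in `[a, b]) f (s + c) = \int[mu]_(s in `[a + c, b + c]) f s.
Proof.
move=> mf; rewrite /Rintegral.
rewrite -(@integral_translate c `[a + c, b + c] (fun s => (f s)%:E))//.
  by rewrite translate_itv.
exact/measurable_EFinP.
Qed.

Lemma itv_cc_split (a b c : R) : a <= b -> b <= c ->
  `[a, c]%classic = `[a, b]%classic `|` `]b, c]%classic.
Proof. by move=> ab bc; rewrite -itv_bndbnd_setU// bnd_simp. Qed.

Lemma integrable_itv_cat (a b c : R) (f : R -> \bar R) : a <= b -> b <= c ->
  mu.-integrable `[a, b] f -> mu.-integrable `[b, c] f -> mu.-integrable `[a, c] f.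
Proof.
move=> ab bc /integrableP[m1 i1] /integrableP[m2 i2].
have bcS : `]b, c] `<=` `[b, c] by apply: subset_itvr; rewrite bnd_simp.
have m3 : measurable_fun `]b, c] f by apply: measurable_funS m2.
have mf : measurable_fun `[a, c] f.
  by rewrite (itv_cc_split ab bc); apply/measurable_funU.
apply/integrableP; split => //.
rewrite (itv_cc_split ab bc) ge0_integral_setU//.
- apply: lte_add_pinfty => //; apply: le_lt_trans i2.
  by apply: ge0_subset_integral => //; exact: measurableT_comp.
- by rewrite -(itv_cc_split ab bc); exact: measurableT_comp.
- apply/disj_setPS => s [] /=; rewrite !in_itv /= => /andP[_ sb] /andP[bs _].
  by rewrite ltNge sb in bs.
Qed.

Lemma Rintegral_itv_cat (a b c : R) (f : R -> R) : a <= b -> b <= c ->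
  mu.-integrable `[a, c] (EFin \o f) ->
  \int[mu]_(s in `[a, c]) f s =
  \int[mu]_(s in `[a, b]) f s + \int[mu]_(s in `[b, c]) f s.
Proof.
move=> ab bc fi; have := Rintegral_itvB (x := b) fi.
rewrite !bnd_simp => /(_ ab bc); rewrite Rintegral_itv_obnd_cbnd; last first.
  by apply: integrableS fi => //; apply: subset_itvr; rewrite bnd_simp.
by move=> <-; rewrite addrC subrK.
Qed.

End RealLine.

(** * Monotonicity, primitives and iterated integrals *)

Section RealAnalysis.
Context {R : realType}.
Local Notation mu := (@lebesgue_measure R).

Lemma ae_mono (P Q : R -> Prop) : (forall s, P s -> Q s) ->
  {ae mu, forall s, P s} -> {ae mu, forall s, Q s}.
Proof. by move=> PQ; apply: filterS => //; exact: (ae_filter_ringOfSetsType mu). Qed.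

Lemma ae_and (P Q : R -> Prop) : {ae mu, forall s, P s} ->
  {ae mu, forall s, Q s} -> {ae mu, forall s, P s /\ Q s}.
Proof. by move=> hP hQ; apply: filterI => //; exact: (ae_filter_ringOfSetsType mu). Qed.

(** The times up to which q s <= q 0 + e s holds form an interval. By the
    second hypothesis it contains its supremum, and by the first one the
    supremum can only be r. This allows to integrate a one-sided derivative.
    *)
Lemma almost_nonincreasing (q : R -> R) (r e : R) : 0 <= r -> 0 <= e ->
  (forall s : R, 0 <= s -> s < r -> exists2 d : R, 0 < d &
     forall h : R, 0 < h -> h < d -> s + h <= r -> q (s + h) <= q s + e * h) ->
  (forall s n : R, 0 < s -> s <= r -> 0 < n -> exists2 d : R, 0 < d &
     forall h : R, 0 < h -> h < d -> h <= s -> q s <= q (s - h) + n) ->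
  q r <= q 0 + e * r.
Proof.
move=> r0 e0 qr ql.
pose E := [set s | 0 <= s <= r /\ forall s', 0 <= s' -> s' <= s -> q s' <= q 0 + e * s'].
have E0 : E 0.
  split; first by rewrite lexx.
  by move=> s' a b; rewrite (le_anti (introT andP (conj b a))) mulr0 addr0.
have hE : has_sup E by split; [exists 0|exists r => s [/andP[]]].
have sE := sup_upper_bound hE.
pose s := sup E.
have s0 : 0 <= s by exact: sE.
have sr : s <= r by apply: ge_sup; [exists 0|move=> x [/andP[]]].
have Ebelow x : 0 <= x -> x < s -> q x <= q 0 + e * x.
  move=> x0 xs; have sx : 0 < s - x by rewrite subr_gt0.
  have [y [yr Ey]] := sup_adherent sx hE.
  by rewrite opprB addrC subrK => /ltW xy; exact: Ey.
have qs : q s <= q 0 + e * s.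
  have [->|sn0] := eqVneq s 0; first by rewrite mulr0 addr0.
  have sp : 0 < s by rewrite lt_neqAle eq_sym sn0.
  apply/ler_addgt0Pr => n n0; have [d d0 qd] := ql s n sp sr n0.
  pose h := Num.min (d / 2) (s / 2).
  have h0 : 0 < h by rewrite lt_min !divr_gt0.
  have hd : h < d by rewrite gt_min; apply/orP; left; rewrite ltr_pdivrMr// ltr_pMr// ltr1n.
  have hs : h < s by rewrite gt_min; apply/orP; right; rewrite ltr_pdivrMr// ltr_pMr// ltr1n.
  rewrite (le_trans (qd h h0 hd (ltW hs)))// lerD2r.
  have xs : s - h < s by rewrite ltrBlDr ltrDl.
  rewrite (le_trans (Ebelow (s - h) _ xs))//; first by rewrite subr_ge0 ltW.
  by rewrite lerD2l ler_wpM2l// ltW.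
have Es : E s.
  split; first by rewrite s0.
  move=> x x0; rewrite le_eqVlt => /predU1P[->//|]; exact: Ebelow.
move: (sr); rewrite le_eqVlt => /predU1P[<-//|slr].
have [d d0 qd] := qr s s0 slr.
pose h := Num.min (d / 2) (r - s).
have h0 : 0 < h by rewrite lt_min divr_gt0//= subr_gt0.
have hd : h < d by rewrite gt_min; apply/orP; left; rewrite ltr_pdivrMr// ltr_pMr// ltr1n.
have hr : s + h <= r by rewrite -lerBrDl ge_min lexx orbT.
suff : E (s + h) by move=> /sE; rewrite -/s -lerBrDl subrr leNgt h0.
split; first by rewrite addr_ge0// ltW.
move=> x x0 xsh; have [xs|sx] := leP x s; first by case: Es => _; apply.
have := qd (x - s); rewrite subr_gt0 => /(_ sx); rewrite [s + _]addrC subrK.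
move=> qq; apply: (le_trans (qq _ _)).
- by rewrite (le_lt_trans _ hd)// lerBlDl.
- exact: le_trans hr.
- by move: qs; lra.
Qed.

(** By Lebesgue's differentiation theorem f - g is almost everywhere the
    derivative of its primitive, which vanishes identically. *)
Lemma ae_eq_of_Rintegral (a b : R) (f g : R -> R) : a <= b ->
  mu.-integrable `[a, b] (EFin \o f) -> mu.-integrable `[a, b] (EFin \o g) ->
  (forall x, a <= x <= b ->
    \int[mu]_(s in `[a, x]) f s = \int[mu]_(s in `[a, x]) g s) ->
  {ae mu, forall s : R, s \in `[a, b] -> f s = g s}.
Proof.
move=> ab fi gi fg.
pose h0 s := f s - g s; pose h := h0 \_ `[a, b].
have h0i : mu.-integrable `[a, b] (EFin \o h0) by have := integrableB (mu := mu) (measurable_itv _) fi gi; exact: eq_integrable.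
have hloc : locally_integrable [set: R] h by exact: integrable_locally_restrict.
have hi : mu.-integrable setT (EFin \o h).
  have /integrable_mkcond := h0i; move=> /(_ (measurable_itv _)).
  by rewrite restrict_EFin.
have F0 x : \int[mu]_(t in `]-oo, x]) h t = 0.
  rewrite -Rintegral_mkcondr.
  have [xa|ax] := ltP x a.
    rewrite (_ : _ `&` _ = set0) ?Rintegral_set0//.
    apply/seteqP; split => // s /=; rewrite !in_itv/= => -[sx /andP[as_ _]].
    by have := lt_le_trans xa as_; rewrite ltNge sx.
  pose y := Num.min x b.
  have yab : a <= y <= b by rewrite le_min ax ab/= ge_min lexx orbT.
  have yi : `[a, y] `<=` `[a, b] by apply: subset_itvl; rewrite bnd_simp; case/andP : yab.
  rewrite (_ : _ `&` _ = `[a, y]%classic).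
    have fiy : mu.-integrable `[a, y] (EFin \o f) by exact: integrableS fi.
    have giy : mu.-integrable `[a, y] (EFin \o g) by exact: integrableS gi.
    by rewrite RintegralB// fg// subrr.
  by apply/seteqP; split => s /=; rewrite !in_itv/= le_min; [move=> [-> /andP[-> ->]]|move=> /and3P[-> -> ->]].
have iy y : mu.-integrable `]-oo, y] (EFin \o h) by exact: integrableS hi.
move: (FTC1Ny iy hloc); apply: ae_mono => x [_].
have -> : (fun x : R => \int[mu]_(t in `]-oo, x]) h t) = cst 0.
  by apply/funext => ?; exact: F0.
rewrite derive1_cst /h patchE => + xab.
by rewrite mem_set// /h0 => /esym/eqP; rewrite subr_eq0 => /eqP.
Qed.

Lemma abs_continuity (a b : R) (g : R -> R) :
  mu.-integrable `[a, b] (EFin \o g) -> forall e : R, 0 < e ->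
  exists2 d : R, 0 < d & forall c c', a <= c -> c <= c' -> c' <= b -> c' - c < d ->
    \int[mu]_(s in `[c, c']) `|g s| < e.
Proof.
move=> gi e e0.
have hi : mu.-integrable setT (EFin \o (g \_ `[a, b])).
  have /integrable_mkcond := gi; move=> /(_ (measurable_itv _)).
  by rewrite restrict_EFin.
have [d [d0 dP]] := integral_normr_continuous hi e0.
exists d => // c c' ac cc' c'b cd.
have mcc : (mu `[c, c'] < d%:E)%E.
  by rewrite lebesgue_measure_itv/= lte_fin; case: ifPn => // _; rewrite -EFinD lte_fin.
have := dP `[c, c']%classic (measurable_itv _) mcc.
have -> : \int[mu]_(x in `[c, c']) `|(g \_ `[a, b]) x| = \int[mu]_(s in `[c, c']) `|g s|.
  apply: eq_Rintegral => s; rewrite inE/= in_itv/= => /andP[cs sc'].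
  by rewrite patchE mem_set//= in_itv/= (le_trans ac)//= (le_trans sc').
by [].
Qed.

Lemma integrable_itv_cst (x y c : R) : mu.-integrable `[x, y] (EFin \o cst c).
Proof.
apply: continuous_compact_integrable; first exact: segment_compact.
by apply: continuous_subspaceT => z; exact: cvg_cst.
Qed.

Lemma Rintegral_itv_cst (x y c : R) : x <= y ->
  \int[mu]_(s in `[x, y]) c = c * (y - x).
Proof.
move=> xy; rewrite Rintegral_cst//= lebesgue_measure_itv/= lte_fin.
move: xy; rewrite le_eqVlt => /predU1P[->|->]; last by rewrite -EFinD.
by rewrite ltxx subrr.
Qed.

Lemma integrable_mul_bounded (D : set R) (g k : R -> R) (M : R) : measurable D ->
  mu.-integrable D (EFin \o g) -> measurable_fun D k ->
  (forall s, D s -> `|k s| <= M) -> mu.-integrable D (EFin \o (fun s => g s * k s)).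
Proof.
move=> mD gi km kM.
have := integrableZl (mu := mu) mD M (integrable_abse gi).
apply: le_integrable => //.
  apply/measurable_EFinP; apply: measurable_funM => //.
  by apply/measurable_EFinP; move: gi => /measurable_int.
move=> s Ds /=; rewrite lee_fin normrM [leLHS]mulrC normrM normr_id.
by rewrite ler_wpM2r// (le_trans (kM _ Ds))// ler_norm.
Qed.

Lemma integrable_itv_bounded (x y : R) (k : R -> R) (M : R) :
  measurable_fun `[x, y] k -> (forall s, x <= s -> s <= y -> `|k s| <= M) ->
  mu.-integrable `[x, y] (EFin \o k).
Proof.
move=> km kM; apply: (le_integrable _ _ _ (integrable_itv_cst x y M)) => //.
  exact/measurable_EFinP.
move=> s /=; rewrite in_itv/= => /andP[xs sy]; rewrite lee_fin.
by rewrite (le_trans (kM _ xs sy))// ler_norm.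
Qed.

Lemma derivative_FTC (phi phi' : R -> R) (x y : R) : x <= y ->
  (forall s, derivable phi s 1) -> (phi^`())%classic = phi' -> continuous phi' ->
  phi y - phi x = \int[mu]_(s in `[x, y]) phi' s.
Proof.
rewrite le_eqVlt => /predU1P[<-|xy] dphi phiE cphi'.
  by rewrite set_itv1 Rintegral_set1 subrr.
have cphi z : {for z, continuous phi}.
  by apply: differentiable_continuous; apply/derivable1_diffP.
rewrite /Rintegral (@continuous_FTC2 _ phi' phi x y)//.
- by apply: continuous_subspaceT => z; exact: cphi'.
- split => //; first by apply: cvg_at_right_filter; exact: cphi.
  by apply: cvg_at_left_filter; exact: cphi.
- by move=> z _; rewrite phiE.
Qed.

Lemma eq_Rintegral_support (D E : set R) (k : R -> R) :
  (forall s, D s -> ~ E s -> k s = 0) -> (forall s, E s -> ~ D s -> k s = 0) ->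
  \int[mu]_(s in D) k s = \int[mu]_(s in E) k s.
Proof.
move=> kD kE; rewrite Rintegral_mkcond [RHS]Rintegral_mkcond.
congr Rintegral; apply/funext => s; rewrite !patchE.
case: ifPn => Ds; case: ifPn => Es //.
  by rewrite kD//; [exact: set_mem|move=> /mem_set; exact/negP].
by rewrite kE//; [exact: set_mem|move=> /mem_set; exact/negP].
Qed.

Lemma integrableZlR (D : set R) (c : R) (k : R -> R) : measurable D ->
  mu.-integrable D (EFin \o k) -> mu.-integrable D (EFin \o (fun s => c * k s)).
Proof.
by move=> mD ki; have := integrableZl (mu := mu) mD c ki; exact: eq_integrable.
Qed.

Lemma integrable_patch (D : set R) (k : R -> R) : measurable D ->
  mu.-integrable D (EFin \o k) -> mu.-integrable setT (EFin \o (k \_ D)).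
Proof. by move=> mD ki; rewrite -restrict_EFin; have /integrable_mkcond := ki; apply. Qed.

Lemma EFin_Rintegral (D : set R) (f : R -> R) : measurable D -> mu.-integrable D (EFin \o f) ->
  (\int[mu]_(s in D) (f s)%:E)%E = (\int[mu]_(s in D) f s)%:E.
Proof. by move=> mD fi; rewrite fineK//; apply: integrable_fin_num. Qed.

Lemma integrable_of_patch (D : set R) (k : R -> R) : measurable D ->
  mu.-integrable setT (EFin \o (k \_ D)) -> mu.-integrable D (EFin \o k).
Proof. by move=> mD; rewrite -restrict_EFin => ki; apply/integrable_mkcond. Qed.

(** Fubini's theorem for h extended by 0 outside D x [a, b]. Since g does not
    depend on r, every section of h is integrable, so the real-valued inner
    integrals are meaningful everywhere and not only almost everywhere. *)
Lemma Rfubini (D : set R) (a b : R) (g : R -> R) (h : R -> R -> R) : a <= b ->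
  measurable D -> mu.-integrable D (EFin \o g) ->
  measurable_fun (D `*` `[a, b]) (fun x : R * R => h x.1 x.2) ->
  (forall s r, D s -> `[a, b]%classic r -> `|h s r| <= g s) ->
  [/\ mu.-integrable `[a, b] (EFin \o (fun r => \int[mu]_(s in D) h s r)),
      mu.-integrable D (EFin \o (fun s => \int[mu]_(r in `[a, b]) h s r)) &
      \int[mu]_(r in `[a, b]) (\int[mu]_(s in D) h s r) =
      \int[mu]_(s in D) (\int[mu]_(r in `[a, b]) h s r)].
Proof.
move=> ab mD gi mh hg.
pose I := `[a, b]%classic : set R.
have mI : measurable I by exact: measurable_itv.
have aI : I a by rewrite /I /= in_itv/= lexx.
pose H : R * R -> R := (fun x : R * R => h x.1 x.2) \_ (D `*` I).
have mH : measurable_fun setT H.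
  by apply/(measurable_restrict (fun x : R * R => h x.1 x.2)); rewrite ?setTI//; exact: measurableX.
have HE s r : H (s, r) = if (s \in D) && (r \in I) then h s r else 0.
  by rewrite /H patchE in_setX.
pose gD := g \_ D.
have gD0 s : 0 <= gD s.
  by rewrite /gD patchE; case: ifPn => // /set_mem sD; exact: le_trans (hg s a sD aI).
have gDi : mu.-integrable setT (EFin \o gD) by exact: integrable_patch.
pose c s : R -> R := (cst (gD s)) \_ I.
have ci s : mu.-integrable setT (EFin \o c s).
  by apply: integrable_patch => //; exact: integrable_itv_cst.
have Hc s r : `|H (s, r)| <= c s r.
  rewrite HE /c /gD !patchE; case: ifPn => [/andP[sD rI]|].
    by rewrite sD rI; apply: hg; exact: set_mem.
  by rewrite normr0 => _; case: ifP => // _; exact: gD0.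
have Hg s r : `|H (s, r)| <= gD s.
  by rewrite (le_trans (Hc s r))// /c patchE; case: ifP => // _; exact: gD0.
have cE s : \int[mu]_r c s r = gD s * (b - a).
  by rewrite -Rintegral_mkcond Rintegral_itv_cst.
have mH1 r : measurable_fun setT (fun s => H (s, r)) by exact: measurable_fun_pair1.
have mH2 s : measurable_fun setT (fun r => H (s, r)) by exact: measurable_fun_pair2.
have iH2 s : mu.-integrable setT (EFin \o (fun r => H (s, r))).
  apply: le_integrable (ci s) => //; first by apply/measurable_EFinP; exact: mH2.
  by move=> r _ /=; rewrite lee_fin (le_trans (Hc s r))// ler_norm.
have iH1 r : mu.-integrable setT (EFin \o (fun s => H (s, r))).
  apply: le_integrable gDi => //; first by apply/measurable_EFinP; exact: mH1.
  by move=> s _ /=; rewrite lee_fin (le_trans (Hg s r))// ler_norm.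
have mEH : measurable_fun setT (EFin \o H) by exact/measurable_EFinP.
have iH : (mu \x mu)%E.-integrable setT (EFin \o H).
  apply/(integrable12ltyP mu mu mEH).
  have gci := integrableZlR (b - a) measurableT gDi.
  apply: (@le_lt_trans _ _ (\int[mu]_x ((b - a) * gD x)%:E)%E); last first.
    by rewrite (EFin_Rintegral measurableT gci) ltry.
  apply: ge0_le_integral => //=.
  - by move=> x _; apply: integral_ge0 => y _; rewrite lee_fin.
  - apply: (measurable_fun_fubini_tonelli_F (m2 := mu) (fun z => `|H z|%:E)) => //=.
    by apply/measurable_EFinP; exact: measurableT_comp.
  - exact: measurable_int gci.
  - move=> x _; rewrite mulrC -cE -EFin_Rintegral//; apply: ge0_le_integral => //=.
    + by apply/measurable_EFinP; apply: measurableT_comp => //; exact: mH2.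
    + exact: measurable_int (ci x).
    + by move=> y _; rewrite lee_fin.
have FE : fubini_F mu (EFin \o H) = EFin \o ((fun s => \int[mu]_(r in `[a, b]) h s r) \_ D).
  apply/funext => s; rewrite /fubini_F /= (EFin_Rintegral measurableT (iH2 s)); congr EFin.
  rewrite patchE; case: ifPn => sD.
    rewrite [RHS]Rintegral_mkcond; congr Rintegral; apply/funext => r.
    by rewrite HE sD patchE.
  rewrite (_ : (fun r => H (s, r)) = cst 0); last by apply/funext => r; rewrite HE (negbTE sD).
  by rewrite /Rintegral /= integral0.
have GE : fubini_G mu (EFin \o H) = EFin \o ((fun r => \int[mu]_(s in D) h s r) \_ I).
  apply/funext => r; rewrite /fubini_G /= (EFin_Rintegral measurableT (iH1 r)); congr EFin.
  rewrite patchE; case: ifPn => rI.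
    rewrite [RHS]Rintegral_mkcond; congr Rintegral; apply/funext => s.
    by rewrite HE rI andbT patchE.
  rewrite (_ : (fun s => H (s, r)) = cst 0); last first.
    by apply/funext => s; rewrite HE (negbTE rI) andbF.
  by rewrite /Rintegral /= integral0.
have iF : mu.-integrable setT (EFin \o ((fun s => \int[mu]_(r in `[a, b]) h s r) \_ D)).
  by rewrite -FE; exact: integrable_fubini_F iH.
have iFD : mu.-integrable D (EFin \o (fun s => \int[mu]_(r in `[a, b]) h s r)).
  exact: integrable_of_patch mD iF.
have mG : measurable_fun setT (EFin \o ((fun r => \int[mu]_(s in D) h s r) \_ I)).
  by rewrite -GE; exact: measurable_fubini_G iH.
have iG : mu.-integrable `[a, b] (EFin \o (fun r => \int[mu]_(s in D) h s r)).
  apply: (integrable_itv_bounded (M := \int[mu]_s gD s)).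
    have /measurable_EFinP := mG.
    by move/(measurable_restrict (fun r => \int[mu]_(s in D) h s r) mI measurableT); rewrite setTI.
  move=> r ar rb; have rI : r \in I by apply/mem_set; rewrite /I /= in_itv/= ar rb.
  have -> : \int[mu]_(s in D) h s r = \int[mu]_s H (s, r).
    rewrite [LHS]Rintegral_mkcond; congr Rintegral; apply/funext => s.
    by rewrite HE rI andbT patchE.
  rewrite (le_trans (le_normr_Rintegral _ _))//.
  apply: le_Rintegral => //.
  exact: integrable_norm (iH1 r).
split; [exact: iG|exact: iFD|].
have := Fubini iH; rewrite -/(fubini_F mu (EFin \o H)).
have -> : (\int[mu]_x \int[mu]_y (EFin \o H) (x, y) = \int[mu]_x fubini_F mu (EFin \o H) x)%E by [].
have -> : (\int[mu]_y \int[mu]_x (EFin \o H) (x, y) = \int[mu]_y fubini_G mu (EFin \o H) y)%E by [].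
rewrite FE GE /= => /esym e1.
rewrite Rintegral_mkcond [RHS]Rintegral_mkcond /Rintegral.
by have := congr1 fine e1.
Qed.

Lemma measurable_prod_fst (D E : set R) (f : R -> R) : measurable D -> measurable E ->
  measurable_fun D f -> measurable_fun (D `*` E) (fun x : R * R => f x.1).
Proof.
move=> mD mE mf; apply: (measurable_comp (F := D)) => //.
  by move=> _ [x [xD _] <-].
exact: measurable_funTS.
Qed.

(** * Weak derivatives on the unit interval *)

Lemma test_function_bounded (phi : R -> R) : test_function phi ->
  exists L, forall s, 0 <= s <= 1 -> `|(phi^`())%classic s| <= L.
Proof.
move=> [_ cphi _].
have cn : {within `[0, 1], continuous (fun s : R => `|(phi^`())%classic s|)}.
  apply: continuous_subspaceT => s; apply: cvg_norm; exact: cphi.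
have [c _ cP] := EVT_max ler01 cn.
by exists `|(phi^`())%classic c| => s s01; apply: cP; rewrite in_itv.
Qed.

Lemma test_function0 (phi : R -> R) : test_function phi -> phi 0 = 0 /\ phi 1 = 0.
Proof.
move=> [_ _ [a [b [a0 b1 ph]]]].
by split; apply: ph; rewrite in_itv/= negb_and -!ltNge ?a0// b1 orbT.
Qed.

(** As G s - G 0 is the integral of g over r <= s, the left side is a double
    integral over the triangle r <= s; integrating over s first gives phi 1 -
    phi r = - phi r. *)
Lemma AC_by_parts (g G phi : R -> R) : mu.-integrable `[0, 1] (EFin \o g) ->
  (forall a b, 0 <= a -> a <= b -> b <= 1 -> G b - G a = \int[mu]_(s in `[a, b]) g s) ->
  test_function phi ->
  \int[mu]_(s in `[0, 1]) (G s * (phi^`())%classic s) =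
  - \int[mu]_(s in `[0, 1]) (g s * phi s).
Proof.
move=> gi Gg tphi; have [p0 p1] := test_function0 tphi.
have [L LP] := test_function_bounded tphi; have [dphi cphi' _] := tphi.
set f := (phi^`())%classic in LP cphi' *.
pose I := `[(0 : R), 1]%classic.
have mI : measurable I by exact: measurable_itv.
have mg : measurable_fun I g by apply/measurable_EFinP; move: gi => /measurable_int.
have mf : measurable_fun setT f by exact: continuous_measurable_fun.
have fi : mu.-integrable `[0, 1] (EFin \o f).
  by apply: (integrable_itv_bounded (M := L)); [exact: measurable_funTS|move=> s s0 s1; apply: LP; rewrite s0].
pose h r s := g r * (f s * \1_(`[0, +oo[%classic : set R) (s - r)).
have mh : measurable_fun (I `*` I) (fun x : R * R => h x.1 x.2).
  apply: measurable_funM; first exact: (measurable_prod_fst mI mI mg).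
  apply: measurable_funTS; apply: measurable_funM; first exact: measurableT_comp.
  by apply: measurableT_comp; [exact: measurable_indic|exact: measurable_funB].
have hL r s : `[0, 1]%classic r -> `[0, 1]%classic s -> `|h r s| <= L * `|g r|.
  rewrite /= !in_itv/= => _ s01; rewrite normrM mulrC ler_wpM2r// normrM.
  have fs := LP s s01; apply: le_trans fs; rewrite ler_piMr// indicE.
  by case: (_ \in _); rewrite /= ?normr1 ?normr0.
have [i1 i3] := Rfubini ler01 mI (integrableZlR L mI (integrable_norm gi)) mh hL.
have heavE r s : \1_(`[0, +oo[%classic : set R) (s - r) = (r <= s)%R%:R :> R.
  by rewrite indicE mem_setE in_itv/= subr_ge0 andbT.
have e1 s : `[0, 1]%classic s -> \int[mu]_(r in `[0, 1]) h r s = f s * (G s - G 0).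
  rewrite /= in_itv/= => /andP[s0 s1]; rewrite Gg// -RintegralZl//; last first.
    by apply: integrableS gi => //; apply: subset_itvl; rewrite bnd_simp.
  rewrite [LHS](@eq_Rintegral_support _ `[0, s]).
  - apply: eq_Rintegral => r; rewrite inE/= in_itv/= => /andP[_ rs].
    by rewrite /h heavE rs mulr1 mulrC.
  - move=> r; rewrite /= !in_itv/= => /andP[r0 _]; rewrite r0 /= => /negP/negbTE rs.
    by rewrite /h heavE rs !mulr0.
  - by move=> r; rewrite /= !in_itv/= => /andP[-> rs] []; rewrite (le_trans rs).
have e2 r : `[0, 1]%classic r -> \int[mu]_(s in `[0, 1]) h r s = - (g r * phi r).
  rewrite /= in_itv/= => /andP[r0 r1].
  have fr : mu.-integrable `[r, 1] (EFin \o f).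
    by apply: integrableS fi => //; apply: subset_itvr; rewrite bnd_simp.
  have -> : - (g r * phi r) = g r * \int[mu]_(s in `[r, 1]) f s.
    by rewrite -(derivative_FTC r1 dphi erefl cphi') p1 sub0r mulrN.
  rewrite -RintegralZl// [LHS](@eq_Rintegral_support _ `[r, 1]).
  - apply: eq_Rintegral => s; rewrite inE/= in_itv/= => /andP[rs _].
    by rewrite /h heavE rs mulr1.
  - move=> s; rewrite /= !in_itv/= => /andP[_ s1]; rewrite s1 andbT => /negP/negbTE rs.
    by rewrite /h heavE rs !mulr0.
  - by move=> s; rewrite /= !in_itv/= => /andP[rs ->] []; rewrite (le_trans r0).
move=> H.
have {}H : \int[mu]_(s in `[0, 1]) (f s * (G s - G 0)) = \int[mu]_(r in `[0, 1]) (- (g r * phi r)).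
  transitivity (\int[mu]_(s in `[0, 1]) \int[mu]_(r in I) h r s).
    by apply: eq_Rintegral => s /set_mem sI; rewrite e1.
  by rewrite H; apply: eq_Rintegral => r /set_mem rI; exact: e2.
have gphi : mu.-integrable `[0, 1] (EFin \o (fun r => g r * phi r)).
  apply: eq_integrable (integrableZlR (-1) mI i3) => // r /set_mem rI.
  by rewrite /= e2// mulN1r opprK.
have i2 : mu.-integrable `[0, 1] (EFin \o (fun s => f s * (G s - G 0))).
  by apply: eq_integrable i1 => // s /set_mem sI; rewrite /= e1.
transitivity (\int[mu]_(s in `[0, 1]) (f s * (G s - G 0) + G 0 * f s)).
  by apply: eq_Rintegral => s _; ring.
rewrite RintegralD//; last exact: integrableZlR.
rewrite RintegralZl// -(derivative_FTC ler01 dphi erefl cphi') p0 p1 subrr mulr0 addr0.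
by rewrite H -[RHS]mulN1r -RintegralZl//; apply: eq_Rintegral => s _; rewrite mulN1r.
Qed.

Lemma continuous_mulR (f g : R -> R) : continuous f -> continuous g ->
  continuous (fun s => f s * g s).
Proof. by move=> cf cg s; apply: continuousM; [exact: cf|exact: cg]. Qed.

Lemma continuous_subR (f g : R -> R) : continuous f -> continuous g ->
  continuous (fun s => f s - g s).
Proof. by move=> cf cg s; apply: continuousB; [exact: cf|exact: cg]. Qed.

Lemma continuous_cstR (c : R) : continuous (fun _ : R => c).
Proof. by move=> s; exact: cvg_cst. Qed.

Lemma integrable_support (a b : R) (D : set R) (k : R -> R) : measurable D ->
  continuous k -> (forall s, s \notin `[a, b] -> k s = 0) ->
  mu.-integrable D (EFin \o k).
Proof.
move=> mD ck ks; apply: (@integrableS _ _ _ _ setT) => //.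
have ki : mu.-integrable `[a, b] (EFin \o k).
  apply: continuous_compact_integrable; first exact: segment_compact.
  by apply: continuous_subspaceT => z; exact: ck.
have /integrable_mkcond := ki; move=> /(_ (measurable_itv _)).
apply: eq_integrable => // s _; rewrite restrict_EFin/= patchE.
by case: ifPn => // /negP sab; rewrite ks//; apply/negP => h; apply: sab; rewrite inE.
Qed.

(** The primitive of k lies between 0 and the total integral of k, so it
    vanishes, and so does its derivative k. *)
Lemma continuous_ge0_integral0 (k : R -> R) : continuous k -> (forall s, 0 <= k s) ->
  (forall s, s \notin `[0, 1] -> k s = 0) -> \int[mu]_(s in `[0, 1]) k s = 0 ->
  forall s, k s = 0.
Proof.
move=> ck k0 ks ki0 s.
have ki D : measurable D -> mu.-integrable D (EFin \o k).
  by move=> mD; exact: (integrable_support mD ck ks).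
have K0 x : \int[mu]_(t in `]-oo, x]) k t = 0.
  apply/eqP; rewrite eq_le Rintegral_ge0// andbT -ki0.
  rewrite Rintegral_mkcond [leRHS]Rintegral_mkcond.
  apply: le_Rintegral => //.
  - by apply: integrable_patch => //; exact: ki.
  - by apply: integrable_patch => //; exact: ki.
  move=> t _; rewrite !patchE; case: ifPn => _; case: ifPn => // /negP h.
  by rewrite ks//; apply/negP => h'; apply: h; rewrite inE.
have ss : s < s + 1 by rewrite ltrDl.
have := continuous_FTC1 ss (ki `]-oo, (s + 1)]%classic (measurable_itv _)) _ (ck s).
rewrite ltNyr => /(_ isT)[_] <-.
have -> : (fun x : R => \int[mu]_(t in `]-oo, x]) k t) = cst 0.
  by apply/funext => ?; exact: K0.
by rewrite derive1_cst.
Qed.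

(** The lemma of du Bois-Reymond. Take a bump w that is positive between a and
    b, and the mean c of h with respect to w. Then (h - c) w has integral 0,
    so its primitive is a test function, and testing with it gives that (h -
    c)^2 w has integral 0. *)
Lemma weakly_flat_constant (h : R -> R) (a b : R) : continuous h ->
  (forall phi, test_function phi -> \int[mu]_(s in `[0, 1]) (h s * (phi^`())%classic s) = 0) ->
  0 < a -> a < b -> b < 1 -> exists c, forall s, a < s -> s < b -> h s = c.
Proof.
move=> ch hphi a0 ab b1.
pose w s : R := Num.max 0 ((s - a) * (b - s)).
have cw : continuous w.
  move=> s; apply: (@continuous_max R _ (cst 0) (fun s => (s - a) * (b - s))).
    exact: cvg_cst.
  apply: continuousM; first by apply: continuousB; [exact: cvg_id|exact: cvg_cst].
  by apply: continuousB; [exact: cvg_cst|exact: cvg_id].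
have w0 s : 0 <= w s by rewrite le_max lexx.
have wpos s : a < s -> s < b -> 0 < w s.
  by move=> as_ sb; rewrite lt_max mulr_gt0 ?orbT// subr_gt0.
have wN s : s \notin `[a, b] -> w s = 0.
  rewrite in_itv/= negb_and -!ltNge => sab; apply/max_idPl.
  case/orP: sab => sab; first by rewrite mulr_le0_ge0// ?subr_le0 ?subr_ge0 ltW// (lt_trans sab).
  by rewrite mulr_ge0_le0// ?subr_le0 ?subr_ge0 ltW// (lt_trans ab).
have sub s : s \notin `[0, 1] -> s \notin `[a, b].
  rewrite !in_itv/= => /negP h1; apply/negP => /andP[as_ sb]; apply: h1.
  by rewrite (ltW (lt_le_trans a0 as_)) (ltW (le_lt_trans sb b1)).
have Iw : \int[mu]_(s in `[0, 1]) w s != 0.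
  apply/eqP => Iw0; have m1 : a < (a + b) / 2 by rewrite midf_lt.
  have m2 : (a + b) / 2 < b by rewrite midf_lt.
  have := wpos _ m1 m2; rewrite (continuous_ge0_integral0 cw w0 _ Iw0) ?ltxx//.
  by move=> s /sub; exact: wN.
pose c := (\int[mu]_(s in `[0, 1]) (h s * w s)) / \int[mu]_(s in `[0, 1]) w s.
pose k s := (h s - c) * w s.
have ck : continuous k.
  apply: continuous_mulR => //; apply: continuous_subR => //; exact: continuous_cstR.
have kN s : s \notin `[a, b] -> k s = 0 by move=> /wN; rewrite /k => ->; rewrite mulr0.
have ki D : measurable D -> mu.-integrable D (EFin \o k).
  by move=> mD; exact: (integrable_support mD ck kN).
have hwi : mu.-integrable `[0, 1] (EFin \o (fun s => h s * w s)).
  apply: (@integrable_support a b) => //.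
    exact: continuous_mulR.
  by move=> s /wN ->; rewrite mulr0.
have wi : mu.-integrable `[0, 1] (EFin \o w).
  by apply: (@integrable_support a b).
have cwi : mu.-integrable `[0, 1] (EFin \o (fun s => c * w s)).
  by have := integrableZl (mu := mu) (measurable_itv _) c wi; exact: eq_integrable.
have k01 : \int[mu]_(s in `[0, 1]) k s = 0.
  rewrite /k; under eq_Rintegral do rewrite mulrBl.
  by rewrite RintegralB// RintegralZl// /c divfK// subrr.
pose phi x := \int[mu]_(t in `]-oo, x]) k t.
have phiP x : derivable phi x 1 /\ (phi^`())%classic x = k x.
  have xx : x < x + 1 by rewrite ltrDl.
  have := continuous_FTC1 xx (ki `]-oo, (x + 1)]%classic (measurable_itv _)) _ (ck x).
  by rewrite ltNyr => /(_ isT).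
have phiE : (phi^`())%classic = k by apply/funext => x; case: (phiP x).
have tphi : test_function phi.
  split; first by move=> x; case: (phiP x).
    by rewrite phiE.
  exists a, b; split => //.
  move=> s; rewrite in_itv/= negb_and -!ltNge => /orP[sa|bs]; rewrite /phi.
    rewrite (@eq_Rintegral_support _ set0) ?Rintegral_set0// => t /=.
    rewrite in_itv/= => ts _; apply: kN; rewrite in_itv/= negb_and -!ltNge.
    by rewrite (le_lt_trans ts sa).
  rewrite -k01; apply: eq_Rintegral_support => t /=.
    by move=> _ /negP t01; apply: kN; exact: sub.
  rewrite !in_itv/= => _ /negP; rewrite -ltNge => st; apply: kN.
  by rewrite in_itv/= negb_and -!ltNge (lt_trans bs st) orbT.
have hk : \int[mu]_(s in `[0, 1]) (h s * k s) = 0 by have := hphi _ tphi; rewrite phiE.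
have hki : mu.-integrable `[0, 1] (EFin \o (fun s => h s * k s)).
  apply: (@integrable_support a b) => //.
    exact: continuous_mulR.
  by move=> s /kN ->; rewrite mulr0.
have cki : mu.-integrable `[0, 1] (EFin \o (fun s => c * k s)).
  by apply: integrableZlR => //; exact: ki.
pose k2 s := (h s - c) * k s.
have k20 : \int[mu]_(s in `[0, 1]) k2 s = 0.
  rewrite /k2; under eq_Rintegral do rewrite mulrBl.
  rewrite RintegralB// RintegralZl//; last exact: ki.
  by rewrite hk k01 mulr0 subrr.
have k2z : forall s, k2 s = 0.
  apply: continuous_ge0_integral0 => //.
  - apply: continuous_mulR => //; apply: continuous_subR => //; exact: continuous_cstR.
  - by move=> s; rewrite /k2 /k mulrA -expr2 mulr_ge0// sqr_ge0.
  - by move=> s /sub /kN; rewrite /k2 => ->; rewrite mulr0.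
exists c => s as_ sb; have /eqP := k2z s.
rewrite /k2 /k !mulf_eq0 (gt_eqF (wpos _ as_ sb)) orbF orbb subr_eq0.
by move=> /eqP.
Qed.

Lemma clamp_itv (s : R) : `[0, 1]%classic (Num.max 0 (Num.min 1 s)).
Proof. by rewrite /= in_itv/= le_max lexx ge_max ler01 ge_min lexx. Qed.

Lemma clamp_id (s : R) : 0 <= s -> s <= 1 -> Num.max 0 (Num.min 1 s) = s.
Proof. by move=> s0 s1; rewrite (min_idPr s1) (max_idPr s0). Qed.

Lemma continuous_clamp (F : R -> R) : {within `[0, 1], continuous F} ->
  continuous (fun s : R => F (Num.max 0 (Num.min 1 s))).
Proof.
move=> /subspace_continuousP cF s.
pose cl (s : R) : R := Num.max 0 (Num.min 1 s).
have cc : continuous cl.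
  move=> {}s.
  apply: (@continuous_max R R (cst 0) (fun s : R => Num.min 1 s : R)); first exact: cvg_cst.
  apply: (@continuous_min R R (cst 1) id); first exact: cvg_cst.
  exact: cvg_id.
apply: cvg_trans (cF _ (clamp_itv s)) => A /= FA.
have FA' : nbhs (cl s) [set x | `[0, 1]%classic x -> A (F x)] by exact: FA.
have cFA : nbhs s [set y | `[0, 1]%classic (cl y) -> A (F (cl y))] := cc s _ FA'.
suff : nbhs s [set x | A (F (cl x))] by [].
by apply: filterS cFA => x /=; apply; exact: clamp_itv.
Qed.

Lemma ae_eq_Rintegral (D : set R) (f g : R -> R) : measurable D ->
  measurable_fun D f -> measurable_fun D g ->
  {ae mu, forall s, D s -> f s = g s} ->
  \int[mu]_(s in D) f s = \int[mu]_(s in D) g s.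
Proof.
move=> mD mf mg fg; congr fine; apply: ae_eq_integral => //.
- exact/measurable_EFinP.
- exact/measurable_EFinP.
- by move: fg; apply: ae_mono => s fgs Ds; rewrite fgs.
Qed.

Lemma continuous_within_measurable (a b : R) (F : R -> R) :
  {within `[a, b], continuous F} -> measurable_fun `[a, b] F.
Proof. by move=> /(subspace_continuous_measurable_fun (measurable_itv _)). Qed.

(** The difference of F and a primitive of g has weak derivative 0, so it is
    constant inside [0, 1] by [weakly_flat_constant], and on [0, 1] by
    continuity. Clamping the variable to [0, 1] turns it into a continuous
    function on the line. *)
Lemma weak_derivative_FTC (f g F : R -> R) :
  mu.-integrable `[0, 1] (EFin \o f) -> mu.-integrable `[0, 1] (EFin \o g) ->
  {within `[0, 1], continuous F} ->
  {ae mu, forall s : R, s \in `[0, 1] -> F s = f s} ->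
  (forall phi, test_function phi ->
     \int[mu]_(s in `[0, 1]) (f s * (phi^`())%classic s) =
     - \int[mu]_(s in `[0, 1]) (g s * phi s)) ->
  forall a b, 0 <= a -> a <= b -> b <= 1 -> F b - F a = \int[mu]_(s in `[a, b]) g s.
Proof.
move=> fi gi cF Ff fg.
pose G x := \int[mu]_(s in `[0, x]) g s.
have Gg x y : 0 <= x -> x <= y -> y <= 1 -> G y - G x = \int[mu]_(s in `[x, y]) g s.
  move=> x0 xy y1; rewrite /G (Rintegral_itv_cat x0 xy) 1?addrC ?addKr//.
  by apply: integrableS gi => //; apply: subset_itvl; rewrite bnd_simp.
have cG : {within `[0, 1], continuous G} := parameterized_integral_continuous ler01 gi.
pose cl s : R := Num.max 0 (Num.min 1 s).
pose h s := F (cl s) - G (cl s).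
have ch : continuous h.
  by apply: continuous_subR; exact: continuous_clamp.
have mF := continuous_within_measurable cF.
have mG := continuous_within_measurable cG.
have cmp (k : R -> R) : {within `[0, 1], continuous k} -> mu.-integrable `[0, 1] (EFin \o k).
  by move=> ck; apply: continuous_compact_integrable => //; exact: segment_compact.
have hphi phi : test_function phi ->
    \int[mu]_(s in `[0, 1]) (h s * (phi^`())%classic s) = 0.
  move=> tphi; have [L Lp] := test_function_bounded tphi.
  have [dphi cphi' _] := tphi.
  have mp : measurable_fun `[(0 : R), 1] (phi^`())%classic.
    by apply: measurable_funTS; exact: continuous_measurable_fun.
  have Lp' (s : R) : `[0, 1]%classic s -> `|(phi^`())%classic s| <= L.
    by move=> /=; rewrite in_itv/=; exact: Lp.
  have Fpi := integrable_mul_bounded (D := `[(0 : R), 1]%classic) (measurable_itv _) (cmp _ cF) mp Lp'.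
  have Gpi := integrable_mul_bounded (D := `[(0 : R), 1]%classic) (measurable_itv _) (cmp _ cG) mp Lp'.
  transitivity (\int[mu]_(s in `[0, 1]) (F s * (phi^`())%classic s - G s * (phi^`())%classic s)).
    apply: eq_Rintegral => s; rewrite inE/= in_itv/= => /andP[s0 s1].
    by rewrite /h /cl clamp_id// mulrBl.
  rewrite RintegralB// (AC_by_parts gi Gg tphi).
  rewrite (@ae_eq_Rintegral _ _ (fun s => f s * (phi^`())%classic s))//.
  - by rewrite fg// opprK addNr.
  - exact: measurable_funM.
  - apply: measurable_funM => //.
    by apply/measurable_EFinP; move: fi => /measurable_int.
  - by move: Ff; apply: ae_mono => s Fs s01; rewrite Fs.
have hc x y : 0 < x -> x < y -> y < 1 -> h x = h y.
  move=> x0 xy y1.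
  have x2 : x / 2 < x by rewrite ltr_pdivrMr// ltr_pMr// ltr1n.
  have y2 : y < (y + 1) / 2 by rewrite midf_lt.
  have [|||c hc] := weakly_flat_constant (a := x / 2) (b := (y + 1) / 2) ch hphi.
  - by rewrite divr_gt0.
  - exact: lt_trans x2 (lt_trans xy y2).
  - by rewrite midf_lt.
  - by rewrite !hc//; [exact: lt_trans xy|exact: lt_trans y2].
have h12 : forall x, 0 < x -> x < 1 -> h x = h (1 / 2).
  move=> x x0 x1; have [xl|xl|->//] := ltgtP x (1 / 2).
    by apply: hc => //; rewrite ltr_pdivrMr// mul1r ltr1n.
  by rewrite -(hc (1/2) x)// divr_gt0.
have h0 : h 0 = h (1 / 2).
  have : h x @[x --> 0^'+] --> h 0 by apply: cvg_at_right_filter; exact: ch.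
  move=> /cvg_lim <- //; apply: cvg_lim => //.
  apply: cvg_near_cst; near=> x; rewrite h12//.
have h1 : h 1 = h (1 / 2).
  have : h x @[x --> 1^'-] --> h 1 by apply: cvg_at_left_filter; exact: ch.
  move=> /cvg_lim <- //; apply: cvg_lim => //.
  apply: cvg_near_cst; near=> x; rewrite h12//.
have hall x : 0 <= x -> x <= 1 -> h x = h (1 / 2).
  rewrite le_eqVlt => /predU1P[<-//|x0]; rewrite le_eqVlt => /predU1P[->//|x1].
  exact: h12.
move=> a b a0 ab b1.
have a1 : a <= 1 := le_trans ab b1.
have b0 : 0 <= b := le_trans a0 ab.
have : h b = h a by rewrite (hall a a0 a1) (hall b b0 b1).
rewrite /h /cl (clamp_id a0 a1) (clamp_id b0 b1) => hba.
by rewrite -Gg// -[F b](subrK (G b)) hba; ring.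
Unshelve. all: by end_near. Qed.

End RealAnalysis.

(** * Complex and vector-valued p-integrable functions *)

Section VectorFunctions.
Context {R : realType}.
Local Notation C := R[i].
Local Notation mu := (@lebesgue_measure R).
Implicit Types (D : set R).

Lemma integrableDR D (f g : R -> R) : measurable D ->
  mu.-integrable D (EFin \o f) -> mu.-integrable D (EFin \o g) ->
  mu.-integrable D (EFin \o (fun s => f s + g s)).
Proof.
by move=> mD fi gi; have := integrableD (mu := mu) mD fi gi; exact: eq_integrable.
Qed.

Lemma integrable_sumR D (I : Type) (r : seq I) (F : I -> R -> R) : measurable D ->
  (forall i, mu.-integrable D (EFin \o F i)) ->
  mu.-integrable D (EFin \o (fun s => \sum_(i <- r) F i s)).
Proof.
move=> mD Fi; elim: r => [|i r IH].
  by under eq_fun do rewrite big_nil; exact: integrable0.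
by under eq_fun do rewrite big_cons; exact: integrableDR.
Qed.

Lemma Rintegral_sum D (I : Type) (r : seq I) (F : I -> R -> R) : measurable D ->
  (forall i, mu.-integrable D (EFin \o F i)) ->
  \int[mu]_(s in D) (\sum_(i <- r) F i s) = \sum_(i <- r) \int[mu]_(s in D) F i s.
Proof.
move=> mD Fi; elim: r => [|i r IH].
  under eq_Rintegral do rewrite big_nil; rewrite big_nil.
  by rewrite /Rintegral integral0.
under eq_Rintegral do rewrite big_cons; rewrite RintegralD ?IH ?big_cons//.
exact: integrable_sumR.
Qed.

Lemma cintegrable_itv_cat (a b c : R) (f : R -> C) : a <= b -> b <= c ->
  cintegrable `[a, b] f -> cintegrable `[b, c] f -> cintegrable `[a, c] f.
Proof. by move=> ab bc [f1 f2] [f3 f4]; split; apply: integrable_itv_cat bc _ _. Qed.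

Lemma cintegral_itv_cat (a b c : R) (f : R -> C) : a <= b -> b <= c ->
  cintegrable `[a, c] f ->
  cintegral `[a, c] f = cintegral `[a, b] f + cintegral `[b, c] f.
Proof.
move=> ab bc [f1 f2]; apply: complex_eq; rewrite ?ReD ?ImD /=.
  exact: Rintegral_itv_cat.
exact: Rintegral_itv_cat.
Qed.

Lemma cintegrable_itv_translate (c a b : R) (f : R -> C) :
  cintegrable `[a + c, b + c] f -> cintegrable `[a, b] (fun s => f (s + c)).
Proof.
move=> [f1 f2]; split.
  exact: (integrable_itv_translate (f := fun s => (complex.Re (f s))%:E)).
exact: (integrable_itv_translate (f := fun s => (complex.Im (f s))%:E)).
Qed.

Lemma cintegral_itv_translate (c a b : R) (f : R -> C) :
  cmeas `[a + c, b + c] f ->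
  cintegral `[a, b] (fun s => f (s + c)) = cintegral `[a + c, b + c] f.
Proof.
move=> [f1 f2]; apply: complex_eq => /=.
  exact: (Rintegral_itv_translate (f := fun s => complex.Re (f s))).
exact: (Rintegral_itv_translate (f := fun s => complex.Im (f s))).
Qed.

Lemma ae_eq_of_cintegral (a b : R) (f g : R -> C) : a <= b ->
  cintegrable `[a, b] f -> cintegrable `[a, b] g ->
  (forall x, a <= x <= b -> cintegral `[a, x] f = cintegral `[a, x] g) ->
  {ae mu, forall s : R, s \in `[a, b] -> f s = g s}.
Proof.
move=> ab [f1 f2] [g1 g2] fg.
have h1 : {ae mu, forall s : R, s \in `[a, b] -> complex.Re (f s) = complex.Re (g s)}.
  by apply: ae_eq_of_Rintegral => // x xab; have := congr1 (@complex.Re R) (fg x xab).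
have h2 : {ae mu, forall s : R, s \in `[a, b] -> complex.Im (f s) = complex.Im (g s)}.
  by apply: ae_eq_of_Rintegral => // x xab; have := congr1 (@complex.Im R) (fg x xab).
have := ae_and h1 h2; apply: ae_mono => s [H1 H2] sab.
by apply: complex_eq; [exact: H1|exact: H2].
Qed.

Lemma ae_eq_cintegral D (f g : R -> C) : measurable D -> cmeas D f -> cmeas D g ->
  {ae mu, forall s, D s -> f s = g s} -> cintegral D f = cintegral D g.
Proof.
move=> mD [f1 f2] [g1 g2] fg; apply: complex_eq => /=; apply: ae_eq_Rintegral => //;
  by move: fg; apply: ae_mono => s fgs Ds; rewrite fgs.
Qed.

Lemma Lnorm_patchE (p : R) D (k : R -> R) : 0 < p -> (forall s, 0 <= k s) ->
  ('N[mu]_(p%:E)[(fun s => (k s)%:E) \_ D] =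
   (\int[mu]_(s in D) (k s `^ p)%:E) `^ p^-1)%E.
Proof.
move=> p0 k0; rewrite unlock /Lnorm; congr (_ `^ _)%E.
rewrite [RHS]integral_mkcond; apply: eq_integral => s _; rewrite !patchE.
case: ifPn => _ /=; first by rewrite ger0_norm// poweR_EFin.
by rewrite normr0 powR0// gt_eqF.
Qed.

Lemma measurable_powR_comp (p : R) D (k : R -> R) : measurable_fun D k ->
  measurable_fun D (fun s => k s `^ p).
Proof. by move=> mk; apply: (measurableT_comp (f := (@powR R)^~ p)) => //; exact: measurable_powR. Qed.

Lemma integrable_powRP (p : R) D (k : R -> R) : measurable_fun D k ->
  mu.-integrable D (EFin \o (fun s => k s `^ p)) <->
  (\int[mu]_(s in D) (k s `^ p)%:E < +oo)%E.
Proof.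
move=> mk.
have E : (\int[mu]_(s in D) `|(k s `^ p)%:E| = \int[mu]_(s in D) (k s `^ p)%:E)%E.
  by apply: eq_integral => s _; rewrite /= ger0_norm// powR_ge0.
split=> [/integrableP[_]|h]; first by rewrite E.
apply/integrableP; split; last by rewrite E.
by apply/measurable_EFinP; exact: measurable_powR_comp.
Qed.

Lemma LpP (p : R) D (f : R -> C) : 1 <= p ->
  Lp p D f <-> cmeas D f /\
    mu.-integrable D (EFin \o (fun s => Normc.normc (f s) `^ p)).
Proof.
move=> p1; have p0 : 0 < p by rewrite (lt_le_trans ltr01).
rewrite /Lp /= Lnorm_patchE//; last by move=> s; exact: normc_ge0.
split=> [[m1 m2 fi]|[[m1 m2] fi]].
  split=> //; apply/integrable_powRP; first exact: cmeas_normc.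
  by apply: lty_poweRy fi; rewrite invr_neq0// gt_eqF.
split=> //; apply: poweR_lty; apply/integrable_powRP => //; exact: cmeas_normc.
Qed.

Lemma powR_mono (r a b : R) : 0 <= r -> 0 <= a -> a <= b -> a `^ r <= b `^ r.
Proof.
move=> r0 a0 ab; apply: (ge0_ler_powR r0) => //.
by rewrite nnegrE (le_trans a0).
Qed.

(** From a + b <= 2 max (a, b). *)
Lemma powRD_le (p a b : R) : 0 < p -> 0 <= a -> 0 <= b ->
  (a + b) `^ p <= 2 `^ p * (a `^ p + b `^ p).
Proof.
move=> p0 a0 b0.
have le2 : a + b <= 2 * Num.max a b.
  by rewrite mulr_natl mulr2n lerD// le_max lexx ?orbT.
have M0 : 0 <= Num.max a b by rewrite le_max a0.
apply: (@le_trans _ _ ((2 * Num.max a b) `^ p)).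
  by apply: ge0_ler_powR => //; rewrite ?nnegrE ?(ltW p0) ?addr_ge0// mulr_ge0.
rewrite powRM// ler_wpM2l ?powR_ge0//.
by case: (leP a b) => _; rewrite ?lerDl ?lerDr powR_ge0.
Qed.

Lemma Lp_le (p : R) D (f g : R -> C) (c : R) : 1 <= p -> measurable D -> cmeas D f ->
  Lp p D g -> 0 <= c ->
  (forall s, D s -> Normc.normc (f s) <= c * Normc.normc (g s)) -> Lp p D f.
Proof.
move=> p1 mD mf /(LpP D g p1)[mg gi] c0 fg; apply/LpP => //; split=> //.
have p0 : 0 <= p by rewrite (le_trans ler01).
apply: (le_integrable _ _ _ (integrableZlR (c `^ p) mD gi)) => //.
  by apply/measurable_EFinP; apply: measurable_powR_comp; exact: cmeas_normc.
move=> s Ds /=; rewrite lee_fin !ger0_norm ?mulr_ge0 ?powR_ge0//.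
rewrite -powRM ?normc_ge0//; apply: ge0_ler_powR; rewrite ?nnegrE ?normc_ge0 ?mulr_ge0 ?normc_ge0//.
exact: fg.
Qed.

Lemma LpD (p : R) D (f g : R -> C) : 1 <= p -> measurable D ->
  Lp p D f -> Lp p D g -> Lp p D (fun s => f s + g s).
Proof.
move=> p1 mD /(LpP _ _ p1)[mf fi] /(LpP _ _ p1)[mg gi]; apply/LpP => //.
have p0 : 0 < p by rewrite (lt_le_trans ltr01).
have mfg := cmeasD mf mg; split=> //.
have fgi := integrableZlR (2 `^ p) mD (integrableD (mu := mu) mD fi gi).
apply: (le_integrable _ _ _ fgi) => //.
  by apply/measurable_EFinP; apply: measurable_powR_comp; exact: cmeas_normc.
move=> s Ds /=; rewrite lee_fin !ger0_norm ?mulr_ge0 ?addr_ge0 ?powR_ge0//.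
apply: le_trans (powRD_le _ _ _) => //; rewrite ?normc_ge0//.
by apply: ge0_ler_powR; rewrite ?nnegrE ?addr_ge0 ?normc_ge0 ?normcD ?(ltW p0).
Qed.

Lemma Lp0 (p : R) D : 1 <= p -> measurable D -> Lp p D (fun _ => 0).
Proof.
move=> p1 mD; apply/LpP => //; split; first exact: cmeas_cst.
have p0 : 0 < p by rewrite (lt_le_trans ltr01).
under eq_fun do rewrite Normc.normc0 powR0 ?gt_eqF//.
exact: integrable0.
Qed.

Lemma Lp_cmeas (p : R) D f : Lp p D f -> cmeas D f.
Proof. by case. Qed.

Lemma LpZ (p : R) D (c : C) (f : R -> C) : 1 <= p -> measurable D ->
  Lp p D f -> Lp p D (fun s => c * f s).
Proof.
move=> p1 mD fp; apply: (Lp_le (c := Normc.normc c) p1 mD _ fp).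
- by apply: cmeasZ; exact: Lp_cmeas fp.
- exact: normc_ge0.
- by move=> s _; rewrite Normc.normcM.
Qed.

Lemma Lp_sum (p : R) D (I : Type) (r : seq I) (F : I -> R -> C) : 1 <= p -> measurable D ->
  (forall i, Lp p D (F i)) -> Lp p D (fun s => \sum_(i <- r) F i s).
Proof.
move=> p1 mD FL; elim: r => [|i r IH].
  by under eq_fun do rewrite big_nil; exact: Lp0.
by under eq_fun do rewrite big_cons; exact: LpD.
Qed.

Lemma Lp_normc (p : R) D (f : R -> C) : 1 <= p -> measurable D ->
  Lp p D f -> Lp p D (fun s => (Normc.normc (f s))%:C).
Proof.
move=> p1 mD fp; apply: (Lp_le (c := 1) p1 mD _ fp) => //.
  split; last exact: measurable_cst.
  by apply: cmeas_normc; exact: Lp_cmeas fp.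
by move=> s _; rewrite normc_real mul1r ger0_norm// normc_ge0.
Qed.

Lemma eq_Lp (p : R) D (f g : R -> C) : measurable D -> 1 <= p ->
  (forall s, D s -> f s = g s) -> Lp p D f -> Lp p D g.
Proof.
move=> mD p1 fg [m1 m2 fi].
have mg : cmeas D g.
  split; [move: m1|move: m2]; apply: eq_measurable_fun => s; rewrite inE => Ds;
  by rewrite fg.
apply: (Lp_le (c := 1) (g := f) p1 mD mg) => //.
by move=> s Ds; rewrite fg// mul1r.
Qed.

(** For all M > 0 one has k <= M + M (k / M)^p: look at k <= M and at k > M
    separately. Integrate, and let M decrease to the p-norm of k. *)
Lemma le_Rintegral_powR (p : R) (a b : R) (k : R -> R) : 1 <= p -> a <= b ->
  measurable_fun `[a, b] k -> (forall s, 0 <= k s) ->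
  mu.-integrable `[a, b] (EFin \o (fun s => k s `^ p)) ->
  mu.-integrable `[a, b] (EFin \o k) /\
  \int[mu]_(s in `[a, b]) k s <=
    (b - a + 1) * (\int[mu]_(s in `[a, b]) (k s `^ p)) `^ p^-1.
Proof.
move=> p1 ab mk k0 ki; have p0 : 0 < p by rewrite (lt_le_trans ltr01).
set J := \int[mu]_(s in `[a, b]) (k s `^ p).
have J0 : 0 <= J by apply: Rintegral_ge0 => s _; exact: powR_ge0.
have kle M s : 0 < M -> k s <= M + (M * M^-1 `^ p) * k s `^ p.
  move=> M0; rewrite -mulrA -powRM ?invr_ge0 ?(ltW M0)//.
  rewrite -[X in X + _]mulr1 -mulrDr -ler_pdivrMl//.
  have kM0 : 0 <= M^-1 * k s by rewrite mulr_ge0// invr_ge0 ltW.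
  have [h|h] := leP (M^-1 * k s) 1; first by rewrite ler_wpDr// powR_ge0.
  by rewrite ler_wpDl// le1r_powR// ltW.
have bnd M : mu.-integrable `[a, b] (EFin \o (fun s => M + (M * M^-1 `^ p) * k s `^ p)).
  apply: integrableDR => //; first exact: integrable_itv_cst.
  exact: integrableZlR.
have k1 : mu.-integrable `[a, b] (EFin \o k).
  apply: (le_integrable _ _ _ (bnd 1)) => //; first exact/measurable_EFinP.
  move=> s _; rewrite lee_fin ger0_norm//.
  by rewrite (le_trans (kle 1 s ltr01))// ler_norm.
split=> //; apply/ler_addgt0Pr => e e0.
have ba : 0 < b - a + 1 by rewrite ltr_wpDl// subr_ge0.
pose M := J `^ p^-1 + e / (b - a + 1).
have M0 : 0 < M by rewrite ltr_wpDl ?powR_ge0// divr_gt0.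
have -> : (b - a + 1) * J `^ p^-1 + e = (b - a + 1) * M.
  by rewrite /M mulrDr [X in _ = _ + X]mulrC divfK// gt_eqF.
apply: (@le_trans _ _ (\int[mu]_(s in `[a, b]) (M + (M * M^-1 `^ p) * k s `^ p))).
  by apply: le_Rintegral => // s _; exact: kle.
rewrite RintegralD//; last 2 first.
  exact: integrable_itv_cst.
  exact: integrableZlR.
rewrite Rintegral_itv_cst// RintegralZl// -/J [leRHS]mulrDl mul1r [X in X + _]mulrC lerD2l.
rewrite -mulrA ler_piMr ?(ltW M0)//.
have JM : J <= M `^ p.
  have {1}-> : J = (J `^ p^-1) `^ p by rewrite -powRrM mulVf ?gt_eqF// powRr1.
  apply: ge0_ler_powR; rewrite ?nnegrE ?powR_ge0 ?(ltW p0) ?(ltW M0)//.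
  by rewrite lerDl ltW// divr_gt0.
apply: (le_trans (ler_wpM2l (powR_ge0 _ _) JM)).
by rewrite -powRM ?invr_ge0 ?(ltW M0)// mulVf ?gt_eqF// powR1.
Qed.

Lemma Lp_cintegrable (p : R) (a b : R) (f : R -> C) : 1 <= p -> a <= b ->
  Lp p `[a, b] f -> cintegrable `[a, b] f.
Proof.
move=> p1 ab /(LpP _ _ p1)[mf fi].
have [i1 _] := le_Rintegral_powR p1 ab (cmeas_normc mf) (fun s => normc_ge0 _) fi.
exact: cintegrable_le i1 _.
Qed.

Section Vectors.
Variable m : nat.
Implicit Types (f g : R -> 'cV[C]_m) (d : 'cV[C]_m).

Definition cvnorm d : R := \sum_j Normc.normc (d j 0).

Definition vmeas D f : Prop := forall j, cmeas D (fun s => f s j 0).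
Definition vintegrable D f : Prop := forall j, cintegrable D (fun s => f s j 0).
Definition vintegral D f : 'cV[C]_m := \col_j cintegral D (fun s => f s j 0).

Lemma cvnorm_ge0 d : 0 <= cvnorm d.
Proof. by apply: sumr_ge0 => j _; exact: normc_ge0. Qed.

Lemma cvnormD d e : cvnorm (d + e) <= cvnorm d + cvnorm e.
Proof.
rewrite /cvnorm -big_split/=; apply: ler_sum => j _; rewrite mxE; exact: normcD.
Qed.

Lemma cvnormZ (c : C) d : cvnorm (c *: d) = Normc.normc c * cvnorm d.
Proof.
by rewrite /cvnorm mulr_sumr; apply: eq_bigr => j _; rewrite mxE Normc.normcM.
Qed.

Lemma cvnormN d : cvnorm (- d) = cvnorm d.
Proof. by apply: eq_bigr => j _; rewrite mxE normcN. Qed.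

Lemma cvnormB d e : cvnorm (d - e) <= cvnorm d + cvnorm e.
Proof. by rewrite -(cvnormN e); exact: cvnormD. Qed.

Lemma cvnorm0 : cvnorm 0 = 0.
Proof. by apply: big1 => j _; rewrite mxE Normc.normc0. Qed.

Lemma cvnorm_sum (I : Type) (r : seq I) (F : I -> 'cV[C]_m) :
  cvnorm (\sum_(i <- r) F i) <= \sum_(i <- r) cvnorm (F i).
Proof.
elim: r => [|i r IH]; first by rewrite !big_nil cvnorm0.
by rewrite !big_cons (le_trans (cvnormD _ _))// lerD2l.
Qed.

Lemma normc_le_cvnorm d j : Normc.normc (d j 0) <= cvnorm d.
Proof.
by rewrite /cvnorm (bigD1 j)//= lerDl sumr_ge0// => k _; exact: normc_ge0.
Qed.

Lemma cvnorm_eq0 d : cvnorm d <= 0 -> d = 0.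
Proof.
move=> d0; apply/matrixP => j k; rewrite ord1 mxE.
apply: Normc.eq0_normc; apply/eqP; rewrite eq_le normc_ge0 andbT.
exact: le_trans (normc_le_cvnorm d j) d0.
Qed.

(** A bound on the operator norm of M with respect to [cvnorm]. *)
Definition mxbound (M : 'M[C]_m) : R := \sum_i \sum_j Normc.normc (M i j).

Lemma mxbound_ge0 M : 0 <= mxbound M.
Proof. by apply: sumr_ge0 => i _; apply: sumr_ge0 => j _; exact: normc_ge0. Qed.

Lemma cvnorm_mulmx M d : cvnorm (M *m d) <= mxbound M * cvnorm d.
Proof.
rewrite /mxbound mulr_suml; apply: ler_sum => i _; rewrite mxE.
rewrite (le_trans (normc_sum _ _))// mulr_suml; apply: ler_sum => j _.
by rewrite Normc.normcM ler_wpM2l ?normc_ge0// normc_le_cvnorm.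
Qed.

Lemma vintegrable_vmeas D f : vintegrable D f -> vmeas D f.
Proof. by move=> fi j; exact: cintegrable_cmeas. Qed.

Lemma vmeasS D E f : measurable E -> D `<=` E -> vmeas E f -> vmeas D f.
Proof. by move=> mE DE mf j; exact: cmeasS (mf j). Qed.

Lemma vmeasD D f g : vmeas D f -> vmeas D g -> vmeas D (fun s => f s + g s).
Proof. by move=> mf mg j; under eq_fun do rewrite mxE; exact: cmeasD. Qed.

Lemma measurable_cvnorm D f : vmeas D f -> measurable_fun D (fun s => cvnorm (f s)).
Proof.
by move=> mf; apply: measurable_sum => j; exact: cmeas_normc.
Qed.

Lemma vintegrableS D E f : measurable E -> measurable D -> D `<=` E ->
  vintegrable E f -> vintegrable D f.
Proof. by move=> mE mD DE fi j; exact: cintegrableS (fi j). Qed.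

Lemma vintegrableD D f g : measurable D -> vintegrable D f -> vintegrable D g ->
  vintegrable D (fun s => f s + g s).
Proof. by move=> mD fi gi j; under eq_fun do rewrite mxE; exact: cintegrableD. Qed.

Lemma vintegralD D f g : measurable D -> vintegrable D f -> vintegrable D g ->
  vintegral D (fun s => f s + g s) = vintegral D f + vintegral D g.
Proof.
move=> mD fi gi; apply/matrixP => j k; rewrite ord1 !mxE -cintegralD//.
by apply: eq_cintegral => s _; rewrite mxE.
Qed.

Lemma vintegrableZ D c f : measurable D -> vintegrable D f ->
  vintegrable D (fun s => c *: f s).
Proof. by move=> mD fi j; under eq_fun do rewrite mxE; exact: cintegrableZ. Qed.

Lemma vintegralZ D c f : measurable D -> vintegrable D f ->
  vintegral D (fun s => c *: f s) = c *: vintegral D f.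
Proof.
move=> mD fi; apply/matrixP => j k; rewrite ord1 !mxE -cintegralZ//.
by apply: eq_cintegral => s _; rewrite mxE.
Qed.

Lemma vintegrableN D f : measurable D -> vintegrable D f -> vintegrable D (fun s => - f s).
Proof. by move=> mD fi j; under eq_fun do rewrite mxE; exact: cintegrableN. Qed.

Lemma vintegralN D f : measurable D -> vintegrable D f ->
  vintegral D (fun s => - f s) = - vintegral D f.
Proof.
move=> mD fi; apply/matrixP => j k; rewrite ord1 !mxE -cintegralN//.
by apply: eq_cintegral => s _; rewrite mxE.
Qed.

Lemma vintegrableB D f g : measurable D -> vintegrable D f -> vintegrable D g ->
  vintegrable D (fun s => f s - g s).
Proof. by move=> mD fi gi; apply: vintegrableD => //; exact: vintegrableN. Qed.

Lemma vintegralB D f g : measurable D -> vintegrable D f -> vintegrable D g ->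
  vintegral D (fun s => f s - g s) = vintegral D f - vintegral D g.
Proof.
by move=> mD fi gi; rewrite vintegralD// ?vintegralN//; exact: vintegrableN.
Qed.

Lemma vintegrableZl D (u : R -> C) d : measurable D -> cintegrable D u ->
  vintegrable D (fun s => u s *: d).
Proof.
move=> mD ui j; under eq_fun do rewrite mxE mulrC; exact: cintegrableZ.
Qed.

Lemma vintegralZl D (u : R -> C) d : measurable D -> cintegrable D u ->
  vintegral D (fun s => u s *: d) = cintegral D u *: d.
Proof.
move=> mD ui; apply/matrixP => j k; rewrite ord1 !mxE mulrC -cintegralZ//.
by apply: eq_cintegral => s _; rewrite mxE mulrC.
Qed.

Lemma vintegrable_mulmx D (M : 'M[C]_m) f : measurable D -> vintegrable D f ->
  vintegrable D (fun s => M *m f s).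
Proof.
move=> mD fi j; under eq_fun do rewrite mxE.
by apply: cintegrable_sum => // k; exact: cintegrableZ.
Qed.

Lemma vintegral_mulmx D (M : 'M[C]_m) f : measurable D -> vintegrable D f ->
  vintegral D (fun s => M *m f s) = M *m vintegral D f.
Proof.
move=> mD fi; apply/matrixP => j k; rewrite ord1 !mxE.
rewrite (eq_cintegral (g := fun s => \sum_k M j k * f s k 0)); last by move=> s _; rewrite mxE.
rewrite cintegral_sum//; last by move=> i; exact: cintegrableZ.
by apply: eq_bigr => i _; rewrite mxE cintegralZ.
Qed.

Lemma vintegrable0 D : measurable D -> vintegrable D (fun _ => 0).
Proof. by move=> mD j; under eq_fun do rewrite mxE; exact: cintegrable0. Qed.

Lemma vintegrable_sum D (I : Type) (r : seq I) (F : I -> R -> 'cV[C]_m) : measurable D ->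
  (forall i, vintegrable D (F i)) -> vintegrable D (fun s => \sum_(i <- r) F i s).
Proof.
move=> mD Fi; elim: r => [|i r IH].
  by under eq_fun do rewrite big_nil; exact: vintegrable0.
by under eq_fun do rewrite big_cons; exact: vintegrableD.
Qed.

Lemma vintegral0 D : vintegral D (fun _ => 0) = 0.
Proof.
apply/matrixP => j k; rewrite !mxE -[RHS](cintegral0 D).
by apply: eq_cintegral => s _; rewrite ?mxE.
Qed.

Lemma vintegral_sum D (I : Type) (r : seq I) (F : I -> R -> 'cV[C]_m) : measurable D ->
  (forall i, vintegrable D (F i)) ->
  vintegral D (fun s => \sum_(i <- r) F i s) = \sum_(i <- r) vintegral D (F i).
Proof.
move=> mD Fi; elim: r => [|i r IH].
  by under eq_fun do rewrite big_nil; rewrite big_nil vintegral0.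
under eq_fun do rewrite big_cons; rewrite vintegralD ?IH ?big_cons//.
exact: vintegrable_sum.
Qed.

Lemma eq_vintegral D f g : (forall s, D s -> f s = g s) -> vintegral D f = vintegral D g.
Proof.
by move=> fg; apply/matrixP => j k; rewrite !mxE; apply: eq_cintegral => s Ds; rewrite fg.
Qed.

Lemma eq_vintegrable D f g : measurable D -> (forall s, D s -> f s = g s) ->
  vintegrable D f -> vintegrable D g.
Proof.
move=> mD fg fi j; apply: eq_cintegrable (fi j) => // s Ds; by rewrite fg.
Qed.

Lemma vintegrable_cvnorm D f : measurable D -> vintegrable D f ->
  mu.-integrable D (EFin \o (fun s => cvnorm (f s))).
Proof. by move=> mD fi; apply: integrable_sumR => // j; exact: cintegrable_normc. Qed.

Lemma vintegrable_le D f (g : R -> R) : measurable D -> vmeas D f ->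
  mu.-integrable D (EFin \o g) -> (forall s, D s -> cvnorm (f s) <= g s) ->
  vintegrable D f.
Proof.
move=> mD mf gi fg j; apply: cintegrable_le (mf j) gi _ => // s Ds.
exact: le_trans (normc_le_cvnorm _ _) (fg s Ds).
Qed.

Lemma cvnorm_vintegral_le D f : measurable D -> vintegrable D f ->
  cvnorm (vintegral D f) <= 2 * \int[mu]_(s in D) cvnorm (f s).
Proof.
move=> mD fi; rewrite Rintegral_sum//; last by move=> j; exact: cintegrable_normc.
rewrite mulr_sumr; apply: ler_sum => j _; rewrite mxE; exact: normc_cintegral_le.
Qed.

Lemma vintegrable_itv_cat (a b c : R) f : a <= b -> b <= c ->
  vintegrable `[a, b] f -> vintegrable `[b, c] f -> vintegrable `[a, c] f.
Proof. by move=> ab bc f1 f2 j; exact: cintegrable_itv_cat (f1 j) (f2 j). Qed.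

Lemma vintegral_itv_cat (a b c : R) f : a <= b -> b <= c ->
  vintegrable `[a, c] f ->
  vintegral `[a, c] f = vintegral `[a, b] f + vintegral `[b, c] f.
Proof.
by move=> ab bc fi; apply/matrixP => j k; rewrite !mxE; exact: cintegral_itv_cat.
Qed.

Lemma vintegrable_itv_translate (c a b : R) f :
  vintegrable `[a + c, b + c] f -> vintegrable `[a, b] (fun s => f (s + c)).
Proof. by move=> fi j; exact: (cintegrable_itv_translate (fi j)). Qed.

Lemma vintegral_itv_translate (c a b : R) f : vmeas `[a + c, b + c] f ->
  vintegral `[a, b] (fun s => f (s + c)) = vintegral `[a + c, b + c] f.
Proof.
move=> mf; apply/matrixP => j k; rewrite !mxE.
exact: (cintegral_itv_translate (mf j)).
Qed.

Lemma ae_forall_ord (P : 'I_m -> R -> Prop) :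
  (forall j, {ae mu, forall s, P j s}) -> {ae mu, forall s, forall j, P j s}.
Proof.
move=> hP.
have : {ae mu, forall s, forall j, j \in enum 'I_m -> P j s}.
  elim: (enum 'I_m) => [|i r IH].
    by apply: (ae_mono (P := fun _ => True)) => //; exact: aeW.
  have := ae_and (hP i) IH; apply: ae_mono => s [Pi Pr] j.
  by rewrite inE => /predU1P[->//|]; exact: Pr.
by apply: ae_mono => s H j; apply: H; rewrite mem_enum.
Qed.

Lemma ae_eq_of_vintegral (a b : R) f g : a <= b ->
  vintegrable `[a, b] f -> vintegrable `[a, b] g ->
  (forall x, a <= x <= b -> vintegral `[a, x] f = vintegral `[a, x] g) ->
  {ae mu, forall s : R, s \in `[a, b] -> f s = g s}.
Proof.
move=> ab fi gi fg.
have : {ae mu, forall s, forall j, s \in `[a, b] -> f s j 0 = g s j 0}.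
  apply: ae_forall_ord => j; apply: ae_eq_of_cintegral => // x xab.
  by have /matrixP/(_ j 0) := fg x xab; rewrite !mxE.
by apply: ae_mono => s H sab; apply/matrixP => j k; rewrite ord1 H.
Qed.

Lemma ae_eq_vintegral D f g : measurable D -> vmeas D f -> vmeas D g ->
  {ae mu, forall s, D s -> f s = g s} -> vintegral D f = vintegral D g.
Proof.
move=> mD mf mg fg; apply/matrixP => j k; rewrite !mxE.
by apply: ae_eq_cintegral => //; move: fg; apply: ae_mono => s fgs Ds; rewrite fgs.
Qed.

Section LpNorm.
Variable p : R.
Hypothesis p1 : 1 <= p.
Let p0 : 0 < p. Proof. by rewrite (lt_le_trans ltr01). Qed.
Local Notation I01 := `[(0 : R), 1]%classic.

(** Membership is defined coordinatewise and the norm by means of [cvnorm].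
    The two fit together because [cvnorm] dominates the modulus of each
    coordinate and is a finite sum of these moduli. *)
Lemma LpvP f : Lpv p f <-> vmeas `[0, 1] f /\
  mu.-integrable `[0, 1] (EFin \o (fun s => cvnorm (f s) `^ p)).
Proof.
split=> [fL|[mf fi] j].
  have mf : vmeas `[0, 1] f by move=> j; exact: Lp_cmeas (fL j).
  split=> //.
  have : Lp p `[0, 1] (fun s => \sum_j (Normc.normc (f s j 0))%:C).
    by apply: Lp_sum => // j; apply: Lp_normc => //; exact: fL.
  move=> /(LpP _ _ p1)[_]; apply: eq_integrable => // s _; rewrite /comp; congr ((_ `^ _)%:E).
  have -> : \sum_j (Normc.normc (f s j 0))%:C = (cvnorm (f s))%:C.
    by rewrite /cvnorm (raddf_sum (real_complex R)).
  by rewrite normc_real ger0_norm// cvnorm_ge0.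
have L1 : Lp p `[0, 1] (fun s => (cvnorm (f s))%:C).
  apply/LpP => //; split.
    by split; [exact: measurable_cvnorm|exact: measurable_cst].
  apply: eq_integrable fi => // s _; rewrite /comp; congr ((_ `^ _)%:E).
  by rewrite normc_real ger0_norm// cvnorm_ge0.
apply: (Lp_le (c := 1) p1 _ (mf j) L1) => // s _.
by rewrite mul1r normc_real ger0_norm ?cvnorm_ge0// normc_le_cvnorm.
Qed.

Lemma LpvD f g : Lpv p f -> Lpv p g -> Lpv p (f + g).
Proof.
move=> fL gL j; apply: eq_Lp (LpD p1 _ (fL j) (gL j)) => // s _.
by rewrite mxE.
Qed.

Lemma LpvZ c f : Lpv p f -> Lpv p (c *: f).
Proof. by move=> fL j; apply: eq_Lp (LpZ c p1 _ (fL j)) => // s _; rewrite mxE. Qed.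

Lemma LpvN f : Lpv p f -> Lpv p (- f).
Proof. by move=> /(LpvZ (-1)); rewrite scaleN1r. Qed.

Lemma LpvB f g : Lpv p f -> Lpv p g -> Lpv p (f - g).
Proof. by move=> fL gL; apply: LpvD => //; exact: LpvN. Qed.

Lemma Lpv0 : Lpv p (0 : R -> 'cV[C]_m).
Proof. by move=> j; apply: eq_Lp (Lp0 p1 _) => // s _; rewrite mxE. Qed.

Lemma Lpv_sum (I : Type) (r : seq I) (F : I -> R -> 'cV[C]_m) :
  (forall i, Lpv p (F i)) -> Lpv p (fun s => \sum_(i <- r) F i s).
Proof.
move=> FL; elim: r => [|i r IH].
  by under eq_fun do rewrite big_nil; exact: Lpv0.
by under eq_fun do rewrite big_cons; exact: LpvD.
Qed.

Lemma LpvZl (u : R -> C) d : Lp p `[0, 1] u -> Lpv p (fun s => u s *: d).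
Proof. by move=> uL j; apply: eq_Lp (LpZ (d j 0) p1 _ uL) => // s _; rewrite mxE mulrC. Qed.

Lemma Lpv_bounded f (M : R) : vmeas `[0, 1] f ->
  (forall s, 0 <= s <= 1 -> cvnorm (f s) <= M) -> Lpv p f.
Proof.
move=> mf fM; apply/LpvP; split=> //.
apply: (integrable_itv_bounded (M := M `^ p)).
  by apply: measurable_powR_comp; exact: measurable_cvnorm.
move=> s s0 s1; rewrite ger0_norm ?powR_ge0//.
have fs := fM s; rewrite s0 s1 in fs.
by apply: ge0_ler_powR; rewrite ?nnegrE ?cvnorm_ge0 ?(ltW p0) ?(le_trans (cvnorm_ge0 _) (fs isT)) ?fs.
Qed.

Lemma Lpv_vmeas f : Lpv p f -> vmeas `[0, 1] f.
Proof. by move=> /LpvP[]. Qed.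

Lemma Lpv_vintegrable f : Lpv p f -> vintegrable `[0, 1] f.
Proof. by move=> fL j; apply: (Lp_cintegrable p1 ler01 (fL j)). Qed.

Lemma Lpv_normE f : Lpv p f ->
  Lpv_norm p f = (\int[mu]_(s in `[0, 1]) (cvnorm (f s) `^ p)) `^ p^-1.
Proof.
move=> /LpvP[mf fi]; rewrite /Lpv_norm Lnorm_patchE//; last by move=> s; exact: cvnorm_ge0.
have := integrable_fin_num (mu := mu) (measurable_itv _) fi => /fineK <-.
by rewrite poweR_EFin.
Qed.

Lemma Lpv_norm_ge0 f : 0 <= Lpv_norm p f.
Proof. by rewrite /Lpv_norm fine_ge0// Lnorm_ge0. Qed.

Lemma Lpv_norm_L1 f : Lpv p f ->
  \int[mu]_(s in `[0, 1]) cvnorm (f s) <= 2 * Lpv_norm p f.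
Proof.
move=> fL; have [mf fi] := (LpvP f).1 fL; rewrite Lpv_normE //.
have [_] := le_Rintegral_powR p1 ler01 (measurable_cvnorm mf) (fun s => cvnorm_ge0 _) fi.
by rewrite subr0.
Qed.

Lemma eq_Lpv_norm f g : (forall s, 0 <= s <= 1 -> f s = g s) -> Lpv_norm p f = Lpv_norm p g.
Proof.
move=> fg; congr fine; apply: eq_Lnorm => s; rewrite !patchE; case: ifPn => // sI.
by rewrite fg//; move: sI; rewrite inE/= in_itv.
Qed.

(** Minkowski's inequality for the scalar functions cvnorm (f s) and cvnorm (g
    s). *)
Lemma Lpv_normD f g : Lpv p f -> Lpv p g ->
  Lpv_norm p (f + g) <= Lpv_norm p f + Lpv_norm p g.
Proof.
move=> fL gL.
have hfin h : Lpv p h ->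
    ('N[mu]_(p%:E)[(fun s => (cvnorm (h s))%:E) \_ `[0%R, 1%R]] < +oo)%E.
  move=> /LpvP[mh hi]; rewrite Lnorm_patchE//; last by move=> s; exact: cvnorm_ge0.
  by apply: poweR_lty; apply: integrable_lty => //.
have fgL := LpvD fL gL.
pose f1 := (fun s => cvnorm (f s)) \_ I01; pose g1 := (fun s => cvnorm (g s)) \_ I01.
have mf1 : measurable_fun setT f1.
  have mI : measurable I01 by [].
  exact: ((measurable_restrictT (fun s => cvnorm (f s)) mI).1 (measurable_cvnorm (Lpv_vmeas fL))).
have mg1 : measurable_fun setT g1.
  have mI : measurable I01 by [].
  exact: ((measurable_restrictT (fun s => cvnorm (g s)) mI).1 (measurable_cvnorm (Lpv_vmeas gL))).
have nE h : (fun s => (cvnorm (h s))%:E) \_ I01 = EFin \o ((fun s => cvnorm (h s)) \_ I01).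
  by rewrite restrict_EFin.
have := minkowski_EFin mu mf1 mg1 p1; rewrite -!nE => H.
have Nf := hfin f fL; have Ng := hfin g gL.
have fE (x : \bar R) : (0 <= x)%E -> (x < +oo)%E -> x \is a fin_num by move=> *; rewrite ge0_fin_numE.
rewrite /Lpv_norm -fineD ?fE ?Lnorm_ge0//.
apply: fine_le; rewrite ?fE ?Lnorm_ge0 ?hfin//.
  by apply: adde_ge0; exact: Lnorm_ge0.
  exact: lte_add_pinfty.
apply: le_trans H.
rewrite Lnorm_patchE//; last by move=> s; exact: cvnorm_ge0.
have -> : EFin \o (f1 \+ g1) = (fun s => (cvnorm (f s) + cvnorm (g s))%:E) \_ I01.
  by apply/funext => s; rewrite /f1 /g1 /= !patchE; case: ifPn => //; rewrite addr0.
rewrite Lnorm_patchE//; last by move=> s; rewrite addr_ge0// cvnorm_ge0.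
apply: gt0_ler_poweR; rewrite ?invr_ge0 ?(ltW p0)//.
- by rewrite in_itv/= leey andbT integral_ge0// => s _; rewrite lee_fin powR_ge0.
- by rewrite in_itv/= leey andbT integral_ge0// => s _; rewrite lee_fin powR_ge0.
apply: ge0_le_integral => //.
- by move=> s _; rewrite lee_fin powR_ge0.
- apply/measurable_EFinP; apply: measurable_powR_comp; apply: measurable_cvnorm.
  by apply: vmeasD; exact: Lpv_vmeas.
- apply/measurable_EFinP; apply: measurable_powR_comp; apply: measurable_funD.
    by apply: measurable_cvnorm; exact: Lpv_vmeas.
  by apply: measurable_cvnorm; exact: Lpv_vmeas.
- move=> s _; rewrite lee_fin.
  by apply: ge0_ler_powR; rewrite ?nnegrE ?cvnorm_ge0 ?(ltW p0) ?addr_ge0 ?cvnorm_ge0 ?cvnormD.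
Qed.

Lemma Lpv_normZ c f : Lpv p f ->
  Lpv_norm p (c *: f) = Normc.normc c * Lpv_norm p f.
Proof.
move=> fL; rewrite (Lpv_normE fL) (Lpv_normE (LpvZ c fL)).
under eq_Rintegral do rewrite cvnormZ powRM ?normc_ge0 ?cvnorm_ge0//.
have [_ fi] := (LpvP f).1 fL.
rewrite RintegralZl// powRM ?powR_ge0//; last by apply: Rintegral_ge0 => s _; exact: powR_ge0.
by rewrite -powRrM mulfV ?gt_eqF// powRr1// normc_ge0.
Qed.

Lemma Lpv_normN f : Lpv_norm p (- f) = Lpv_norm p f.
Proof.
congr fine; apply: eq_Lnorm => s; rewrite !patchE; case: ifPn => // _.
by congr EFin; exact: (cvnormN (f s)).
Qed.

Lemma Lpv_norm0 : Lpv_norm p (0 : R -> 'cV[C]_m) = 0.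
Proof.
have := Lpv_normZ 0 Lpv0; rewrite Normc.normc0 mul0r => <-.
by apply: eq_Lpv_norm => s _; rewrite scale0r.
Qed.

Lemma Lpv_norm_bound f (M : R) : vmeas `[0, 1] f ->
  (forall s, 0 <= s <= 1 -> cvnorm (f s) <= M) -> Lpv_norm p f <= M.
Proof.
move=> mf fM; have fL := Lpv_bounded mf fM; rewrite Lpv_normE //.
have M0 : 0 <= M by rewrite (le_trans (cvnorm_ge0 (f 0)))// fM// lexx ler01.
have -> : M = (M `^ p) `^ p^-1 by rewrite -powRrM mulfV ?gt_eqF// powRr1.
have [_ fi] := (LpvP f).1 fL.
apply: ge0_ler_powR; rewrite ?nnegrE ?invr_ge0 ?powR_ge0 ?(ltW p0)//.
  by apply: Rintegral_ge0 => s _; exact: powR_ge0.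
apply: (@le_trans _ _ (\int[mu]_(s in `[0, 1]) (M `^ p))).
  apply: le_Rintegral => //; first exact: integrable_itv_cst.
  move=> s /=; rewrite in_itv/= => s01.
  by apply: ge0_ler_powR; rewrite ?nnegrE ?cvnorm_ge0 ?(ltW p0) ?fM.
by rewrite Rintegral_itv_cst// subr0 mulr1.
Qed.

Lemma Lpv_norm_ae0 f : Lpv p f -> Lpv_norm p f = 0 ->
  {ae mu, forall s : R, s \in `[0, 1] -> f s = 0}.
Proof.
move=> fL f0; apply: ae_eq_of_vintegral => //.
- exact: Lpv_vintegrable.
- exact: vintegrable0.
move=> x /andP[x0 x1]; rewrite vintegral0; apply: cvnorm_eq0.
have sub : `[0, x] `<=` `[(0 : R), 1] by apply: subset_itvl; rewrite bnd_simp.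
have fx : vintegrable `[0, x] f by apply: vintegrableS sub (Lpv_vintegrable fL).
apply: (le_trans (cvnorm_vintegral_le _ fx)) => //.
rewrite -(mulr0 2) ler_wpM2l//.
have := Lpv_norm_L1 fL; rewrite f0 mulr0; apply: le_trans.
rewrite (Rintegral_itv_cat x0 x1); last exact/vintegrable_cvnorm/Lpv_vintegrable.
by rewrite lerDl Rintegral_ge0// => s _; exact: cvnorm_ge0.
Qed.

Lemma Lpv_norm_eq0 f : Lpv p f ->
  {ae mu, forall s : R, s \in `[0, 1] -> f s = 0} -> Lpv_norm p f = 0.
Proof.
move=> fL f0; rewrite Lpv_normE //.
rewrite (@ae_eq_Rintegral _ _ _ (fun _ => 0))//.
- by rewrite /Rintegral integral0 powR0// invr_neq0// gt_eqF.
- by apply: measurable_powR_comp; apply: measurable_cvnorm; exact: Lpv_vmeas.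
- by move: f0; apply: ae_mono => s fs sI; rewrite fs// cvnorm0 powR0// gt_eqF.
Qed.

Lemma same_aeP f g : Lpv p f -> Lpv p g -> same (Lpv_norm p) f g <->
  {ae mu, forall s : R, s \in `[0, 1] -> f s = g s}.
Proof.
move=> fL gL; rewrite /same; have fgL := LpvB fL gL; split=> h.
  move: (Lpv_norm_ae0 fgL h); apply: ae_mono => s H sI.
  by apply/eqP; rewrite -subr_eq0; apply/eqP; exact: H.
by apply: (Lpv_norm_eq0 fgL); move: h; apply: ae_mono => s H sI; rewrite !fctE H// subrr.
Qed.

Lemma ae_Lpv_norm f g : Lpv p f -> Lpv p g ->
  {ae mu, forall s : R, s \in `[0, 1] -> f s = g s} -> Lpv_norm p f = Lpv_norm p g.
Proof.
move=> fL gL fg; rewrite (Lpv_normE fL) (Lpv_normE gL).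
have mk (h : R -> 'cV[C]_m) : Lpv p h -> measurable_fun I01 (fun s => cvnorm (h s) `^ p).
  by move=> hL; apply: measurable_powR_comp; apply: measurable_cvnorm; exact: Lpv_vmeas.
rewrite (ae_eq_Rintegral (measurable_itv _) (mk f fL) (mk g gL)) //.
by move: fg; apply: ae_mono => s H sI; rewrite H.
Qed.

Lemma same_refl f : same (Lpv_norm p) f f.
Proof. by rewrite /same subrr; exact: Lpv_norm0. Qed.

Lemma same_sym f g : same (Lpv_norm p) f g -> same (Lpv_norm p) g f.
Proof. by rewrite /same => <-; rewrite -[f - g]opprB; symmetry; exact: Lpv_normN. Qed.

Lemma same_trans g f h : Lpv p f -> Lpv p g -> Lpv p h ->
  same (Lpv_norm p) f g -> same (Lpv_norm p) g h -> same (Lpv_norm p) f h.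
Proof.
move=> fL gL hL /same_aeP => /(_ fL gL) fg /same_aeP => /(_ gL hL) gh.
apply/same_aeP => //; have := ae_and fg gh; apply: ae_mono => s [H1 H2] sI.
by rewrite H1// H2.
Qed.

End LpNorm.

End Vectors.

End VectorFunctions.

(** * Free transport along the edges *)

Section HalfOpen.
Context {R : realType}.
Local Notation mu := (@lebesgue_measure R).

(** The values at b do not matter: [ext B x] agrees with x at s < 1 but not at
    s = 1. *)
Lemma eq_co_integrable (a b : R) (f g : R -> R) : a <= b ->
  (forall s, a <= s -> s < b -> f s = g s) ->
  mu.-integrable `[a, b] (EFin \o f) -> mu.-integrable `[a, b] (EFin \o g).
Proof.
rewrite le_eqVlt => /predU1P[<-|ab] fg fi.
  rewrite set_itv1; apply/integrableP; split.
    exact: measurable_fun_set1.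
  by rewrite integral_set1.
have sub : `[a, b[ `<=` `[a, b] by apply: subset_itvl; rewrite bnd_simp.
have mf : measurable_fun `[a, b] f.
  by apply/measurable_EFinP; move: fi => /measurable_int.
have mg0 : measurable_fun `[a, b[ g.
  apply: (@eq_measurable_fun _ _ _ _ _ f).
    by move=> s; rewrite inE/= in_itv/= => /andP[]; exact: fg.
  by apply: measurable_funS mf.
have mg : measurable_fun `[a, b] g by apply/measurable_fun_itv_bndo_bndcP.
apply/integrableP; split; first exact/measurable_EFinP.
move: fi => /integrableP[_]; apply: le_lt_trans.
rewrite -integral_itv_bndo_bndc; last by do 2 apply: measurableT_comp => //.
rewrite -[leRHS]integral_itv_bndo_bndc.
  rewrite le_eqVlt; apply/orP; left; apply/eqP; apply: eq_integral => s.
  by rewrite inE/= in_itv/= => /andP[as_ sb]; rewrite fg.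
by do 2 apply: measurableT_comp => //; apply: measurable_funS mf.
Qed.

Lemma eq_co_ae (T : Type) (a b : R) (f g : R -> T) :
  (forall s, a <= s -> s < b -> f s = g s) ->
  {ae mu, forall s : R, `[a, b]%classic s -> f s = g s}.
Proof.
move=> fg; exists [set b]; split => //.
  exact: lebesgue_measure_set1.
move=> s /= /not_implyP[]; rewrite in_itv/= => /andP[as_ sb] nfg.
by move: sb; rewrite le_eqVlt => /predU1P[//|sb]; exfalso; apply: nfg; exact: fg.
Qed.

Lemma eq_co_vintegrable m (a b : R) (f g : R -> 'cV[R[i]]_m) : a <= b ->
  (forall s, a <= s -> s < b -> f s = g s) ->
  vintegrable `[a, b] f -> vintegrable `[a, b] g.
Proof.
move=> ab fg fi j; have [f1 f2] := fi j; split; [move: f1|move: f2];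
  by apply: eq_co_integrable => // s as_ sb; rewrite fg.
Qed.

Lemma eq_co_vintegral m (a b : R) (f g : R -> 'cV[R[i]]_m) : a <= b ->
  (forall s, a <= s -> s < b -> f s = g s) ->
  vintegrable `[a, b] f -> vintegral `[a, b] f = vintegral `[a, b] g.
Proof.
move=> ab fg fi; apply: ae_eq_vintegral => //.
- exact: vintegrable_vmeas.
- by apply: vintegrable_vmeas; exact: eq_co_vintegrable fi.
- exact: eq_co_ae.
Qed.

End HalfOpen.

Section FreeTransport.
Context {R : realType} {m : nat}.
Local Notation C := R[i].
Local Notation mu := (@lebesgue_measure R).
Variable B : 'M[C]_m.
Implicit Types (x y F g : R -> 'cV[C]_m) (d : 'cV[C]_m).

(** The value that arrives at s = 0 at time rho if the edges carry x at time
    0: during floor(rho) full laps it has been multiplied by B as often. *)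
Definition ext x (rho : R) : 'cV[C]_m :=
  iter (Num.truncn rho) (mulmx B) (x (rho - (Num.truncn rho)%:R)).

Lemma iter_mulmxD n d e : iter n (mulmx B) (d + e) = iter n (mulmx B) d + iter n (mulmx B) e.
Proof. by elim: n => [//|n IH] /=; rewrite IH mulmxDr. Qed.

Lemma iter_mulmxZ n c d : iter n (mulmx B) (c *: d) = c *: iter n (mulmx B) d.
Proof. by elim: n => [//|n IH] /=; rewrite IH scalemxAr. Qed.

Lemma iter_mulmx0 n : iter n (mulmx B) (0 : 'cV[C]_m) = 0.
Proof. by elim: n => [//|n IH] /=; rewrite IH mulmx0. Qed.

Lemma extD x y rho : ext (x + y) rho = ext x rho + ext y rho.
Proof. by rewrite /ext iter_mulmxD. Qed.

Lemma extZ c x rho : ext (c *: x) rho = c *: ext x rho.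
Proof. by rewrite /ext iter_mulmxZ. Qed.

Lemma ext_small x rho : 0 <= rho -> rho < 1 -> ext x rho = x rho.
Proof.
move=> r0 r1; have -> : x rho = iter 0 (mulmx B) (x (rho - 0%:R)) by rewrite subr0.
by rewrite /ext; have -> : Num.truncn rho = 0%N by apply: truncn_def; rewrite r0.
Qed.

Lemma ext_succ x rho : 0 <= rho -> ext x (rho + 1) = B *m ext x rho.
Proof.
move=> r0; rewrite /ext -iterS; have -> : Num.truncn (rho + 1) = (Num.truncn rho).+1.
  apply: truncn_def; have /andP[h1 h2] := truncn_itv r0.
  by rewrite -natr1 lerD2r h1/= -natr1 ltrD2r.
by congr (iter _ _ (x _)); rewrite -natr1 opprD addrACA subrr addr0.
Qed.

Lemma ext_vintegrable_nat x (k : nat) : vintegrable `[0, 1] x ->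
  vintegrable `[0, k%:R] (ext x).
Proof.
move=> xi; elim: k => [|k IH].
  rewrite set_itv1 => j; split; apply/integrableP; split;
    by [exact: measurable_fun_set1|rewrite integral_set1].
apply: (vintegrable_itv_cat (b := 1)) => //; first by rewrite -natr1 lerDr.
  apply: (eq_co_vintegrable _ _ xi) => // s s0 s1; by rewrite ext_small.
have H : vintegrable `[1 + -1, k.+1%:R + -1] (fun s => B *m ext x s).
  by rewrite subrr -natr1 addrK; exact: vintegrable_mulmx.
apply: (eq_vintegrable _ _ (vintegrable_itv_translate H)) => // s /=.
by rewrite in_itv/= => /andP[s1 _]; rewrite -ext_succ ?subrK// subr_ge0.
Qed.

Lemma ext_vintegrable x (a b : R) : vintegrable `[0, 1] x -> 0 <= a ->
  vintegrable `[a, b] (ext x).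
Proof.
move=> xi a0; have := ext_vintegrable_nat (Num.truncn b).+1 xi.
apply: vintegrableS => // s /=; rewrite !in_itv/= => /andP[as_ sb].
by rewrite (le_trans a0 as_)/= (le_trans sb)// ltW// truncnS_gt.
Qed.

Lemma vintegral_ext_shift x (a b : R) : vintegrable `[0, 1] x -> 0 <= a ->
  vintegral `[a + 1, b + 1] (ext x) = B *m vintegral `[a, b] (ext x).
Proof.
move=> xi a0; rewrite -vintegral_itv_translate; last first.
  by apply: vintegrable_vmeas; apply: ext_vintegrable => //; rewrite addr_ge0.
rewrite -vintegral_mulmx//; last exact: ext_vintegrable.
apply: eq_vintegral => s /=; rewrite in_itv/= => /andP[as_ _].
by rewrite ext_succ// (le_trans a0).
Qed.

(** Every further unit of length costs one multiplication by B. *)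
Lemma ext_L1_bound (k : nat) : exists2 c : R, 0 <= c & forall x, vintegrable `[0, 1] x ->
  \int[mu]_(s in `[0, k%:R]) cvnorm (ext x s) <= c * \int[mu]_(s in `[0, 1]) cvnorm (x s).
Proof.
elim: k => [|k [c c0 IH]].
  by exists 0 => // x xi; rewrite set_itv1 Rintegral_set1 mul0r.
exists (1 + mxbound B * c); first by rewrite addr_ge0// mulr_ge0// mxbound_ge0.
move=> x xi.
have ei a b : 0 <= a -> mu.-integrable `[a, b] (EFin \o (fun s => cvnorm (ext x s))).
  by move=> a0; apply: vintegrable_cvnorm => //; exact: ext_vintegrable.
rewrite (@Rintegral_itv_cat _ 0 1)//; last 2 first.
  by rewrite -natr1 lerDr.
  exact: ei.
rewrite mulrDl mul1r; apply: lerD.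
  rewrite le_eqVlt; apply/orP; left; apply/eqP; apply: ae_eq_Rintegral => //.
  - by apply: measurable_cvnorm; apply: vintegrable_vmeas; exact: ext_vintegrable.
  - by apply: measurable_cvnorm; exact: vintegrable_vmeas.
  - by apply: eq_co_ae => s s0 s1; rewrite ext_small.
have -> : \int[mu]_(s in `[1, k.+1%:R]) cvnorm (ext x s) =
          \int[mu]_(s in `[0, k%:R]) cvnorm (ext x (s + 1)).
  rewrite (Rintegral_itv_translate (f := fun s => cvnorm (ext x s))) ?add0r ?natr1//.
  by apply: measurable_cvnorm; apply: vintegrable_vmeas; exact: ext_vintegrable.
apply: (@le_trans _ _ (\int[mu]_(s in `[0, k%:R]) (mxbound B * cvnorm (ext x s)))).
  apply: le_Rintegral => //.
  - have H : mu.-integrable `[0, k%:R] (EFin \o (fun s => cvnorm (B *m ext x s))).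
      by apply: vintegrable_cvnorm => //; apply: vintegrable_mulmx => //; exact: ext_vintegrable.
    apply: eq_integrable H => // s.
    by rewrite inE/= in_itv/= => /andP[s0 _]; rewrite /comp ext_succ.
  - by apply: integrableZlR => //; exact: ei.
  - move=> s /=; rewrite in_itv/= => /andP[s0 _]; rewrite ext_succ//.
    exact: cvnorm_mulmx.
rewrite RintegralZl//; last exact: ei.
by rewrite -mulrA ler_wpM2l ?mxbound_ge0// IH.
Qed.

(** At the integer k + 1 the extension of F jumps from B ^ k (F 1) to B ^ (k +
    1) (F 0), that is, by - B ^ k d. Once these jumps are added back, it is a
    primitive of the extension of g. *)
Lemma ext_FTC F g d : vintegrable `[0, 1] g -> d = F 1 - B *m F 0 ->
  (forall a b, 0 <= a -> a <= b -> b <= 1 -> F b - F a = vintegral `[a, b] g) ->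
  forall rho, 0 <= rho ->
  ext F rho + \sum_(k < Num.truncn rho) iter k (mulmx B) d =
  F 0 + vintegral `[0, rho] (ext g).
Proof.
move=> gi dE Fg.
suff aux n rho : 0 <= rho -> Num.truncn rho = n ->
    ext F rho + \sum_(k < n) iter k (mulmx B) d = F 0 + vintegral `[0, rho] (ext g).
  by move=> rho rho0; exact: aux.
have ge s : 0 <= s -> s <= 1 -> vintegral `[0, s] g = vintegral `[0, s] (ext g).
  move=> s0 s1; apply: eq_co_vintegral => //.
    by move=> z z0 zs; rewrite ext_small// (lt_le_trans zs).
  by apply: vintegrableS gi => //; apply: subset_itvl; rewrite bnd_simp.
elim: n rho => [|n IH] rho rho0 nE.
  have r1 : rho < 1 by rewrite -[1]/(1%:R) -truncn_lt_nat// nE.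
  rewrite big_ord0 addr0 ext_small// -ge// ?ltW// -Fg// ?ltW//.
  by rewrite addrC subrK.
have r1 : 1 <= rho by rewrite -truncn_gt0 nE.
have rm : 0 <= rho - 1 by rewrite subr_ge0.
have nm : Num.truncn (rho - 1) = n.
  apply: truncn_def; have /andP[h1 h2] := truncn_itv rho0.
  by rewrite nE in h1 h2; rewrite lerBrDr ltrBlDr !natr1 h1.
have := congr1 (mulmx B) (IH _ rm nm).
rewrite !mulmxDr -ext_succ// subrK -vintegral_ext_shift// add0r subrK.
have -> : B *m F 0 = F 0 + vintegral `[0, 1] (ext g) - d.
  by rewrite -ge// -Fg// [F 0 + _]addrC subrK dE opprB addrC subrK.
have ei a b := @ext_vintegrable g a b gi.
rewrite (vintegral_itv_cat (f := ext g) ler01 r1); last exact: ei.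
rewrite big_ord_recl/= mulmx_sumr => H.
have E : \sum_(i < n) iter (bump 0 i) (mulmx B) d = \sum_(i < n) B *m iter i (mulmx B) d.
  by apply: eq_bigr.
by rewrite E [d + _]addrC addrA H addrAC subrK addrA.
Qed.

End FreeTransport.

(** * Weak derivatives and classes of vector-valued functions *)

Section WeakDerivatives.
Context {R : realType} {m : nat}.
Local Notation C := R[i].
Local Notation mu := (@lebesgue_measure R).
Implicit Types (f g F : R -> 'cV[C]_m).

Lemma Re_mul_real (z : C) (a : R) : complex.Re (z * a%:C) = complex.Re z * a.
Proof. by rewrite Re_mulc /= mulr0 subr0. Qed.

Lemma Im_mul_real (z : C) (a : R) : complex.Im (z * a%:C) = complex.Im z * a.
Proof. by rewrite Im_mulc /= mulr0 add0r. Qed.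

(** Together with [vFTC_weak_derivative]: the functions with weak derivative g
    are, up to null sets, the primitives of g. All statements about D(A_m) go
    through these two lemmas. *)
Lemma weak_derivative_vFTC (f g F : R -> 'cV[C]_m) :
  vintegrable `[0, 1] f -> vintegrable `[0, 1] g ->
  weak_derivative f g -> continuous_representative f F ->
  forall a b, 0 <= a -> a <= b -> b <= 1 -> F b - F a = vintegral `[a, b] g.
Proof.
move=> fi gi fg [cF Ff] a b a0 ab b1; apply/matrixP => j k; rewrite ord1 !mxE.
have [f1 f2] := fi j; have [g1 g2] := gi j; have [c1 c2] := cF j.
apply: complex_eq; rewrite ?ReD ?ImD ?ReN ?ImN.
  apply: (weak_derivative_FTC f1 g1 c1) => //.
    by move: Ff; apply: ae_mono => s H sI; rewrite H.
  move=> phi tphi; have := congr1 (@complex.Re R) (fg phi tphi j).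
  rewrite ReN /=; under eq_Rintegral do rewrite Re_mul_real.
  by under [in RHS]eq_Rintegral do rewrite Re_mul_real.
apply: (weak_derivative_FTC f2 g2 c2) => //.
  by move: Ff; apply: ae_mono => s H sI; rewrite H.
move=> phi tphi; have := congr1 (@complex.Im R) (fg phi tphi j).
rewrite ImN /=; under eq_Rintegral do rewrite Im_mul_real.
by under [in RHS]eq_Rintegral do rewrite Im_mul_real.
Qed.

Lemma AC_continuous (g F : R -> R) : mu.-integrable `[0, 1] (EFin \o g) ->
  (forall a b, 0 <= a -> a <= b -> b <= 1 -> F b - F a = \int[mu]_(s in `[a, b]) g s) ->
  {within `[0, 1], continuous F}.
Proof.
move=> gi Fg; pose k x := \int[mu]_(s in `[0, x]) g s.
have ck : {within `[0, 1], continuous k} := parameterized_integral_continuous ler01 gi.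
apply: (@subspace_eq_continuous _ _ _ (fun x => F 0 + k x)).
  by move=> x; rewrite inE/= in_itv/= => /andP[x0 x1]; rewrite /k -Fg// addrC subrK.
by move=> x; apply: cvgD; [exact: cvg_cst|exact: ck].
Qed.

Lemma vFTC_weak_derivative (g F : R -> 'cV[C]_m) : vintegrable `[0, 1] g ->
  (forall a b, 0 <= a -> a <= b -> b <= 1 -> F b - F a = vintegral `[a, b] g) ->
  weak_derivative F g /\ continuous_representative F F.
Proof.
move=> gi Fg.
have FRe j a b : 0 <= a -> a <= b -> b <= 1 -> complex.Re (F b j 0) - complex.Re (F a j 0)
    = \int[mu]_(s in `[a, b]) complex.Re (g s j 0).
  move=> a0 ab b1; rewrite -ReN -ReD.
  by have /matrixP/(_ j 0) := Fg a b a0 ab b1; rewrite !mxE => ->.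
have FIm j a b : 0 <= a -> a <= b -> b <= 1 -> complex.Im (F b j 0) - complex.Im (F a j 0)
    = \int[mu]_(s in `[a, b]) complex.Im (g s j 0).
  move=> a0 ab b1; rewrite -ImN -ImD.
  by have /matrixP/(_ j 0) := Fg a b a0 ab b1; rewrite !mxE => ->.
split; last first.
  split; last exact: aeW.
  move=> j; have [g1 g2] := gi j; split.
    exact: (AC_continuous g1 (FRe j)).
  exact: (AC_continuous g2 (FIm j)).
move=> phi tphi j; have [g1 g2] := gi j; apply: complex_eq; rewrite ?ReN ?ImN /=.
  under eq_Rintegral do rewrite Re_mul_real.
  under [in RHS]eq_Rintegral do rewrite Re_mul_real.
  exact: (AC_by_parts g1 (FRe j)).
under eq_Rintegral do rewrite Im_mul_real.
under [in RHS]eq_Rintegral do rewrite Im_mul_real.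
exact: (AC_by_parts g2 (FIm j)).
Qed.

Lemma vabs_continuity (a b : R) g : vintegrable `[a, b] g -> forall e : R, 0 < e ->
  exists2 d : R, 0 < d & forall c c', a <= c -> c <= c' -> c' <= b -> c' - c < d ->
    \int[mu]_(s in `[c, c']) cvnorm (g s) < e.
Proof.
move=> gi e e0; have ni := vintegrable_cvnorm (measurable_itv _) gi.
have [d d0 dP] := abs_continuity ni e0; exists d => // c c' ac cc' c'b cd.
have := dP c c' ac cc' c'b cd; congr (_ < _); apply: eq_Rintegral => s _.
by rewrite ger0_norm// cvnorm_ge0.
Qed.

End WeakDerivatives.

Section LpSpace.
Context {R : realType} {m : nat}.
Local Notation C := R[i].
Local Notation mu := (@lebesgue_measure R).
Variable p : R.
Hypothesis p1 : 1 <= p.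
Local Notation X := (@Lpv R p m).
Local Notation N := (@Lpv_norm R p m).
Local Notation "x ~~ y" := (same N x y) (at level 70).
Implicit Types (x y z : R -> 'cV[C]_m).

Lemma Lpv_norm_sub x y z : X x -> X y -> X z -> N (x - z) <= N (x - y) + N (y - z).
Proof.
move=> Xx Xy Xz; have -> : x - z = (x - y) + (y - z) by rewrite addrA subrK.
by apply: (Lpv_normD p1); exact: (LpvB p1).
Qed.

Lemma Lpv_norm_same x y : X x -> X y -> x ~~ y -> N x = N y.
Proof. by move=> Xx Xy xy; apply: ae_Lpv_norm => //; apply/(same_aeP p1). Qed.

Lemma sameD x x' y y' : X x -> X x' -> X y -> X y' ->
  x ~~ x' -> y ~~ y' -> (x + y) ~~ (x' + y').
Proof.
move=> Xx Xx' Xy Xy' /(same_aeP p1 Xx Xx') h1 /(same_aeP p1 Xy Xy') h2.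
apply/(same_aeP p1); [exact: (LpvD p1)|exact: (LpvD p1)|].
by have := ae_and h1 h2; apply: ae_mono => s [e1 e2] sI; rewrite !fctE e1// e2.
Qed.

Lemma sameZ c x x' : X x -> X x' -> x ~~ x' -> (c *: x) ~~ (c *: x').
Proof.
move=> Xx Xx' /(same_aeP p1 Xx Xx') h; apply/(same_aeP p1); [exact: (LpvZ p1)|exact: (LpvZ p1)|].
by move: h; apply: ae_mono => s e1 sI; rewrite !fctE e1.
Qed.

Lemma sameB x x' y y' : X x -> X x' -> X y -> X y' ->
  x ~~ x' -> y ~~ y' -> (x - y) ~~ (x' - y').
Proof.
move=> Xx Xx' Xy Xy' h1 h2; rewrite -[- y]scaleN1r -[- y']scaleN1r.
by apply: sameD => //; try exact: (LpvZ p1); apply: sameZ.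
Qed.

Lemma same_vintegral x y (a b : R) : X x -> X y -> x ~~ y -> 0 <= a -> b <= 1 ->
  vintegral `[a, b] x = vintegral `[a, b] y.
Proof.
move=> Xx Xy /(same_aeP p1 Xx Xy) h a0 b1.
have sub : `[a, b] `<=` `[(0 : R), 1] by apply: subset_itv; rewrite bnd_simp.
apply: ae_eq_vintegral => //.
- by apply: vmeasS sub _ => //; exact: Lpv_vmeas p1 _ Xx.
- by apply: vmeasS sub _ => //; exact: Lpv_vmeas p1 _ Xy.
- by move: h; apply: ae_mono => s H /sub; exact: H.
Qed.

Lemma vintegral_same x y : X x -> X y ->
  (forall b, 0 <= b -> b <= 1 -> vintegral `[0, b] x = vintegral `[0, b] y) -> x ~~ y.
Proof.
move=> Xx Xy xy; apply/(same_aeP p1) => //; apply: ae_eq_of_vintegral => //.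
- exact: Lpv_vintegrable p1 _ Xx.
- exact: Lpv_vintegrable p1 _ Xy.
- by move=> b /andP[b0 b1]; exact: xy.
Qed.

End LpSpace.

(** * Strongly continuous semigroups *)

Section Limits.
Context {R : realType}.

Lemma cvg_at_right0P (k : R -> R) : (forall h, 0 <= k h) ->
  k h @[h --> (0 : R)^'+] --> (0 : R) <->
  forall e : R, 0 < e -> exists2 d : R, 0 < d & forall h, 0 < h -> h < d -> k h < e.
Proof.
move=> k0; split=> [/cvgrPdist_lt H e e0|H].
  have [d /= d0 dP] := H e e0; exists d => // h h0 hd.
  have := dP h; rewrite /ball_/= sub0r normrN gtr0_norm// => /(_ hd h0).
  by rewrite sub0r normrN ger0_norm.
apply/cvgrPdist_lt => e e0; have [d d0 dP] := H e e0.
exists d => //= h; rewrite /ball_/= sub0r normrN => hd h0.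
rewrite sub0r normrN ger0_norm//; apply: dP => //.
by move: hd; rewrite gtr0_norm.
Qed.

Lemma cvg_withinP (k : R -> R) (A : set R) (t : R) : (forall h, 0 <= k h) ->
  k s @[s --> within A (nbhs t)] --> (0 : R) ->
  forall e : R, 0 < e -> exists2 d : R, 0 < d & forall s, A s -> `|t - s| < d -> k s < e.
Proof.
move=> k0 /cvgrPdist_lt H e e0; have [d /= d0 dP] := H e e0.
exists d => // s As std; have := dP s std As.
by rewrite sub0r normrN ger0_norm.
Qed.

Lemma cvg_seq0P (k : nat -> R) : (forall n, 0 <= k n) ->
  k n @[n --> \oo] --> (0 : R) ->
  forall e : R, 0 < e -> exists n0, forall n, (n0 <= n)%N -> k n < e.
Proof.
move=> k0 /cvgrPdist_lt H e e0; have [n0 _ nP] := H e e0.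
by exists n0 => n nn; have := nP n nn; rewrite sub0r normrN ger0_norm.
Qed.

Lemma seq0P_cvg (k : nat -> R) : (forall n, 0 <= k n) ->
  (forall e : R, 0 < e -> exists n0, forall n, (n0 <= n)%N -> k n < e) ->
  k n @[n --> \oo] --> (0 : R).
Proof.
move=> k0 H; apply/cvgrPdist_lt => e e0; have [n0 nP] := H e e0.
by exists n0 => // n nn; rewrite sub0r normrN ger0_norm// nP.
Qed.

End Limits.

Section Semigroup.
Context {R : realType} {m : nat}.
Local Notation C := R[i].
Variable p : R.
Hypothesis p1 : 1 <= p.
Local Notation X := (@Lpv R p m).
Local Notation N := (@Lpv_norm R p m).
Local Notation "x ~~ y" := (same N x y) (at level 70).
Implicit Types (x y z : R -> 'cV[C]_m).
Variable T : R -> (R -> 'cV[C]_m) -> (R -> 'cV[C]_m).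
Hypothesis HT : strongly_continuous_semigroup X N T.

Lemma semigroup_Lpv t x : 0 <= t -> X x -> X (T t x).
Proof. by move=> t0 Xx; case: HT => /(_ t t0)[TXt _ _] _ _ _; exact: TXt. Qed.

Ltac Lp_closed := lazymatch goal with
  | |- is_true _ => first [assumption | exact: ltW]
  | |- Lpv _ (_ + _) => apply: (LpvD p1); Lp_closed
  | |- Lpv _ (- _) => apply: (LpvN p1); Lp_closed
  | |- Lpv _ (_ *: _) => apply: (LpvZ p1); Lp_closed
  | |- Lpv _ 0 => exact: (Lpv0 p1)
  | |- Lpv _ (T _ _) => apply: semigroup_Lpv; Lp_closed
  | |- _ => assumption
  end.

Lemma semigroup_bound t : 0 <= t -> exists2 M : R, 0 <= M & forall x, X x -> N (T t x) <= M * N x.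
Proof.
move=> t0; case: HT => /(_ t t0)[_ _ [M MP]] _ _ _; exists `|M| => // x Xx.
rewrite (le_trans (MP x Xx))// ler_wpM2r ?ler_norm//; exact: Lpv_norm_ge0.
Qed.

Lemma semigroup_lin t a x y : 0 <= t -> X x -> X y -> T t (a *: x + y) ~~ (a *: T t x + T t y).
Proof. by move=> t0 Xx Xy; case: HT => /(_ t t0)[_ H _] _ _ _; exact: H. Qed.

Lemma semigroup_same t x y : 0 <= t -> X x -> X y -> x ~~ y -> T t x ~~ T t y.
Proof.
move=> t0 Xx Xy xy; have [M M0 MP] := semigroup_bound t0.
have Xd : X ((-1) *: y + x) by apply: LpvD => //; exact: LpvZ.
have H := semigroup_lin (-1) t0 Xy Xx.
have : N (T t ((-1) *: y + x)) = 0.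
  apply/eqP; rewrite eq_le Lpv_norm_ge0 andbT.
  rewrite (le_trans (MP _ Xd))//.
  have -> : N ((-1) *: y + x) = 0 by rewrite scaleN1r addrC.
  by rewrite mulr0.
rewrite (Lpv_norm_same p1 _ _ H); [|by Lp_closed|by Lp_closed].
by rewrite /same scaleN1r addrC.
Qed.

Lemma semigroup_sub t x y : 0 <= t -> X x -> X y -> T t (x - y) ~~ (T t x - T t y).
Proof.
move=> t0 Xx Xy; have := semigroup_lin (-1) t0 Xy Xx.
by rewrite !scaleN1r addrC [- T t y + _]addrC.
Qed.

Lemma semigroup_scale t a x : 0 <= t -> X x -> T t (a *: x) ~~ (a *: T t x).
Proof.
move=> t0 Xx; have X00 := Lpv0 (m := m) p1.
have T0 : T t 0 ~~ 0.
  have := semigroup_lin 1 t0 X00 X00; rewrite !scale1r addr0 /same opprD addrA subrr sub0r => H.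
  by rewrite /same subr0 -H; symmetry; exact: Lpv_normN.
have := semigroup_lin a t0 Xx X00; rewrite addr0 => H.
apply: (same_trans p1 _ _ _ H); [by Lp_closed|by Lp_closed|by Lp_closed|].
rewrite -[X in _ ~~ X]addr0; apply: (sameD p1); [by Lp_closed|by Lp_closed|by Lp_closed|by Lp_closed| |by []].
exact: same_refl.
Qed.

Lemma semigroup_add s t x : 0 <= s -> 0 <= t -> X x -> T (s + t) x ~~ T s (T t x).
Proof. by move=> s0 t0 Xx; case: HT => _ _ H _; exact: H. Qed.

Lemma semigroup_zero x : X x -> T 0 x ~~ x.
Proof. by move=> Xx; case: HT => _ H _ _; exact: H. Qed.

Lemma semigroup_cont x t : X x -> 0 <= t -> forall e : R, 0 < e ->
  exists2 d : R, 0 < d & forall s, 0 <= s -> `|t - s| < d -> N (T s x - T t x) < e.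
Proof.
move=> Xx t0 e e0; case: HT => _ _ _ /(_ x t Xx t0) H.
have [d d0 dP] := cvg_withinP (fun h => Lpv_norm_ge0 p _) H e0.
by exists d => // s s0 sd; exact: dP.
Qed.

Local Notation gen := (generator X N T).

Lemma generatorP x y : gen x y <-> [/\ X x, X y & forall e : R, 0 < e ->
  exists2 d : R, 0 < d & forall h, 0 < h -> h < d ->
    N ((h^-1)%:C *: (T h x - x) - y) < e].
Proof.
have k0 (h : R) : 0 <= N ((h^-1)%:C *: (T h x - x) - y) by exact: Lpv_norm_ge0.
by split=> -[Xx Xy H]; split=> //; apply/(cvg_at_right0P k0).
Qed.

(** T s maps the difference quotient of x to that of T s x. *)
Lemma generator_T x y s : 0 <= s -> gen x y -> gen (T s x) (T s y).
Proof.
move=> s0 /generatorP[Xx Xy H]; apply/generatorP; split; [exact: semigroup_Lpv|exact: semigroup_Lpv|].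
move=> e e0; have [M M0 MP] := semigroup_bound s0.
have M1 : 0 < M + 1 by rewrite ltr_wpDl.
have eM : 0 < e / (M + 1) by rewrite divr_gt0.
have [d d0 dP] := H _ eM; exists d => // h h0 hd.
have hp := ltW h0.
have XTx := semigroup_Lpv s0 Xx; have XTh := semigroup_Lpv hp Xx; have XThs := semigroup_Lpv hp XTx; have XTsh := semigroup_Lpv s0 XTh.
have Xd : X ((h^-1)%:C *: (T h x - x) - y) by apply: LpvB => //; apply: LpvZ => //; exact: LpvB.
have e1 : T h (T s x) ~~ T s (T h x).
  apply: (same_trans p1 (g := T (h + s) x)) => //.
  - by apply: semigroup_Lpv => //; exact: addr_ge0.
  - by apply: same_sym; exact: semigroup_add.
  - by rewrite addrC; exact: semigroup_add.
have e2 : T s ((h^-1)%:C *: (T h x - x) - y) ~~ ((h^-1)%:C *: (T h (T s x) - T s x) - T s y).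
  have XBs : X (T h x - x) by exact: LpvB.
  have XZs : X ((h^-1)%:C *: (T h x - x)) by exact: LpvZ.
  have XTBs : X (T s (T h x - x)) by exact: semigroup_Lpv.
  have XBB : X (T s (T h x) - T s x) by exact: LpvB.
  have XBB' : X (T h (T s x) - T s x) by exact: LpvB.
  apply: (same_trans p1 (g := T s ((h^-1)%:C *: (T h x - x)) - T s y)); [by Lp_closed|by Lp_closed|by Lp_closed|by apply: semigroup_sub; Lp_closed|].
  apply: (sameB p1); [by Lp_closed|by Lp_closed|by Lp_closed|by Lp_closed| |exact: same_refl].
  apply: (same_trans p1 (g := (h^-1)%:C *: T s (T h x - x))); [by Lp_closed|by Lp_closed|by Lp_closed|by apply: semigroup_scale; Lp_closed|].
  apply: (sameZ p1) => //.
  apply: (same_trans p1 (g := T s (T h x) - T s x)) => //; first exact: semigroup_sub.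
  apply: (sameB p1) => //; last exact: same_refl.
  exact: same_sym.
rewrite -(Lpv_norm_same p1 _ _ e2); [|by Lp_closed|by Lp_closed].
rewrite (le_lt_trans (MP _ Xd))//.
apply: (@le_lt_trans _ _ ((M + 1) * N ((h^-1)%:C *: (T h x - x) - y))).
  by rewrite ler_wpM2r ?Lpv_norm_ge0// lerDl.
by rewrite mulrC -ltr_pdivlMr// dP.
Qed.

Lemma generator_fun x x' y y' : gen x y -> gen x' y' -> x ~~ x' -> y ~~ y'.
Proof.
move=> /generatorP[Xx Xy H] /generatorP[Xx' Xy' H'] xx'.
rewrite /same; apply/eqP; rewrite eq_le Lpv_norm_ge0 andbT.
apply/ler_addgt0Pr => e e0; rewrite add0r.
have e2 : 0 < e / 2 by rewrite divr_gt0.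
have [d d0 dP] := H _ e2; have [d' d'0 d'P] := H' _ e2.
pose h := Num.min d d' / 2.
have mdd : 0 < Num.min d d' by rewrite lt_min d0.
have h0 : 0 < h by rewrite divr_gt0.
have hm : h < Num.min d d' by rewrite ltr_pdivrMr// ltr_pMr// ltr1n.
have /andP[hd hd'] : (h < d) && (h < d') by rewrite -lt_min.
have := dP h h0 hd; have := d'P h h0 hd'.
set a := (_ *: _) in d'P *; set b := (h^-1)%:C *: (T h x - x).
have Xa z : X z -> X ((h^-1)%:C *: (T h z - z)).
  by move=> Xz; apply: LpvZ => //; apply: LpvB => //; apply: semigroup_Lpv => //; exact: ltW.
have ba : b ~~ a.
  apply: (sameZ p1); [by Lp_closed|by Lp_closed|].
  apply: (sameB p1); [by Lp_closed|by Lp_closed|by Lp_closed|by Lp_closed| |by []].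
  by apply: semigroup_same => //; exact: ltW.
move=> h1 h2.
have XA : X a by exact: Xa.
have XBb : X b by exact: Xa.
rewrite (le_trans (Lpv_norm_sub p1 Xy XBb Xy'))//.
rewrite (splitr e); apply: lerD.
  have -> : N (y - b) = N (b - y) by rewrite -opprB Lpv_normN.
  exact: ltW.
rewrite (le_trans (Lpv_norm_sub p1 XBb XA Xy'))//.
by have -> : N (b - a) = 0 by []; rewrite add0r ltW.
Qed.

End Semigroup.

(** * Windows of the orbits of the semigroup *)

Section TransportSemigroup.
Context {R : realType} {n m : nat}.
Local Notation C := R[i].
Local Notation mu := (@lebesgue_measure R).
Variable p : R.
Hypothesis p1 : 1 <= p.
Variable Net : network R n m.
Local Notation B := (adjB Net).
Local Notation X := (@Lpv R p m).
Local Notation N := (@Lpv_norm R p m).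
Local Notation "x ~~ y" := (same N x y) (at level 70).
Local Notation E a b x := (vintegral `[a, b] (ext B x)).
Implicit Types (x y z F : R -> 'cV[C]_m).

Lemma AC_Lpv (g F : R -> 'cV[C]_m) : vintegrable `[0, 1] g ->
  (forall a b, 0 <= a -> a <= b -> b <= 1 -> F b - F a = vintegral `[a, b] g) -> X F.
Proof.
move=> gi Fg.
have [wF [cF _]] := vFTC_weak_derivative gi Fg.
have mF : vmeas `[0, 1] F.
  by move=> j; have [c1 c2] := cF j; split; exact: continuous_within_measurable.
apply: (Lpv_bounded p1 (M := cvnorm (F 0) + 2 * \int[mu]_(s in `[0, 1]) cvnorm (g s))) => //.
move=> s /andP[s0 s1]; rewrite -[F s](subrK (F 0)) addrC (le_trans (cvnormD _ _))// lerD2l.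
have sub : `[0, s] `<=` `[(0 : R), 1] by apply: subset_itvl; rewrite bnd_simp.
have gs : vintegrable `[0, s] g by apply: vintegrableS sub gi.
rewrite Fg// (le_trans (cvnorm_vintegral_le _ gs))// ler_wpM2l//.
rewrite (Rintegral_itv_cat s0 s1); last exact: vintegrable_cvnorm.
by rewrite lerDl Rintegral_ge0// => z _; exact: cvnorm_ge0.
Qed.

Lemma ext_integrable a b x : 0 <= a -> X x -> vintegrable `[a, b] (ext B x).
Proof. by move=> a0 Xx; exact: ext_vintegrable (Lpv_vintegrable p1 Xx) a0. Qed.

Lemma window_add a b x y : 0 <= a -> X x -> X y -> E a b (x + y) = E a b x + E a b y.
Proof.
move=> a0 Xx Xy; rewrite -vintegralD//; try exact: ext_integrable.
by apply: eq_vintegral => s _; rewrite extD.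
Qed.

Lemma window_scale a b c x : 0 <= a -> X x -> E a b (c *: x) = c *: E a b x.
Proof.
move=> a0 Xx; rewrite -vintegralZ//; last exact: ext_integrable.
by apply: eq_vintegral => s _; rewrite extZ.
Qed.

Lemma window_sub a b x y : 0 <= a -> X x -> X y -> E a b (x - y) = E a b x - E a b y.
Proof.
move=> a0 Xx Xy; rewrite -[- y]scaleN1r window_add//; last exact: LpvZ.
by rewrite window_scale// scaleN1r.
Qed.

Lemma window_bound (L : R) : exists2 c : R, 0 <= c & forall x a b, X x -> 0 <= a -> a <= b ->
  b <= L -> cvnorm (E a b x) <= c * N x.
Proof.
have [c c0 cP] := ext_L1_bound B (Num.truncn L).+1.
exists (2 * (c * 2)); first by rewrite mulr_ge0// mulr_ge0.
move=> x a b Xx a0 ab bL; have b0 := le_trans a0 ab.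
have xi := Lpv_vintegrable p1 Xx.
have bK : b <= (Num.truncn L).+1%:R by rewrite (le_trans bL)// ltW// truncnS_gt.
have ei u v : 0 <= u -> mu.-integrable `[u, v] (EFin \o (fun s => cvnorm (ext B x s))).
  by move=> u0; apply: vintegrable_cvnorm => //; exact: ext_integrable.
rewrite (le_trans (cvnorm_vintegral_le _ (ext_integrable _ a0 Xx)))// -!mulrA ler_wpM2l//.
have pos u v : 0 <= \int[mu]_(s in `[u, v]) cvnorm (ext B x s).
  by apply: Rintegral_ge0 => s _; exact: cvnorm_ge0.
have H := cP x xi.
rewrite (Rintegral_itv_cat b0 bK) ?(Rintegral_itv_cat a0 ab) in H; try exact: ei.
apply: (@le_trans _ _ (c * \int[mu]_(s in `[0, 1]) cvnorm (x s))).
  by apply: le_trans H; rewrite -addrA addrCA lerDl addr_ge0.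
by rewrite ler_wpM2l// Lpv_norm_L1.
Qed.

Lemma window_same a b x y : 0 <= a -> a <= b -> X x -> X y -> x ~~ y -> E a b x = E a b y.
Proof.
move=> a0 ab Xx Xy xy; apply/eqP; rewrite -subr_eq0 -window_sub//; apply/eqP.
have [c _ cP] := window_bound b; apply: cvnorm_eq0.
rewrite (le_trans (cP _ a b _ a0 ab (lexx _)))//; first exact: LpvB.
by rewrite xy mulr0.
Qed.

Lemma window_cat a b c x : 0 <= a -> a <= b -> b <= c -> X x -> E a c x = E a b x + E b c x.
Proof. by move=> a0 ab bc Xx; apply: vintegral_itv_cat => //; exact: ext_integrable. Qed.

(** The defect d = F 1 - B F 0 in the boundary condition is what makes the
    extension of F jump. *)
Lemma op_Am_ext x x1 d : op_Am p Net x x1 -> op_Q p Net x d ->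
  exists F, [/\ X F, x ~~ F, d = F 1 - B *m F 0,
    (forall a b, 0 <= a -> a <= b -> b <= 1 -> F b - F a = vintegral `[a, b] x1) &
    forall rho, 0 <= rho ->
      ext B F rho + \sum_(k < Num.truncn rho) iter k (mulmx B) d = F 0 + E 0 rho x1].
Proof.
move=> [Xx Xx1 wx _] [_ [F cF dE]].
have xi := Lpv_vintegrable p1 Xx; have x1i := Lpv_vintegrable p1 Xx1.
have FTC := weak_derivative_vFTC xi x1i wx cF.
have XF : X F by exact: AC_Lpv FTC.
exists F; split => //; last exact: ext_FTC.
apply/(same_aeP p1) => //; case: cF => _; apply: ae_mono => s H sI.
by rewrite H.
Qed.

(** For d = 0 there are no jumps: the extension of an element of D(A) is a
    primitive on the whole half-line. *)
Lemma op_A_ext x x1 : op_A p Net x x1 ->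
  exists F, [/\ X x, X x1, X F, x ~~ F &
    forall a b, 0 <= a -> a <= b -> ext B F b - ext B F a = E a b x1].
Proof.
move=> [Am Q]; have [F [XF xF _ _ FE]] := op_Am_ext Am Q.
have [Xx Xx1 _ _] := Am; exists F; split => // a b a0 ab.
have FE0 rho : 0 <= rho -> ext B F rho = F 0 + E 0 rho x1.
  by move=> r0; rewrite -FE// big1 ?addr0// => k _; exact: iter_mulmx0.
rewrite !FE0 ?(le_trans a0)// (window_cat (lexx _) a0 ab)//.
by rewrite opprD addrACA subrr add0r addrAC subrr add0r.
Qed.

Lemma window_near_const (a b : R) (F : R -> 'cV[C]_m) (d : 'cV[C]_m) (M : R) :
  0 <= a -> a <= b -> X F -> (forall s, a <= s -> s <= b -> cvnorm (d - ext B F s) <= M) ->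
  cvnorm ((b - a)%:C *: d - E a b F) <= 2 * (M * (b - a)).
Proof.
move=> a0 ab XF FM.
have ci : vintegrable `[a, b] (fun _ => d).
  move=> j; split; exact: integrable_itv_cst.
have -> : (b - a)%:C *: d = vintegral `[a, b] (fun _ => d).
  apply/matrixP => j k; rewrite ord1 !mxE /cintegral !Rintegral_itv_cst//.
  by apply: complex_eq; rewrite ?Re_mulc ?Im_mulc /= mul0r ?subr0 ?addr0 mulrC.
have Fi := ext_integrable b a0 XF.
rewrite -vintegralB//; have Di := vintegrableB (measurable_itv _) ci Fi.
rewrite (le_trans (cvnorm_vintegral_le _ Di))// ler_wpM2l//.
rewrite -Rintegral_itv_cst//; apply: le_Rintegral => //.
- exact: vintegrable_cvnorm.
- exact: integrable_itv_cst.
- by move=> s /=; rewrite in_itv/= => /andP[as_ sb]; exact: FM.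
Qed.

Lemma shift_difference (u v w f1 f2 : 'cV[C]_m) :
  (u - v) + (f1 - f2) - (u - w) = (f1 - v) - (f2 - w).
Proof. by apply/matrixP => j k; rewrite !mxE; ring. Qed.

Lemma window_difference (A u v w K : 'cV[C]_m) : u + w = A + v ->
  A - K = (u - v) - (K - w).
Proof.
move=> H; have -> : A = u + w - v by rewrite H addrK.
by apply/matrixP => j k; rewrite !mxE; ring.
Qed.

Lemma halves_sum (q u v w e h : R) : q <= e / 2 * h -> v <= e / 4 * h -> w <= e / 4 * h ->
  u <= v + w -> q + u <= e * h.
Proof. lra. Qed.

Lemma telescope_diff (u v w : 'cV[C]_m) : w - v = (u - v) + (w - u).
Proof. by rewrite [RHS]addrC addrA subrK. Qed.

Lemma move_remainder (A b r c : 'cV[C]_m) : A + (b + r) - c = r + (A + b - c).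
Proof. by apply/matrixP => j k; rewrite !mxE; ring. Qed.

Variable T : R -> (R -> 'cV[C]_m) -> (R -> 'cV[C]_m).
Hypothesis HT : strongly_continuous_semigroup X N T.
Hypothesis HG : generates X N (op_A p Net) T.

Ltac Lp_closed := lazymatch goal with
  | |- is_true _ => first [assumption | exact: ltW]
  | |- Lpv _ (_ + _) => apply: (LpvD p1); Lp_closed
  | |- Lpv _ (- _) => apply: (LpvN p1); Lp_closed
  | |- Lpv _ (_ *: _) => apply: (LpvZ p1); Lp_closed
  | |- Lpv _ 0 => exact: (Lpv0 p1)
  | |- Lpv _ (T _ _) => apply: (semigroup_Lpv HT); Lp_closed
  | |- _ => assumption
  end.

(** Two first order effects cancel. Since x is in D(A), T h x is x + h x1 up
    to o(h); and moving the window to the left by h changes the integral of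
    ext B F by - h (ext B F b - ext B F a) + o(h), where the difference of the
    values is the window of x1. *)
Lemma window_right_derivative (x x1 : R -> 'cV[C]_m) (a b : R) : op_A p Net x x1 -> 0 < a -> a <= b ->
  forall e : R, 0 < e -> exists2 d : R, 0 < d & forall h, 0 < h -> h < d -> h <= a ->
    cvnorm (E (a - h) (b - h) (T h x) - E a b x) <= e * h.
Proof.
move=> Ax a0 ab e e0.
have [F [Xx Xx1 XF xF FE]] := op_A_ext Ax.
have [c c0 cP] := window_bound b.
have c1 : 0 < c + 1 by rewrite ltr_wpDl.
have /generatorP[_ _ gen] := (HG x x1).1 Ax.
have e2 : 0 < e / 2 / (c + 1) by rewrite !divr_gt0.
have e16 : 0 < e / 16 by rewrite divr_gt0.
have [d1 d10 d1P] := gen _ e2.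
have [d2 d20 d2P] := vabs_continuity (ext_integrable b (lexx 0) Xx1) e16.
exists (Num.min d1 d2); first by rewrite lt_min d10.
move=> h h0; rewrite lt_min => /andP[hd1 hd2] ha.
have hn0 := ltW h0.
have b0 : 0 < b := lt_le_trans a0 ab.
have am0 : 0 <= a - h by rewrite subr_ge0.
have bm0 : 0 <= b - h by rewrite subr_ge0 (le_trans ha).
have abm : a - h <= b - h by rewrite lerD2r.
have amh : a - h <= a by rewrite gerBl.
have bmh : b - h <= b by rewrite gerBl.
pose r := (h^-1)%:C *: (T h x - x) - x1.
have Xr : X r by rewrite /r; Lp_closed.
have hC : (h%:C : C) * (h^-1)%:C = 1.
  by rewrite -(rmorphM (real_complex R)) /= divff ?gt_eqF.
have decomp : T h x = x + (h%:C *: x1 + h%:C *: r).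
  rewrite /r -scalerDr [x1 + _]addrC subrK scalerA hC scale1r addrC subrK //.
rewrite decomp !window_add ?window_scale//; [|by Lp_closed|by Lp_closed|by Lp_closed].
have H1 : cvnorm (h%:C *: E (a - h) (b - h) r) <= e / 2 * h.
  rewrite cvnormZ normc_real ger0_norm// mulrC ler_wpM2r//.
  rewrite (le_trans (cP r _ _ Xr am0 abm bmh))//.
  apply: (@le_trans _ _ ((c + 1) * N r)); first by rewrite ler_wpM2r ?Lpv_norm_ge0// lerDl.
  by rewrite mulrC -ler_pdivlMr// ltW// d1P.
have side (u s : R) : 0 <= u -> u <= s -> s <= b -> s - u < d2 ->
    cvnorm ((s - u)%:C *: ext B F u - E u s F) <= e / 4 * (s - u).
  move=> u0 us sb sud.
  have FM (z : R) : u <= z -> z <= s -> cvnorm (ext B F u - ext B F z) <= e / 8.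
    move=> z1 z2; rewrite -[X in cvnorm X]opprB cvnormN FE//.
    apply: (le_trans (cvnorm_vintegral_le _ (ext_integrable _ u0 Xx1))) => //.
    have zh : z - u < d2 by rewrite (le_lt_trans _ sud)// lerD2r.
    have := ltW (d2P _ _ u0 z1 (le_trans z2 sb) zh); lra.
  by have := window_near_const u0 us XF FM; lra.
have H2 : E (a - h) (b - h) x + h%:C *: E (a - h) (b - h) x1 - E a b x =
    (h%:C *: ext B F (b - h) - E (b - h) b F) - (h%:C *: ext B F (a - h) - E (a - h) a F).
  rewrite -FE// scalerBr (window_same am0 abm Xx XF xF) (window_same (ltW a0) ab Xx XF xF).
  have c1' : E (a - h) b F = E (a - h) a F + E a b F by exact: window_cat am0 amh ab XF.
  have c2' : E (a - h) b F = E (a - h) (b - h) F + E (b - h) b F by exact: window_cat.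
  have -> : E a b F = E (a - h) b F - E (a - h) a F by rewrite c1' addrC addrA addNr add0r.
  have -> : E (a - h) (b - h) F = E (a - h) b F - E (b - h) b F by rewrite c2' addrK.
  exact: shift_difference.
have -> : E (a - h) (b - h) x + (h%:C *: E (a - h) (b - h) x1 + h%:C *: E (a - h) (b - h) r) - E a b x =
   h%:C *: E (a - h) (b - h) r + (E (a - h) (b - h) x + h%:C *: E (a - h) (b - h) x1 - E a b x).
  exact: move_remainder.
apply: (le_trans (cvnormD _ _)); rewrite H2.
have hb : b - (b - h) = h by rewrite subKr.
have ha' : a - (a - h) = h by rewrite subKr.
have := side _ _ bm0 bmh (lexx _); rewrite hb => /(_ hd2) Sb.
have := side _ _ am0 amh ab; rewrite ha' => /(_ hd2) Sa.
have := cvnormB (h%:C *: ext B F (b - h) - E (b - h) b F) (h%:C *: ext B F (a - h) - E (a - h) a F).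
by move=> H3; exact: halves_sum H1 Sb Sa H3.
Qed.

Lemma op_A_T (x x1 : R -> 'cV[C]_m) (s : R) : 0 <= s -> op_A p Net x x1 ->
  op_A p Net (T s x) (T s x1).
Proof. by move=> s0 /(HG x x1).1 gx; apply/(HG _ _); exact: (generator_T p1 HT). Qed.

(** Strong continuity controls the change of the state, absolute continuity of
    the integral the change of the window. *)
Lemma window_left_continuous (y : R -> 'cV[C]_m) (a b s : R) : X y -> 0 <= a -> a <= b -> 0 < s ->
  forall e : R, 0 < e -> exists2 d : R, 0 < d & forall h, 0 < h -> h < d -> h <= s ->
    cvnorm (E a b (T s y) - E (a + h) (b + h) (T (s - h) y)) <= e.
Proof.
move=> Xy a0 ab s0 e e0; have sn0 := ltW s0; have b0 : 0 <= b := le_trans a0 ab.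
have [c c0 cP] := window_bound (b + s).
have c1 : 0 < c + 1 by rewrite ltr_wpDl.
have e2 : 0 < e / 2 / (c + 1) by rewrite !divr_gt0.
have e8 : 0 < e / 8 by rewrite divr_gt0.
have [d1 d10 d1P] := semigroup_cont HT Xy sn0 e2.
have Xw : X (T s y) by Lp_closed.
have [d2 d20 d2P] := vabs_continuity (ext_integrable (b + s) (lexx 0) Xw) e8.
exists (Num.min d1 d2); first by rewrite lt_min d10.
move=> h h0; rewrite lt_min => /andP[hd1 hd2] hs; have hn0 := ltW h0.
have sh0 : 0 <= s - h by rewrite subr_ge0.
have ah0 : 0 <= a + h by rewrite addr_ge0.
have abh : a + h <= b + h by rewrite lerD2r.
have bhs : b + h <= b + s by rewrite lerD2l.
have aah : a <= a + h by rewrite lerDl.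
have bbh : b <= b + h by rewrite lerDl.
have Xsh : X (T (s - h) y) by Lp_closed.
set w := T s y.
have Xw' : X w by [].
have Xd : X (T (s - h) y - w) by Lp_closed.
have H1 : cvnorm (E (a + h) (b + h) (T (s - h) y - w)) <= e / 2.
  rewrite (le_trans (cP _ _ _ Xd ah0 abh bhs))//.
  apply: (@le_trans _ _ ((c + 1) * N (T (s - h) y - w))).
    by rewrite ler_wpM2r ?Lpv_norm_ge0// lerDl.
  rewrite mulrC -ler_pdivlMr// ltW// d1P//.
  by rewrite subKr gtr0_norm.
have side (u : R) : 0 <= u -> u <= b -> cvnorm (E u (u + h) w) <= e / 4.
  move=> u0 ub; have uh : u <= u + h by rewrite lerDl.
  have uhb : u + h <= b + s by rewrite lerD.
  have hd : u + h - u < d2 by rewrite addrAC subrr add0r.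
  rewrite (le_trans (cvnorm_vintegral_le _ (ext_integrable _ u0 Xw)))//.
  by have := ltW (d2P _ _ u0 uh uhb hd); lra.
have c1' : E a (b + h) w = E a b w + E b (b + h) w by exact: window_cat.
have c2' : E a (b + h) w = E a (a + h) w + E (a + h) (b + h) w by exact: window_cat.
have -> : E a b w - E (a + h) (b + h) (T (s - h) y) =
    (E a (a + h) w - E b (b + h) w) - E (a + h) (b + h) (T (s - h) y - w).
  rewrite window_sub//; apply: window_difference; exact: etrans (esym c2') c1'.
have D1 := cvnormB (E a (a + h) w - E b (b + h) w) (E (a + h) (b + h) (T (s - h) y - w)).
have D2 := cvnormB (E a (a + h) w) (E b (b + h) w).
rewrite (le_trans D1)// addrC -[e]mulr1.
by apply: (halves_sum _ _ _ D2); rewrite ?mulr1//; exact: side.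
Qed.

(** The integral of ext B (T s y) over [a + r - s, b + r - s] interpolates
    between the two sides. It is constant in s, by [almost_nonincreasing] for
    its distance to the value at s = 0 and with arbitrarily small slope e. *)
Lemma window_transport_domain (y y1 : R -> 'cV[C]_m) (r a b : R) : op_A p Net y y1 ->
  0 <= r -> 0 <= a -> a <= b -> E a b (T r y) = E (a + r) (b + r) y.
Proof.
move=> Ay r0 a0 ab.
have [_ [Xy _ _ _ _]] := op_A_ext Ay.
pose P s := E (a + (r - s)) (b + (r - s)) (T s y).
pose q s := cvnorm (P s - P 0).
have P0 : P 0 = E (a + r) (b + r) y.
  have XT0 : X (T 0 y) by exact: (semigroup_Lpv HT (lexx 0)).
  rewrite /P subr0; apply: window_same => //; [exact: addr_ge0|by rewrite lerD2r|].
  exact: (semigroup_zero HT).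
have Pr : P r = E a b (T r y) by rewrite /P subrr !addr0.
rewrite -Pr -P0; apply/eqP; rewrite -subr_eq0; apply/eqP; apply: cvnorm_eq0.
have main e : 0 < e -> q r <= e * r.
  move=> e0; have -> : e * r = q 0 + e * r by rewrite /q subrr cvnorm0 add0r.
  apply: almost_nonincreasing => //; first exact: ltW.
  - move=> s s0 sr; have srn : 0 < r - s by rewrite subr_gt0.
    have al0 : 0 < a + (r - s) by rewrite ltr_wpDl.
    have abl : a + (r - s) <= b + (r - s) by rewrite lerD2r.
    have [d d0 dP] := window_right_derivative (op_A_T s0 Ay) al0 abl e0.
    exists d => // h h0 hd shr.
    have ha : h <= a + (r - s) by rewrite ler_wpDl// lerBrDl.
    have := dP h h0 hd ha.
    have -> : E (a + (r - s) - h) (b + (r - s) - h) (T h (T s y)) = P (s + h).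
      rewrite /P opprD !addrA; apply: window_same.
      + by move: ha; rewrite -subr_ge0 addrA.
      + by rewrite !lerD2r.
      + by have := ltW h0; move=> hh; Lp_closed.
      + by have := addr_ge0 s0 (ltW h0); move=> hh; Lp_closed.
      + by rewrite addrC; apply: same_sym => //; apply: (semigroup_add HT) => //; exact: ltW.
    rewrite -/(P s) => H.
    have -> : q (s + h) = cvnorm ((P s - P 0) + (P (s + h) - P s)).
      by rewrite /q -telescope_diff.
    by rewrite (le_trans (cvnormD _ _))// lerD2l.
  - move=> s nn s0 sr n0.
    have al0 : 0 <= a + (r - s) by rewrite addr_ge0// subr_ge0.
    have abl : a + (r - s) <= b + (r - s) by rewrite lerD2r.
    have [d d0 dP] := window_left_continuous Xy al0 abl s0 n0.
    exists d => // h h0 hd hs.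
    have := dP h h0 hd hs.
    rewrite -/(P s).
    have -> : E (a + (r - s) + h) (b + (r - s) + h) (T (s - h) y) = P (s - h).
      by rewrite /P opprB !addrA !(addrAC _ h).
    move=> H; have -> : q s = cvnorm ((P (s - h) - P 0) + (P s - P (s - h))).
      by rewrite /q -telescope_diff.
    by rewrite (le_trans (cvnormD _ _))// lerD2l.
rewrite -/(q r); apply/ler_addgt0Pr => e e0; rewrite add0r.
have e1 : 0 < e / (r + 1) by rewrite divr_gt0// ltr_wpDl.
rewrite (le_trans (main _ e1))// -mulrA ler_piMr ?(ltW e0)//.
by rewrite ler_pdivrMl ?ltr_wpDl// mulr1 lerDl.
Qed.

End TransportSemigroup.

Section WindowTransport.
Context {R : realType} {n m : nat}.
Local Notation C := R[i].
Local Notation mu := (@lebesgue_measure R).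
Variable p : R.
Hypothesis p1 : 1 <= p.
Variable Net : network R n m.
Local Notation B := (adjB Net).
Local Notation X := (@Lpv R p m).
Local Notation N := (@Lpv_norm R p m).
Local Notation "x ~~ y" := (same N x y) (at level 70).
Local Notation E a b x := (vintegral `[a, b] (ext B x)).
Implicit Types (x y z F : R -> 'cV[C]_m).

(** This recovers the values of a continuous extension from its windows. *)
Lemma ext_right_average z F (a : R) : X F -> X z -> 0 <= a ->
  (forall u v : R, 0 <= u -> u <= v -> ext B F v - ext B F u = E u v z) ->
  forall e : R, 0 < e -> exists2 d : R, 0 < d & forall h : R, 0 < h -> h < d ->
    cvnorm (h%:C *: ext B F a - E a (a + h) F) <= e * h.
Proof.
move=> XF Xz a0 FE e e0; have e4 : 0 < e / 4 by rewrite divr_gt0.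
have [d d0 dP] := vabs_continuity (ext_integrable p1 Net (a + 1) (lexx 0) Xz) e4.
exists (Num.min d 1); first by rewrite lt_min d0/=.
move=> h h0; rewrite lt_min => /andP[hd h1].
have ah : a <= a + h by rewrite lerDl ltW.
have hh : a + h - a = h by rewrite addrAC subrr add0r.
have FM (s : R) : a <= s -> s <= a + h -> cvnorm (ext B F a - ext B F s) <= e / 2.
  move=> as_ sah; rewrite -[X in cvnorm X]opprB cvnormN FE//.
  rewrite (le_trans (cvnorm_vintegral_le _ (ext_integrable p1 Net s a0 Xz)))//.
  have sd : s - a < d by rewrite (le_lt_trans _ hd)// lerBlDl.
  have s1 : s <= a + 1 by rewrite (le_trans sah)// lerD2l ltW.
  by have := ltW (dP a s a0 as_ s1 sd); lra.
have := window_near_const p1 a0 ah XF FM; rewrite hh.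
by move=> H; rewrite (le_trans H)// mulrA [2 * _]mulrC divfK.
Qed.

Lemma sub_common (u v a : 'cV[C]_m) : u - v = (u - a) - (v - a).
Proof. by rewrite opprB addrA subrK. Qed.

Variable T : R -> (R -> 'cV[C]_m) -> (R -> 'cV[C]_m).
Hypothesis HT : strongly_continuous_semigroup X N T.
Hypothesis HG : generates X N (op_A p Net) T.
Variable lam : C.
Hypothesis HR : resolvent_set X N (op_A p Net) lam.

(** Write x as lam y - z with (y, z) in the graph of A. The windows of y are
    transported by [window_transport_domain], hence so are the values of its
    continuous extension, hence so are the windows of z, which are differences
    of such values. *)
Lemma window_transport x (r a b : R) : X x -> 0 <= r -> 0 <= a -> a <= b ->
  E a b (T r x) = E (a + r) (b + r) x.
Proof.
move=> Xx r0 a0 ab; have [S [_ /(_ x Xx)[z [Az lx]] _]] := HR.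
set y := S x in Az lx.
have [F [Xy Xz XF yF FE]] := op_A_ext p1 Az.
have [F' [XTy XTz XF' yF' FE']] := op_A_ext p1 (op_A_T p1 HT HG r0 Az).
have key (u v : R) : 0 <= u -> u <= v -> E u v F' = E (u + r) (v + r) F.
  move=> u0 uv; rewrite -(window_same p1 Net u0 uv XTy XF' yF') (window_transport_domain p1 HT HG Az r0 u0 uv).
  by apply: (window_same p1 Net _ _ Xy XF yF); rewrite ?addr_ge0 ?lerD2r.
have ext_eq (u : R) : 0 <= u -> ext B F' u = ext B F (u + r).
  move=> u0; apply/eqP; rewrite -subr_eq0; apply/eqP; apply: cvnorm_eq0.
  apply/ler_addgt0Pr => e e0; rewrite add0r.
  have e2 : 0 < e / 2 by rewrite divr_gt0.
  have ur0 : 0 <= u + r by rewrite addr_ge0.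
  have [d1 d10 d1P] := ext_right_average XF' XTz u0 FE' e2.
  have [d2 d20 d2P] := ext_right_average XF Xz ur0 FE e2.
  pose h := Num.min d1 d2 / 2.
  have m0 : 0 < Num.min d1 d2 by rewrite lt_min d10.
  have h0 : 0 < h by rewrite divr_gt0.
  have hm : h < Num.min d1 d2 by rewrite /h ltr_pdivrMr// mulr_natr mulr2n ltrDl.
  move: (hm); rewrite lt_min => /andP[hd1 hd2].
  have := d1P h h0 hd1; have := d2P h h0 hd2.
  have uh : u <= u + h by rewrite lerDl ltW.
  have -> : E (u + r) (u + r + h) F = E u (u + h) F' by rewrite key// addrAC.
  move=> H1 H2; have H3 : cvnorm (h%:C *: (ext B F' u - ext B F (u + r))) <= e * h.
    rewrite scalerBr (sub_common _ _ (E u (u + h) F')).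
    rewrite (splitr e) mulrDl; exact: le_trans (cvnormB _ _) (lerD H2 H1).
  by move: H3; rewrite cvnormZ normc_real gtr0_norm// mulrC ler_pM2r.
have XTx : X (T r x) by exact: (semigroup_Lpv HT).
have ar0 : 0 <= a + r by rewrite addr_ge0.
have abr : a + r <= b + r by rewrite lerD2r.
have Xl : X (lam *: y) by exact: (LpvZ p1).
have Xly : X (lam *: y - z) by exact: (LpvB p1).
have XTl : X (T r (lam *: y)) by exact: (semigroup_Lpv HT).
have XlT : X (lam *: T r y) by exact: (LpvZ p1).
have XTly : X (T r (lam *: y - z)) by exact: (semigroup_Lpv HT).
have XTB : X (T r (lam *: y) - T r z) by exact: (LpvB p1).
have s1 := same_sym (semigroup_same p1 HT r0 Xly Xx lx).
rewrite (window_same p1 Net a0 ab XTx XTly s1).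
rewrite (window_same p1 Net a0 ab XTly XTB (semigroup_sub HT r0 Xl Xz)) (window_sub p1 Net b a0 XTl XTz).
rewrite (window_same p1 Net a0 ab XTl XlT (semigroup_scale p1 HT lam r0 Xy)) (window_scale p1 Net b lam a0 XTy).
rewrite (window_transport_domain p1 HT HG Az r0 a0 ab) -FE'// !ext_eq//; last exact: le_trans ab.
rewrite FE// -(window_scale p1 Net (b + r) lam ar0 Xy) -(window_sub p1 Net (b + r) ar0 Xl Xz).
exact: (window_same p1 Net ar0 abr Xly Xx lx).
Qed.

Lemma semigroup_shift x (r : R) : X x -> 0 <= r -> X (fun s => ext B x (s + r)) ->
  T r x ~~ (fun s => ext B x (s + r)).
Proof.
move=> Xx r0 XS; have XTx : X (T r x) by exact: (semigroup_Lpv HT).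
apply: (vintegral_same p1 XTx XS) => b b0 b1.
rewrite vintegral_itv_translate; last first.
  by apply: vintegrable_vmeas; apply: (ext_integrable p1 Net _ _ Xx); rewrite addr_ge0.
rewrite -(window_transport Xx r0 (lexx 0) b0).
apply: eq_co_vintegral => //.
  move=> s s0 sb; rewrite ext_small//; exact: lt_le_trans b1.
apply: vintegrableS (Lpv_vintegrable p1 XTx) => //; apply: subset_itvl; rewrite bnd_simp//.
Qed.

End WindowTransport.

(** * The extended kernel of lam - A_m *)

Section Kernel.
Context {R : realType} {m : nat}.
Local Notation C := R[i].
Local Notation mu := (@lebesgue_measure R).
Variables (B : 'M[C]_m) (F : R -> 'cV[C]_m) (d : 'cV[C]_m) (lam : C).
Hypothesis Fi : vintegrable `[0, 1] F.
Hypothesis FE : forall rho : R, 0 <= rho ->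
  ext B F rho + \sum_(k < Num.truncn rho) iter k (mulmx B) d =
  F 0 + lam *: vintegral `[0, rho] (ext B F).
Local Notation K := (ext B F).

(** The integral equation bounds K by its L^1 norm on [0, L] and by the
    finitely many jumps there. *)
Lemma kernel_bounded (L : R) : exists2 M : R, 0 <= M &
  forall rho, 0 <= rho -> rho <= L -> cvnorm (K rho) <= M.
Proof.
pose J := \int[mu]_(s in `[0, L]) cvnorm (K s).
have Ki a b : 0 <= a -> vintegrable `[a, b] K by exact: ext_vintegrable.
have ki a b : 0 <= a -> mu.-integrable `[a, b] (EFin \o (fun s => cvnorm (K s))).
  by move=> a0; apply: vintegrable_cvnorm => //; exact: Ki.
have J0 : 0 <= J by apply: Rintegral_ge0 => s _; exact: cvnorm_ge0.
exists (cvnorm (F 0) + Normc.normc lam * (2 * J)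
   + \sum_(k < Num.truncn L) cvnorm (iter k (mulmx B) d)).
  rewrite addr_ge0//; first by rewrite addr_ge0 ?cvnorm_ge0// mulr_ge0 ?normc_ge0// mulr_ge0.
  by apply: sumr_ge0 => k _; exact: cvnorm_ge0.
move=> rho r0 rL.
have -> : K rho = F 0 + lam *: vintegral `[0, rho] K -
    \sum_(k < Num.truncn rho) iter k (mulmx B) d by rewrite -FE// addrK.
rewrite (le_trans (cvnormB _ _))// lerD//.
  rewrite (le_trans (cvnormD _ _))// lerD2l cvnormZ ler_wpM2l ?normc_ge0//.
  rewrite (le_trans (cvnorm_vintegral_le _ _))//; first exact: Ki.
  rewrite ler_wpM2l// /J (Rintegral_itv_cat r0 rL); last exact: ki.
  by rewrite lerDl Rintegral_ge0// => s _; exact: cvnorm_ge0.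
rewrite (le_trans (cvnorm_sum _ _))//.
rewrite -!(big_mkord xpredT (fun k => cvnorm (iter k (mulmx B) d))).
have tt : (Num.truncn rho <= Num.truncn L)%N by exact: le_truncn.
rewrite [leRHS](big_cat_nat (leq0n _) tt)//= lerDl; apply: sumr_ge0 => k _; exact: cvnorm_ge0.
Qed.

(** If h is so small that rho + h stays below the next integer, then K does
    not jump after rho and up to rho + h. *)
Lemma kernel_right_continuous (rho : R) : 0 <= rho -> forall e : R, 0 < e ->
  exists2 d' : R, 0 < d' & forall h, 0 <= h -> h < d' -> cvnorm (K (rho + h) - K rho) < e.
Proof.
move=> r0 e e0; have [M M0 MP] := kernel_bounded (rho + 1).
pose c := Normc.normc lam * (2 * M) + 1.
have c0 : 0 < c by rewrite ltr_wpDl// mulr_ge0 ?normc_ge0// mulr_ge0.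
have /andP[t1 t2] := truncn_itv r0.
exists (Num.min (Num.min 1 (e / c)) ((Num.truncn rho).+1%:R - rho)).
  by rewrite !lt_min ltr01 divr_gt0//= subr_gt0.
move=> h h0; rewrite !lt_min => /andP[/andP[h1 hc] ht].
have rh0 : 0 <= rho + h by rewrite addr_ge0.
have rrh : rho <= rho + h by rewrite lerDl.
have tE : Num.truncn (rho + h) = Num.truncn rho.
  by apply: truncn_def; rewrite (le_trans t1)//= addrC -ltrBrDr.
have Ki a b : 0 <= a -> vintegrable `[a, b] K by exact: ext_vintegrable.
have D1 : K (rho + h) - K rho = lam *: vintegral `[rho, rho + h] K.
  have e1 := FE r0; have e2 := FE rh0.
  rewrite tE (vintegral_itv_cat r0 rrh) ?scalerDr ?addrA -?e1 in e2; last exact: Ki.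
  move/(canRL (addrK _)): e2 => ->.
  by apply/matrixP => j k; rewrite !mxE; ring.
rewrite D1 cvnormZ.
have H2 : cvnorm (vintegral `[rho, rho + h] K) <= 2 * (M * h).
  rewrite (le_trans (cvnorm_vintegral_le _ _))//; first exact: Ki.
  rewrite ler_wpM2l//.
  have -> : M * h = \int[mu]_(s in `[rho, rho + h]) M.
    by rewrite Rintegral_itv_cst// addrAC subrr add0r.
  apply: le_Rintegral => //.
  - by apply: vintegrable_cvnorm => //; exact: Ki.
  - exact: integrable_itv_cst.
  - move=> s; rewrite /= in_itv/= => /andP[s1 s2]; apply: MP; first exact: le_trans s1.
    by rewrite (le_trans s2)// lerD2l ltW.
apply: (@le_lt_trans _ _ (c * h)).
  rewrite (le_trans (ler_wpM2l (normc_ge0 _) H2))// /c !mulrA mulrDl mul1r lerDl//.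
by rewrite mulrC -ltr_pdivlMr.
Qed.

Lemma kernel_Lpv (p : R) (r : R) : 1 <= p -> 0 <= r -> Lpv p (fun s => K (s + r)).
Proof.
move=> p1 r0; have [M M0 MP] := kernel_bounded (1 + r).
apply: (Lpv_bounded p1 (M := M)).
  apply: vintegrable_vmeas; apply: vintegrable_itv_translate.
  by apply: ext_vintegrable => //; rewrite add0r.
by move=> s /andP[s0 s1]; apply: MP; rewrite ?addr_ge0// lerD2r.
Qed.

End Kernel.

(** * Iterated integrals of a convolution *)

Section DominatedFubini.
Context {R : realType}.
Local Notation C := R[i].
Local Notation mu := (@lebesgue_measure R).

Lemma cfubini (D : set R) (a b : R) (g : R -> R) (h : R -> R -> C) : a <= b ->
  measurable D -> mu.-integrable D (EFin \o g) ->
  measurable_fun (D `*` `[a, b]) (fun x : R * R => complex.Re (h x.1 x.2)) ->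
  measurable_fun (D `*` `[a, b]) (fun x : R * R => complex.Im (h x.1 x.2)) ->
  (forall s r, D s -> `[a, b]%classic r -> Normc.normc (h s r) <= g s) ->
  [/\ cintegrable `[a, b] (fun r => cintegral D (fun s => h s r)),
      cintegrable D (fun s => cintegral `[a, b] (h s)) &
      cintegral `[a, b] (fun r => cintegral D (fun s => h s r)) =
      cintegral D (fun s => cintegral `[a, b] (h s))].
Proof.
move=> ab mD gi mR mI hg.
have hR s r : D s -> `[a, b]%classic r -> `|complex.Re (h s r)| <= g s.
  by move=> sD rI; exact: le_trans (normRe_le _) (hg _ _ sD rI).
have hI s r : D s -> `[a, b]%classic r -> `|complex.Im (h s r)| <= g s.
  by move=> sD rI; exact: le_trans (normIm_le _) (hg _ _ sD rI).
have [R1 R2 R3] := Rfubini ab mD gi mR hR.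
have [I1 I2 I3] := Rfubini ab mD gi mI hI.
split; [by split; [exact: R1|exact: I1]|by split; [exact: R2|exact: I2]|].
by apply: complex_eq; [exact: R3|exact: I3].
Qed.

Lemma convolution_fubini (D : set R) (a b c M : R) (u k : R -> C) : a <= b ->
  measurable D -> cintegrable D u -> cmeas setT k ->
  (forall s, Normc.normc (k s) <= M) ->
  [/\ cintegrable `[a, b] (fun r => cintegral D (fun s => u s * k (c - s + r))),
      cintegrable D (fun s => u s * cintegral `[a, b] (fun r => k (c - s + r))) &
      cintegral `[a, b] (fun r => cintegral D (fun s => u s * k (c - s + r))) =
      cintegral D (fun s => u s * cintegral `[a, b] (fun r => k (c - s + r)))].
Proof.
move=> ab mD ui [kR kI] kM.
have M0 : 0 <= M := le_trans (normc_ge0 _) (kM 0).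
have [uR uI] := cintegrable_cmeas ui.
have mI : measurable (`[a, b]%classic : set R) by [].
have mX := measurableX mD mI.
have mk (f : R -> R) : measurable_fun setT f ->
    measurable_fun (D `*` `[a, b]) (fun x : R * R => f (c - x.1 + x.2)).
  move=> mf; apply: (measurableT_comp mf); apply: measurable_funTS.
  apply: measurable_funD => //; apply: measurable_funB => //.
have mu_ (f : R -> R) : measurable_fun D f ->
    measurable_fun (D `*` `[a, b]) (fun x : R * R => f x.1).
  exact: measurable_prod_fst.
have gi := integrableZlR M mD (cintegrable_normc mD ui).
have hg s r : D s -> `[a, b]%classic r ->
    Normc.normc (u s * k (c - s + r)) <= M * Normc.normc (u s).
  by move=> _ _; rewrite Normc.normcM mulrC ler_wpM2r// normc_ge0.
have mR : measurable_fun (D `*` `[a, b])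
    (fun x : R * R => complex.Re (u x.1 * k (c - x.1 + x.2))).
  apply: (eq_measurable_fun (fun x : R * R => complex.Re (u x.1) * complex.Re (k (c - x.1 + x.2))
     - complex.Im (u x.1) * complex.Im (k (c - x.1 + x.2)))).
    by move=> x _; rewrite Re_mulc.
  by apply: measurable_funB; apply: measurable_funM;
    [exact: mu_ uR|exact: mk kR|exact: mu_ uI|exact: mk kI].
have mI' : measurable_fun (D `*` `[a, b])
    (fun x : R * R => complex.Im (u x.1 * k (c - x.1 + x.2))).
  apply: (eq_measurable_fun (fun x : R * R => complex.Re (u x.1) * complex.Im (k (c - x.1 + x.2))
     + complex.Im (u x.1) * complex.Re (k (c - x.1 + x.2)))).
    by move=> x _; rewrite Im_mulc.
  by apply: measurable_funD; apply: measurable_funM;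
    [exact: mu_ uR|exact: mk kI|exact: mu_ uI|exact: mk kR].
have [F1 F2 F3] := cfubini ab mD gi mR mI' hg.
have kb s : cintegrable `[a, b] (fun r => k (c - s + r)).
  apply: (cintegrable_le (g := cst M) mI _ (integrable_itv_cst a b M)); last by move=> r _; exact: kM.
  have mt : measurable_fun (`[a, b] : set R) (fun r : R => c - s + r).
    by apply: measurable_funD.
  by split; [apply: measurableT_comp kR mt|apply: measurableT_comp kI mt].
have e1 s : cintegral `[a, b] (fun r => u s * k (c - s + r)) =
    u s * cintegral `[a, b] (fun r => k (c - s + r)) by rewrite cintegralZ.
split; first exact: F1.
- by apply: eq_cintegrable F2; [exact: mD|move=> s _; rewrite e1].
- by rewrite F3; apply: eq_cintegral => s _; rewrite e1.
Qed.

End DominatedFubini.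

(** * The reached state and its derivative *)

Section Cutoff.
Context {R : realType}.
Local Notation C := R[i].
Local Notation mu := (@lebesgue_measure R).
Implicit Types (D E : set R) (u : R -> C).

(** Extension by 0. Inputs live on [0, t], but their translates are needed on
    [0, 1]. *)
Definition cutoff D u (s : R) : C := if s \in D then u s else 0.

Lemma Re_cutoff D u : (fun s => complex.Re (cutoff D u s)) = (fun s => complex.Re (u s)) \_ D.
Proof. by apply/funext => s; rewrite /cutoff patchE; case: ifP. Qed.

Lemma Im_cutoff D u : (fun s => complex.Im (cutoff D u s)) = (fun s => complex.Im (u s)) \_ D.
Proof. by apply/funext => s; rewrite /cutoff patchE; case: ifP. Qed.

Lemma cmeas_cutoff D u : measurable D -> cmeas D u -> cmeas setT (cutoff D u).
Proof.
by move=> mD [u1 u2]; split; rewrite ?Re_cutoff ?Im_cutoff;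
  apply/measurable_restrict => //; rewrite setTI.
Qed.

Lemma cmeas_cutoffr D E u : measurable D -> measurable E -> cmeas D u -> cmeas D (cutoff E u).
Proof.
move=> mD mE [u1 u2]; have sub : D `&` E `<=` D by exact: subIsetl.
split; rewrite ?Re_cutoff ?Im_cutoff; apply/measurable_restrict => //.
  exact: measurable_funS mD sub u1.
exact: measurable_funS mD sub u2.
Qed.

Lemma cintegrable_cutoff D u : measurable D -> cintegrable D u -> cintegrable setT (cutoff D u).
Proof.
by move=> mD [u1 u2]; split;
  [have := integrable_patch mD u1; rewrite -Re_cutoff|have := integrable_patch mD u2; rewrite -Im_cutoff].
Qed.

Lemma cintegral_cutoff D E u : cintegral D (cutoff E u) = cintegral (D `&` E) u.
Proof. by rewrite /cintegral Re_cutoff Im_cutoff -!Rintegral_mkcondr. Qed.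

Lemma Lp_cutoff_translate (p c : R) D E u : 1 <= p -> measurable D -> measurable E ->
  Lp p D u -> Lp p E (fun s => cutoff D u (s + c)).
Proof.
move=> p1 mD mE /(LpP _ _ p1)[mu_ ui]; apply/(LpP _ _ p1).
have [m1 m2] := cmeas_cutoff mD mu_.
have mt : measurable_fun E (fun s => s + c).
  by apply: measurable_funTS; exact: measurable_translate.
split; first by split; [apply: measurableT_comp m1 mt|apply: measurableT_comp m2 mt].
have pn0 : p != 0 by rewrite gt_eqF// (lt_le_trans ltr01).
have nE : (fun s => Normc.normc (cutoff D u s) `^ p) = (fun s => Normc.normc (u s) `^ p) \_ D.
  apply/funext => s; rewrite /cutoff patchE; case: ifP => // _.
  by rewrite Normc.normc0 powR0.
have vi := integrable_patch mD ui; rewrite -nE in vi.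
have := integrable_translate c measurableT vi; rewrite preimage_setT.
by apply: integrableS.
Qed.

End Cutoff.

Section ReachedStates.
Context {R : realType} {m : nat}.
Local Notation C := R[i].
Local Notation mu := (@lebesgue_measure R).
Variables (B : 'M[C]_m) (F : R -> 'cV[C]_m) (d : 'cV[C]_m) (lam : C).
Hypothesis Fi : vintegrable `[0, 1] F.
Hypothesis FE : forall rho : R, 0 <= rho ->
  ext B F rho + \sum_(k < Num.truncn rho) iter k (mulmx B) d =
  F 0 + lam *: vintegral `[0, rho] (ext B F).
Local Notation K := (ext B F).
Variables (t : R) (u : R -> C).
Hypothesis t0 : 0 <= t.
Hypothesis ui : cintegrable `[0, t] u.

(** The integral of T (t - r) Q_lam (u(r) d) over [0, t], computed pointwise
    with T (t - r) Q_lam d = K (t - r + .) on [0, 1]. *)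
Definition state (s : R) : 'cV[C]_m := vintegral `[0, t] (fun r => u r *: K (t - r + s)).

(** Inputs enter at 1 in the direction d and travel with unit speed. Those at
    the place s at time t were given at the times t - 1 - k + s, and have been
    multiplied by B k times since. *)
Definition profile (s : R) : 'cV[C]_m :=
  \sum_(k < (Num.truncn t).+1) cutoff `[0, t] u (s + (t - 1 - k%:R)) *: iter k (mulmx B) d.

Let Kp (x : R) : 'cV[C]_m := if x \in `[0, t + 1] then K x else 0.

Let KpE (r s : R) : 0 <= r -> r <= t -> 0 <= s -> s <= 1 -> Kp (t - r + s) = K (t - r + s).
Proof.
move=> r0 rt s0 s1; rewrite /Kp in_itv/= addr_ge0 ?subr_ge0//=.
by have -> : t - r + s <= t + 1 by apply: lerD => //; rewrite gerBl.
Qed.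

Let Kp_bounded : exists2 M : R, 0 <= M & forall x, cvnorm (Kp x) <= M.
Proof.
have [M M0 MP] := kernel_bounded Fi FE (t + 1).
exists M => // x; rewrite /Kp; case: ifPn; last by rewrite cvnorm0.
by rewrite in_itv/= => /andP[x0 x1]; exact: MP.
Qed.

Let Kp_meas j : cmeas setT (fun x => Kp x j 0).
Proof.
have -> : (fun x => Kp x j 0) = cutoff `[0, t + 1] (fun x => K x j 0).
  by apply/funext => x; rewrite /Kp /cutoff mem_setE; case: ifP => // _; rewrite mxE.
apply: cmeas_cutoff => //.
by apply: vintegrable_vmeas; apply: ext_vintegrable.
Qed.

Lemma state_integrable (s : R) : 0 <= s -> s <= 1 ->
  vintegrable `[0, t] (fun r => u r *: K (t - r + s)).
Proof.
move=> s0 s1; have [M M0 MP] := Kp_bounded.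
have mI : measurable (`[0, t]%classic : set R) by exact: measurable_itv.
apply: (@eq_vintegrable _ _ _ (fun r => u r *: Kp (t - r + s))) => //.
  by move=> r; rewrite /= in_itv/= => /andP[r0 rt]; rewrite KpE.
have gi := integrableZlR M mI (cintegrable_normc mI ui).
apply: (vintegrable_le mI _ gi).
  move=> j; have -> : (fun r => (u r *: Kp (t - r + s)) j 0) = (fun r => u r * Kp (t - r + s) j 0).
    by apply/funext => r; rewrite mxE.
  apply: cmeasM; first exact: cintegrable_cmeas.
  have mt : measurable_fun `[0, t] (fun r : R => t - r + s).
    by apply: measurable_funD => //; apply: measurable_funB.
  by have [k1 k2] := Kp_meas j; split; [apply: measurableT_comp k1 mt|apply: measurableT_comp k2 mt].
by move=> r _; rewrite cvnormZ mulrC ler_wpM2r// normc_ge0.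
Qed.

Lemma state_fubini (a b : R) : 0 <= a -> a <= b -> b <= 1 ->
  [/\ vintegrable `[a, b] state,
      vintegrable `[0, t] (fun r => u r *: vintegral `[a + (t - r), b + (t - r)] K) &
      vintegral `[a, b] state =
      vintegral `[0, t] (fun r => u r *: vintegral `[a + (t - r), b + (t - r)] K)].
Proof.
move=> a0 ab b1; have [M M0 MP] := Kp_bounded.
have mI : measurable (`[0, t]%classic : set R) by exact: measurable_itv.
have mJ : measurable (`[a, b]%classic : set R) by exact: measurable_itv.
have kM j s : Normc.normc (Kp s j 0) <= M by exact: le_trans (normc_le_cvnorm _ _) (MP s).
have cf j := @convolution_fubini R _ a b t M u _ ab mI ui (Kp_meas j) (kM j).
have sE j r : `[a, b]%classic r -> cintegral `[0, t] (fun s => u s * Kp (t - s + r) j 0) = state r j 0.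
  rewrite /= in_itv/= => /andP[ar rb]; rewrite mxE; apply: eq_cintegral => s.
  rewrite /= in_itv/= => /andP[s0 st]; rewrite mxE KpE//; first exact: le_trans ar.
  exact: le_trans b1.
have wE j s : `[0, t]%classic s -> u s * cintegral `[a, b] (fun r => Kp (t - s + r) j 0) =
    (u s *: vintegral `[a + (t - s), b + (t - s)] K) j 0.
  rewrite /= in_itv/= => /andP[s0 st]; rewrite !mxE; congr (_ * _).
  have ts0 : 0 <= a + (t - s) by rewrite addr_ge0// subr_ge0.
  rewrite -(cintegral_itv_translate (f := fun x => K x j 0)); last first.
    by apply: vintegrable_vmeas; exact: ext_vintegrable.
  apply: eq_cintegral => r; rewrite /= in_itv/= => /andP[ar rb].
  by rewrite KpE ?[r + _]addrC//; [exact: le_trans ar|exact: le_trans b1].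
split.
- by move=> j; have [H _ _] := cf j; exact: eq_cintegrable (sE j) H.
- by move=> j; have [_ H _] := cf j; exact: eq_cintegrable (wE j) H.
- apply/matrixP => j k; rewrite ord1 !mxE; have [_ _ H] := cf j.
  by rewrite -(eq_cintegral (sE j)) H (eq_cintegral (wE j)).
Qed.

(** The input collected by the jumps of the kernel between two places a and b
    is a window of a translate of the input. *)
Lemma jump_integral (a b y : R) : a <= b ->
  cintegral `[0, t] (cutoff `]y + a, y + b] u) = cintegral `[a, b] (fun s => cutoff `[0, t] u (s + y)).
Proof.
move=> ab; rewrite cintegral_cutoff setIC -cintegral_cutoff.
have ci := cintegrable_cutoff (measurable_itv _) ui.
have [c1 c2] := cintegrable_cmeas ci.
rewrite cintegral_itv_translate; last by split; exact: measurable_funTS.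
rewrite ![_ + y]addrC; apply: complex_eq; rewrite /cintegral /=;
  by rewrite Rintegral_itv_obnd_cbnd//; case: ci => i1 i2; apply: integrableS i1 || apply: integrableS i2.
Qed.

Lemma kernel_jumps (rho : R) : 0 <= rho -> rho <= t + 1 ->
  K rho = F 0 + lam *: vintegral `[0, rho] K -
    \sum_(k < (Num.truncn t).+1) (k.+1%:R <= rho)%R%:R *: iter k (mulmx B) d.
Proof.
move=> r0 rt; rewrite -FE//.
have tt : (Num.truncn rho <= (Num.truncn t).+1)%N.
  rewrite truncn_le_nat (le_lt_trans rt)// -natr1 ltrD2r.
  by have /andP[] := truncn_itv t0.
rewrite (big_ord_widen _ (fun k => iter k (mulmx B) d) tt) big_mkcond/=.
rewrite -[LHS]addr0 -addrA; congr (_ + _); apply/esym/eqP; rewrite subr_eq0; apply/eqP.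
apply: eq_bigr => k _; rewrite truncn_gt_nat.
by case: (_ <= _); rewrite ?scale1r ?scale0r.
Qed.

(** The jump of K at k + 1 lies between t - r + a and t - r + b if and only if
    t - 1 - k + a < r <= t - 1 - k + b. *)
Lemma kernel_increment (a b r : R) : 0 <= a -> a <= b -> b <= 1 -> 0 <= r -> r <= t ->
  u r *: K (t - r + b) - u r *: K (t - r + a) =
  lam *: (u r *: vintegral `[a + (t - r), b + (t - r)] K) -
  \sum_(k < (Num.truncn t).+1)
    cutoff `]t - 1 - k%:R + a, t - 1 - k%:R + b] u r *: iter k (mulmx B) d.
Proof.
move=> a0 ab b1 r0 rt; have tr0 : 0 <= t - r by rewrite subr_ge0.
have at0 : 0 <= t - r + a by rewrite addr_ge0.
have abt : t - r + a <= t - r + b by rewrite lerD2l.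
have bt0 : 0 <= t - r + b := le_trans at0 abt.
have bt : t - r + b <= t + 1 by apply: lerD => //; rewrite gerBl.
rewrite !(addrC _ (t - r)) (kernel_jumps at0 (le_trans abt bt)) (kernel_jumps bt0 bt).
rewrite (vintegral_itv_cat at0 abt); last by apply: ext_vintegrable.
set S1 := \sum_(k < _) _; set S2 := \sum_(k < _) _; set S3 := \sum_(k < _) _.
have -> : S3 = u r *: (S1 - S2).
  rewrite /S1 /S2 -sumrB scaler_sumr; apply: eq_bigr => k _.
  rewrite -scalerBl scalerA; congr (_ *: _); rewrite /cutoff mem_setE in_itv/=.
  have -> : (k.+1%:R <= t - r + b) = (r <= t - 1 - k%:R + b).
    by rewrite -natr1; apply/idP/idP; lra.
  have -> : (k.+1%:R <= t - r + a) = ~~ (t - 1 - k%:R + a < r).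
    by rewrite -leNgt -natr1; apply/idP/idP; lra.
  case: ltP => /= H1; case: leP => H2; rewrite ?subr0 ?mulr1 ?subrr ?mulr0//.
  by exfalso; move: H1 H2 ab; lra.
by apply/matrixP => j k; rewrite !mxE; ring.
Qed.

Lemma profile_vintegrable (a b : R) : a <= b -> vintegrable `[a, b] profile.
Proof.
move=> ab; apply: vintegrable_sum => // k; apply: vintegrableZl => //.
apply: cintegrable_itv_translate.
have ci := cintegrable_cutoff (measurable_itv _) ui.
by apply: cintegrableS ci.
Qed.

(** The integrated form of z' = lam z - f: between its jumps K contributes lam
    K, and the jumps contribute f. *)
Lemma state_derivative (a b : R) : 0 <= a -> a <= b -> b <= 1 ->
  state b - state a = vintegral `[a, b] (lam *: state - profile).
Proof.
move=> a0 ab b1; have [si wi sE] := state_fubini a0 ab b1.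
have mI : measurable (`[0, t]%classic : set R) by exact: measurable_itv.
have mJ : measurable (`[a, b]%classic : set R) by exact: measurable_itv.
have b0 := le_trans a0 ab; have a1 := le_trans ab b1.
have pi k : cintegrable `[a, b] (fun s => cutoff `[0, t] u (s + (t - 1 - k%:R))).
  apply: cintegrable_itv_translate; have ci := cintegrable_cutoff mI ui.
  by apply: cintegrableS ci.
have ci k : cintegrable `[0, t] (cutoff `]t - 1 - k%:R + a, t - 1 - k%:R + b] u).
  apply: (cintegrable_le mI _ (cintegrable_normc mI ui)).
    by apply: cmeas_cutoffr => //; exact: cintegrable_cmeas.
  by move=> s _; rewrite /cutoff; case: ifP => // _; rewrite Normc.normc0 normc_ge0.
rewrite /state -vintegralB; [|exact: mI|exact: state_integrable|exact: state_integrable].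
have -> : vintegral `[a, b] (lam *: state - profile) =
    lam *: vintegral `[a, b] state - vintegral `[a, b] profile.
  rewrite -(vintegralZ lam mJ si) -vintegralB//; first exact: vintegrableZ.
  exact: profile_vintegrable.
rewrite sE /profile vintegral_sum//; last first.
  by move=> k; exact: vintegrableZl.
under [X in _ = _ - X]eq_bigr => k _ do
  rewrite vintegralZl// -(jump_integral _ ab) -vintegralZl//.
rewrite -vintegral_sum//; last by move=> k; exact: vintegrableZl.
rewrite -(vintegralZ lam mI wi) -vintegralB//.
- apply: eq_vintegral => r; rewrite /= in_itv/= => /andP[r0 rt].
  exact: kernel_increment.
- exact: vintegrableZ.
- by apply: vintegrable_sum => // k; exact: vintegrableZl.
Qed.

Lemma state_boundary : state 1 = B *m state 0.
Proof.
have mI : measurable (`[0, t]%classic : set R) by exact: measurable_itv.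
rewrite -vintegral_mulmx//; last exact: state_integrable.
apply: eq_vintegral => r; rewrite /= in_itv/= => /andP[r0 rt].
by rewrite -scalemxAr -ext_succ ?addr0// subr_ge0.
Qed.

End ReachedStates.

(** * Windows of Bochner integrals *)

Section LowerIntegral.
Context {R : realType}.
Local Notation C := R[i].
Local Notation mu := (@lebesgue_measure R).

(** The integral of a nonnegative function is a supremum over the simple
    functions below it, so it is monotone for arbitrary functions. It is
    applied to s |-> N (G s - h k s), where G is an arbitrary integrand. *)
Lemma lower_integral_le (D : set R) (f g : R -> R) : (forall s, D s -> 0 <= f s) ->
  (forall s, D s -> f s <= g s) ->
  (\int[mu]_(s in D) (f s)%:E <= \int[mu]_(s in D) (g s)%:E)%E.
Proof.
move=> f0 fg; rewrite !ge0_integralE; last first.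
- by move=> s Ds; rewrite lee_fin f0.
- by move=> s Ds; rewrite lee_fin (le_trans (f0 s Ds))// fg.
apply: ereal_sup_le => _ [h /= hf <-]; exists h => //= s.
rewrite (le_trans (hf s))// !patchE; case: ifPn => // /set_mem Ds.
by rewrite lee_fin fg.
Qed.

Lemma cintegrable_indic (a b : R) (E : set R) : measurable E ->
  cintegrable `[a, b] (fun s => (\1_E s)%:C : C).
Proof.
move=> mE; apply: (cintegrable_le (measurable_itv _) _ (integrable_itv_cst a b 1)).
  split => /=; last exact: measurable_cst.
  by apply: measurable_funTS; exact: measurable_indic.
by move=> s _; rewrite normc_real indicE; case: (_ \in _) => /=; rewrite ?normr1 ?normr0.
Qed.

Lemma cintegral_indic (D E : set R) : measurable D -> measurable E -> E `<=` D ->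
  cintegral D (fun s => (\1_E s)%:C : C) = (fine (mu E))%:C.
Proof.
move=> mD mE ED; apply: complex_eq => /=.
  by rewrite /Rintegral integral_indic// setIidl.
by rewrite /Rintegral integral0.
Qed.

End LowerIntegral.

Section Pairing.
Context {R : realType} {m : nat}.
Local Notation C := R[i].
Local Notation mu := (@lebesgue_measure R).
Variable p : R.
Hypothesis p1 : 1 <= p.
Local Notation X := (@Lpv R p m).
Local Notation N := (@Lpv_norm R p m).
Local Notation L a b x := (vintegral `[a, b] x).

Lemma vintegrable_sub (x : R -> 'cV[C]_m) (a b : R) : X x -> 0 <= a -> b <= 1 ->
  vintegrable `[a, b] x.
Proof.
move=> Xx a0 b1; apply: vintegrableS (Lpv_vintegrable p1 Xx) => //.
by apply: subset_itv; rewrite bnd_simp.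
Qed.

Lemma cvnorm_window (x : R -> 'cV[C]_m) (a b : R) : X x -> 0 <= a -> a <= b -> b <= 1 ->
  cvnorm (L a b x) <= 4 * N x.
Proof.
move=> Xx a0 ab b1; have b0 := le_trans a0 ab.
have xi := vintegrable_sub Xx a0 b1.
have ni := vintegrable_cvnorm (measurable_itv _) (Lpv_vintegrable p1 Xx).
have ni2 := vintegrable_cvnorm (measurable_itv _) (vintegrable_sub Xx (lexx 0) b1).
have e4 : 4 * N x = 2 * (2 * N x) by rewrite mulrA; congr (_ * _); ring.
have pos u v : 0 <= \int[mu]_(s in `[u, v]) cvnorm (x s).
  by apply: Rintegral_ge0 => s _; exact: cvnorm_ge0.
rewrite e4 (le_trans (cvnorm_vintegral_le _ xi))// ler_wpM2l//.
rewrite (le_trans _ (Lpv_norm_L1 p1 Xx))//.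
rewrite (Rintegral_itv_cat b0 b1 ni) (Rintegral_itv_cat a0 ab ni2).
by rewrite -addrA addrCA lerDl addr_ge0.
Qed.

Lemma window_simple (a b : R) (k : nat) (c : 'I_k -> C) (x : 'I_k -> (R -> 'cV[C]_m)) :
  0 <= a -> b <= 1 -> (forall j, X (x j)) ->
  L a b (\sum_j c j *: x j) = \sum_j c j *: L a b (x j).
Proof.
move=> a0 b1 Xx.
have xi j : vintegrable `[a, b] (fun s => c j *: x j s).
  by apply: vintegrableZ => //; exact: vintegrable_sub.
rewrite (@eq_vintegral _ _ _ _ (fun s => \sum_j c j *: x j s)); last first.
  by move=> s _; rewrite fct_sumE.
rewrite vintegral_sum//; apply: eq_bigr => j _.
by rewrite vintegralZ//; exact: vintegrable_sub.
Qed.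

Lemma Lpv_sumZ (k : nat) (c : 'I_k -> C) (x : 'I_k -> (R -> 'cV[C]_m)) :
  (forall j, X (x j)) -> X (\sum_j c j *: x j).
Proof.
move=> Xx; have : forall j, X (c j *: x j) by move=> j; exact: (LpvZ p1).
by move=> Xc; apply: big_rec => [|j y _ Xy]; [exact: (Lpv0 p1)|exact: (LpvD p1)].
Qed.

(** Windows are bounded linear functionals, so this passes from simple
    functions to their limit: the errors are at most multiples of N (I k - z)
    and of the lower integral of N (G s - h k s). *)
Lemma bochner_window (t a b : R) (G : R -> R -> 'cV[C]_m) (z : R -> 'cV[C]_m)
    (gam : R -> 'cV[C]_m) : 0 <= a -> a <= b -> b <= 1 ->
  bochner_integral X N `[0, t] G z -> vintegrable `[0, t] gam ->
  (forall s, `[0, t]%classic s -> L a b (G s) = gam s) ->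
  L a b z = vintegral `[0, t] gam.
Proof.
move=> a0 ab b1 [Xz XG [h [I [hs _ hN IN]]]] gi gE.
have mD : measurable (`[0, t]%classic : set R) by exact: measurable_itv.
apply/eqP; rewrite -subr_eq0; apply/eqP; apply: cvnorm_eq0.
apply/ler_addgt0Pr => e e0; rewrite add0r.
have e16 : 0 < e / 16 by rewrite divr_gt0.
have [n1 n1P] := cvg_seq0P (fun k => Lpv_norm_ge0 p _) IN e16.
have : \forall k \near \oo, (\int[mu]_(s in `[0%R, t]) (N (G s - h k s))%:E < (e / 16)%:E)%E.
  have op : nbhs (0%E : \bar R) [set y | (y < (e / 16)%:E)%E].
    by apply: (open_nbhs_nbhs (A := [set y | (y < (e / 16)%:E)%E])); split;
      [exact: open_ereal_lt_ereal|rewrite /= lte_fin].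
  exact: hN op.
move=> [n2 _ n2P].
pose k := maxn n1 n2.
have {n1P} k1 := n1P k (leq_maxl _ _).
have {n2P} /= k2 := n2P k (leq_maxr _ _).
have [q [E [x [Ex hE IE]]]] := hs k.
have Xx j : X (x j) by have [] := Ex j.
have mE j : measurable (E j) by have [] := Ex j.
have ED j : E j `<=` `[0, t] by have [] := Ex j.
have XI : X (I k) by rewrite IE; exact: Lpv_sumZ.
have Xh s : X (h k s) by rewrite hE; exact: Lpv_sumZ.
have LhE s : L a b (h k s) = \sum_j (\1_(E j) s)%:C *: L a b (x j).
  by rewrite hE window_simple.
have ii j : vintegrable `[0, t] (fun s => (\1_(E j) s)%:C *: L a b (x j)).
  by apply: vintegrableZl => //; exact: cintegrable_indic.
have Lhi : vintegrable `[0, t] (fun s => L a b (h k s)).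
  have H : vintegrable `[0, t] (fun s => \sum_j (\1_(E j) s)%:C *: L a b (x j)).
    exact: vintegrable_sum.
  by apply: eq_vintegrable H => // s _; rewrite LhE.
have LI : L a b (I k) = vintegral `[0, t] (fun s => L a b (h k s)).
  rewrite IE window_simple// (eq_vintegral (fun s _ => LhE s)) vintegral_sum//.
  by apply: eq_bigr => j _; rewrite vintegralZl ?cintegral_indic//; exact: cintegrable_indic.
have D1 : cvnorm (L a b z - L a b (I k)) <= e / 4.
  rewrite -vintegralB; [|exact: measurable_itv|exact: vintegrable_sub|exact: vintegrable_sub].
  rewrite -cvnormN -vintegralN; [|exact: measurable_itv|]; last first.
    by apply: vintegrableB => //; exact: vintegrable_sub.
  have -> : L a b (fun s => - (z s - I k s)) = L a b (I k - z).
    by apply: eq_vintegral => s _; rewrite opprB.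
  apply: (le_trans (cvnorm_window (LpvB p1 XI Xz) a0 ab b1)).
  by have := ltW k1; lra.
have di : vintegrable `[0, t] (fun s => L a b (h k s) - gam s) by exact: vintegrableB.
have ni := vintegrable_cvnorm mD di.
have D2 : cvnorm (L a b (I k) - vintegral `[0, t] gam) <= e / 2.
  rewrite LI -vintegralB//; apply: (le_trans (cvnorm_vintegral_le mD di)).
  have n4 := integrableZlR (4^-1) mD ni.
  have H : (\int[mu]_(s in `[0%R, t]) (4^-1 * cvnorm (L a b (h k s) - gam s))%:E < (e / 16)%:E)%E.
    apply: le_lt_trans k2; apply: lower_integral_le.
      by move=> s _; rewrite mulr_ge0 ?cvnorm_ge0.
    move=> s sD; rewrite -gE//.
    have XGs := XG s sD.
    rewrite -vintegralB; [|exact: measurable_itv|exact: vintegrable_sub|exact: vintegrable_sub].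
    have -> : L a b (fun s0 => h k s s0 - G s s0) = - L a b (G s - h k s).
      rewrite -vintegralN; [|exact: measurable_itv|exact: vintegrable_sub (LpvB p1 XGs (Xh s)) a0 b1].
      by apply: eq_vintegral => s0 _; rewrite opprB.
    rewrite cvnormN mulrC ler_pdivrMr// mulrC.
    exact: cvnorm_window (LpvB p1 XGs (Xh s)) a0 ab b1.
  rewrite (EFin_Rintegral mD n4) lte_fin RintegralZl// in H.
  by move: H; rewrite mulrC ltr_pdivrMr// => H; have := ltW H; lra.
have -> : L a b z - vintegral `[0, t] gam =
    (L a b z - L a b (I k)) + (L a b (I k) - vintegral `[0, t] gam) by rewrite addrA subrK.
apply: (le_trans (cvnormD _ _)); move: D1 D2; lra.
Qed.

End Pairing.

Section StateInDomain.
Context {R : realType} {n m : nat}.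
Local Notation C := R[i].
Local Notation mu := (@lebesgue_measure R).
Variable p : R.
Hypothesis p1 : 1 <= p.
Variable Net : network R n m.
Local Notation B := (adjB Net).
Local Notation X := (@Lpv R p m).
Local Notation N := (@Lpv_norm R p m).
Local Notation "x ~~ y" := (same N x y) (at level 70).

(** What arrives at a vertex is distributed to the outgoing edges by Psi. So B
    maps into the boundary space. *)
Lemma adjB_factor : exists M : 'M[C]_(n, m), B = Psi Net *m M.
Proof.
exists (\matrix_(j, e) (tgt Net e == j)%:R); apply/matrixP => e e'; rewrite !mxE.
rewrite (bigD1 (src Net e))//= !mxE eqxx big1 ?addr0.
  by case: eqP => _; rewrite ?mulr1 ?mulr0.
by move=> j /negbTE nj; rewrite !mxE eq_sym nj mul0r.
Qed.

Variables (F : R -> 'cV[C]_m) (d : 'cV[C]_m) (lam : C).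
Hypothesis XF : X F.
Hypothesis FE : forall rho : R, 0 <= rho ->
  ext B F rho + \sum_(k < Num.truncn rho) iter k (mulmx B) d =
  F 0 + lam *: vintegral `[0, rho] (ext B F).
Variables (t : R) (u : R -> C).
Hypothesis t0 : 0 <= t.
Hypothesis Lu : Lp p `[0, t] u.
Local Notation z := (state B F t u).
Local Notation f := (profile B d t u).
Let Fi : vintegrable `[0, 1] F := Lpv_vintegrable p1 XF.
Let ui : cintegrable `[0, t] u := Lp_cintegrable p1 t0 Lu.

Lemma profile_Lpv : X f.
Proof.
apply: (Lpv_sum p1) => k; apply: (LpvZl p1).
by apply: Lp_cutoff_translate.
Qed.

Let gi : vintegrable `[0, 1] (lam *: z - f).
Proof.
have [si _ _] := state_fubini Fi FE ui (lexx 0) ler01 (lexx 1).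
apply: vintegrableB => //; first exact: vintegrableZ.
exact: profile_vintegrable.
Qed.

Lemma state_Lpv : X z.
Proof. exact: AC_Lpv gi (state_derivative Fi FE t0 ui). Qed.

(** The condition z 1 = B z 0 says both that z 1 is in the boundary space and
    that Q z = 0. *)
Lemma state_op_A : op_A p Net z (lam *: z - f).
Proof.
have FTC := state_derivative Fi FE t0 ui.
have Xg : X (lam *: z - f).
  by apply: (LpvB p1); [apply: (LpvZ p1); exact: state_Lpv|exact: profile_Lpv].
have [wF cF] := vFTC_weak_derivative gi FTC.
have sb := state_boundary Fi FE ui.
have Am : op_Am p Net z (lam *: z - f).
  split=> //; first exact: state_Lpv.
  exists z => //; have [M BE] := adjB_factor.
  by exists (M *m z 0) => //; rewrite sb mulmxA -BE.
split=> //; split; first by exists (lam *: z - f).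
by exists z => //; rewrite sb subrr.
Qed.

Variable T : R -> (R -> 'cV[C]_m) -> (R -> 'cV[C]_m).
Hypothesis HT : strongly_continuous_semigroup X N T.
Hypothesis HG : generates X N (op_A p Net) T.
Hypothesis HR : resolvent_set X N (op_A p Net) lam.
Variable Q : C -> R -> 'cV[C]_m.
Hypothesis XQ : forall c, X (Q c).
Hypothesis QF : forall c, Q c ~~ (c *: F).

Lemma orbit_same (c : C) (r : R) : 0 <= r -> T r (Q c) ~~ (c *: T r F).
Proof.
move=> r0; have XcF : X (c *: F) by exact: (LpvZ p1).
apply: (same_trans p1 (g := T r (c *: F))); [exact: (semigroup_Lpv HT)|exact: (semigroup_Lpv HT)| | |].
- by apply: (LpvZ p1); exact: (semigroup_Lpv HT).
- exact: (semigroup_same p1 HT).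
- exact: (semigroup_scale p1 HT).
Qed.

(** A class is determined by its windows, and [bochner_window] computes those
    of a Bochner integral. *)
Lemma controlled_state_unique w :
  bochner_integral X N `[0, t] (fun s => T (t - s) (Q (u s))) w -> w ~~ z.
Proof.
move=> bw; have [Xw _ _] := bw; apply: (vintegral_same p1 Xw state_Lpv) => b b0 b1.
have [_ wi ->] := state_fubini Fi FE ui (lexx 0) b0 b1.
apply: (bochner_window p1 (lexx 0) b0 b1 bw wi) => s; rewrite /= in_itv/= => /andP[s0 st].
have ts : 0 <= t - s by rewrite subr_ge0.
have XTF : X (T (t - s) F) by exact: (semigroup_Lpv HT).
have XTQ : X (T (t - s) (Q (u s))) by exact: (semigroup_Lpv HT).
have XcT : X (u s *: T (t - s) F) by exact: (LpvZ p1).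
rewrite (same_vintegral p1 XTQ XcT (orbit_same _ ts) (lexx 0) b1).
rewrite vintegralZ; [|exact: measurable_itv|exact: (vintegrable_sub p1 XTF)].
congr (_ *: _); rewrite -(window_transport p1 HT HG HR XF ts (lexx 0) b0).
apply: eq_co_vintegral => //; last exact: (vintegrable_sub p1 XTF).
by move=> r r0 rb; rewrite ext_small//; exact: lt_le_trans b1.
Qed.

End StateInDomain.

(** * Simple inputs and short time steps *)

Section SimpleApproximation.
Context {R : realType}.
Local Notation C := R[i].
Local Notation mu := (@lebesgue_measure R).
Implicit Types (D : set R).
Import HBNNSimple.

Lemma ereal_cvg0 (x : nat -> \bar R) : (forall k, (0 <= x k)%E) ->
  (forall e : R, 0 < e -> exists n0, forall k, (n0 <= k)%N -> (x k < e%:E)%E) ->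
  x k @[k --> \oo] --> 0%E.
Proof.
move=> x0 xe; apply/fine_cvgP; have [n1 n1P] := xe 1 ltr01.
have fin k e : (x k < e%:E)%E -> x k \is a fin_num.
  by move=> xke; rewrite ge0_fin_numE ?(lt_trans xke) ?ltry.
split; first by exists n1 => // k /= kn; exact: fin (n1P k kn).
apply: seq0P_cvg => [k|e e0]; first by rewrite /= fine_ge0.
have [n0 n0P] := xe e e0; exists n0 => k kn /=.
by have H := n0P k kn; rewrite -lte_fin fineK// (fin _ _ H).
Qed.

Lemma dominated_to0 D (q : nat -> R -> R) (g : R -> R) : measurable D ->
  (forall k, measurable_fun D (q k)) -> mu.-integrable D (EFin \o g) ->
  (forall k s, D s -> 0 <= q k s) -> (forall k s, D s -> q k s <= g s) ->
  (forall s, D s -> forall e : R, 0 < e -> exists n0, forall k, (n0 <= k)%N -> q k s < e) ->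
  forall e : R, 0 < e -> exists n0, forall k, (n0 <= k)%N -> \int[mu]_(s in D) q k s < e.
Proof.
move=> mD mq gi q0 qg qc e e0.
have mqE k : measurable_fun D (fun s => (q k s)%:E) by exact/measurable_EFinP.
have m0 : measurable_fun D (cst (0 : \bar R)) by [].
have cv : {ae mu, forall s, D s -> (q k s)%:E @[k --> \oo] --> cst 0%E s}.
  apply: aeW => s Ds; apply: ereal_cvg0 => [k|d d0]; first by rewrite lee_fin q0.
  by have [n0 n0P] := qc s Ds d d0; exists n0 => k kn; rewrite lte_fin n0P.
have dom : {ae mu, forall s k, D s -> (`|(q k s)%:E| <= (EFin \o g) s)%E}.
  by apply: aeW => s k Ds /=; rewrite lee_fin ger0_norm ?q0// qg.
have [_ _] := @dominated_convergence _ _ R mu D mD (fun k s => (q k s)%:E) (cst 0%E) (EFin \o g) mqE m0 cv gi dom.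
rewrite integral0 => H.
have : \forall k \near \oo, (\int[mu]_(s in D) (q k s)%:E < e%:E)%E.
  have op : nbhs (0%E : \bar R) [set y | (y < e%:E)%E].
    by apply: (open_nbhs_nbhs (A := [set y | (y < e%:E)%E])); split;
      [exact: open_ereal_lt_ereal|rewrite /= lte_fin].
  exact: H op.
move=> [n0 _ n0P]; exists n0 => k kn; have := n0P k kn; rewrite /=.
rewrite (EFin_Rintegral mD) ?lte_fin//.
apply: (@le_integrable _ _ _ mu D mD (EFin \o q k) (EFin \o g) (mqE k) _ gi).
by move=> s Ds /=; rewrite lee_fin ger0_norm ?q0// (le_trans (qg k s Ds))// ler_norm.
Qed.

Lemma inv_nat_small (e : R) : 0 < e -> exists n0 : nat, forall k, (n0 <= k)%N -> k.+1%:R^-1 < e.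
Proof.
move=> e0; have [n0] := ltr_add_invr e0; rewrite add0r => H; exists n0 => k kn.
by rewrite (le_lt_trans _ H)// lef_pV2 ?posrE ?ltr0n// ler_nat.
Qed.

(** Equality with the sum is only required on D, and the sets may overlap, so
    that sums of step functions are immediate. *)
Definition step D (v : R -> C) : Prop := exists (I : finType) (E : I -> set R) (c : I -> C),
  (forall i, measurable (E i) /\ E i `<=` D) /\
  forall s, D s -> v s = \sum_i (\1_(E i) s)%:C * c i.

Lemma stepZ D (a : C) v : step D v -> step D (fun s => a * v s).
Proof.
move=> [I [E [c [Em vE]]]]; exists I, E, (fun i => a * c i); split=> // s Ds.
by rewrite vE// mulr_sumr; apply: eq_bigr => i _; rewrite mulrCA.
Qed.

Lemma stepD D v w : step D v -> step D w -> step D (fun s => v s + w s).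
Proof.
move=> [I [E [c [Em vE]]]] [J [E' [c' [E'm wE]]]].
exists (I + J)%type, (fun x => match x with inl i => E i | inr j => E' j end),
  (fun x => match x with inl i => c i | inr j => c' j end); split; first by case.
by move=> s Ds; rewrite big_sumType/= vE// wE.
Qed.

Lemma step_nnsfun D (g : {nnsfun R >-> R}) : measurable D -> step D (fun s => (g s)%:C).
Proof.
move=> mD; pose r : seq R := finmap.enum_fset (fset_set (range g)).
exists 'I_(size r), (fun i : 'I_(size r) => (g @^-1` [set nth 0 r i]) `&` D), (fun i : 'I_(size r) => (nth 0 r i)%:C).
split; first by move=> i; split; [apply: measurableI|exact: subIsetr].
move=> s Ds; rewrite fimfunE fsbig_finite/=; last exact: fimfunP.
rewrite -/r (big_nth 0) big_mkord rmorph_sum; apply: eq_bigr => i _.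
rewrite -rmorphM mulrC; congr ((_ * _)%:C); rewrite !indicE.
by rewrite in_setI (mem_set Ds) andbT.
Qed.

Lemma step_nonneg D (f : R -> R) : measurable D -> measurable_fun D f ->
  (forall s, D s -> 0 <= f s) ->
  exists g : nat -> R -> R, [/\ forall k, step D (fun s => (g k s)%:C),
    forall k s, D s -> 0 <= g k s <= f s &
    forall s, D s -> forall e : R, 0 < e -> exists n0, forall k, (n0 <= k)%N -> f s - g k s < e].
Proof.
move=> mD mf f0; have mfE : measurable_fun D (EFin \o f) by exact/measurable_EFinP.
have f0E s : D s -> (0 <= (EFin \o f) s)%E by move=> Ds; rewrite lee_fin f0.
pose g := nnsfun_approx mD mfE.
have gc s (Ds : D s) : g k s @[k --> \oo] --> f s.
  by have := cvg_nnsfun_approx mD mfE f0E Ds; move/fine_cvgP => [_]; apply.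
have gle k s : D s -> g k s <= f s.
  move=> Ds; have nd : {homo (fun k => g k s) : a b / (a <= b)%N >-> a <= b}.
    by move=> a b ab; have /lefP := nd_nnsfun_approx mD mfE ab; apply.
  rewrite -(cvg_lim (@Rhausdorff R) (gc s Ds)).
  by apply: nondecreasing_cvgn_le => //; apply/cvg_ex; exists (f s); exact: gc.
exists (fun k s => g k s); split.
- by move=> k; exact: step_nnsfun.
- by move=> k s Ds; rewrite fun_ge0 gle.
- move=> s Ds e e0; have /cvgrPdist_lt/(_ e e0)[n0 _ n0P] := gc s Ds.
  exists n0 => k kn; have := n0P k kn; rewrite /= ger0_norm// subr_ge0; exact: gle.
Qed.

(** The positive and negative parts of the real and imaginary parts of u are
    approximated by simple functions from below, so that the approximations
    are dominated by u. *)
Lemma step_approx D (u : R -> C) : measurable D -> cmeas D u ->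
  exists v : nat -> R -> C, [/\ forall k, step D (v k),
    forall k s, D s -> Normc.normc (v k s) <= 4 * Normc.normc (u s) &
    forall s, D s -> forall e : R, 0 < e -> exists n0, forall k, (n0 <= k)%N ->
      Normc.normc (u s - v k s) < e].
Proof.
move=> mD [mR mI].
have m0 : measurable_fun D (cst 0 : R -> R) by [].
have parts (f : R -> R) : measurable_fun D f ->
    exists g h : nat -> R -> R, [/\ forall k, step D (fun s => (g k s)%:C),
      forall k, step D (fun s => (h k s)%:C),
      forall k s, D s -> `|g k s - h k s| <= `|f s| &
      forall s, D s -> forall e : R, 0 < e -> exists n0, forall k, (n0 <= k)%N ->
        `|f s - (g k s - h k s)| < e].
  move=> mf; have mN : measurable_fun D (fun s => - f s) by exact: measurableT_comp.
  have p1 := measurable_maxr mf m0; have p2 := measurable_maxr mN m0.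
  have q1 s : D s -> 0 <= Num.max (f s) 0 by rewrite le_max lexx orbT.
  have q2 s : D s -> 0 <= Num.max (- f s) 0 by rewrite le_max lexx orbT.
  have [g [gs g0 gc]] := step_nonneg mD p1 q1.
  have [h [hs h0 hc]] := step_nonneg mD p2 q2.
  have fE s : f s = Num.max (f s) 0 - Num.max (- f s) 0.
    by case: (leP (f s) 0) => H; case: (leP (- f s) 0) => H'; lra.
  exists g, h; split => //.
    move=> k s Ds; have /andP[g1 g2] := g0 k s Ds; have /andP[h1 h2] := h0 k s Ds.
    move: g2 h2; rewrite /=; case: (leP (f s) 0) => H; case: (leP (- f s) 0) => H' g2 h2;
      by rewrite ler_norml; apply/andP; split; case: (ger0P (f s)) => H''; lra.
  move=> s Ds e e0; have e2 : 0 < e / 2 by rewrite divr_gt0.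
  have [a aP] := gc s Ds _ e2; have [b bP] := hc s Ds _ e2; exists (maxn a b) => k.
  rewrite geq_max => /andP[ka kb]; have A := aP k ka; have H := bP k kb.
  have /andP[_ g2] := g0 k s Ds; have /andP[_ h2] := h0 k s Ds.
  rewrite {1}fE ltr_norml; move: A H g2 h2; rewrite /= => A H g2 h2.
  by apply/andP; split; lra.
have [a [b [sa sb abN abc]]] := parts _ mR.
have [c [d [sc sd cdN cdc]]] := parts _ mI.
pose v k s : C := (a k s - b k s) +i* (c k s - d k s).
have vE k : v k = fun s => ((a k s)%:C + (-1) * (b k s)%:C) +
    ('i * (c k s)%:C + (- 'i) * (d k s)%:C).
  apply/funext => s; rewrite /v; apply: complex_eq;
    by rewrite ?ReD ?ImD !(Re_mulc, Im_mulc, ReD, ImD) /= ?ReN ?ImN /=; ring.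
exists v; split.
- by move=> k; rewrite vE; apply: stepD; apply: stepD => //; exact: stepZ.
- move=> k s Ds; rewrite (le_trans (normc_le _))//=.
  have := abN k s Ds; have := cdN k s Ds; have := normRe_le (u s); have := normIm_le (u s).
  by have := normc_ge0 (u s); lra.
- move=> s Ds e e0; have e2 : 0 < e / 2 by rewrite divr_gt0.
  have [n1 n1P] := abc s Ds _ e2; have [n2 n2P] := cdc s Ds _ e2; exists (maxn n1 n2) => k.
  rewrite geq_max => /andP[k1 k2]; rewrite (le_lt_trans (normc_le _))//.
  rewrite ReD ImD ReN ImN /= [e]splitr; apply: ltrD; [exact: n1P|exact: n2P].
Qed.

(** The least multiple of 1 / (k + 1) that is greater than t - s. The kernel
    is right continuous only, so t - s has to be approached from above. *)
Definition time_step (t : R) (k : nat) (s : R) : R :=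
  (Num.truncn ((t - s) * k.+1%:R)).+1%:R / k.+1%:R.

Lemma time_step_itv t k s : s <= t ->
  t - s <= time_step t k s /\ time_step t k s - (t - s) <= k.+1%:R^-1.
Proof.
move=> st; have k0 : 0 < k.+1%:R :> R by rewrite ltr0n.
have x0 : 0 <= (t - s) * k.+1%:R by rewrite mulr_ge0// subr_ge0.
have /andP[h1 h2] := truncn_itv x0.
split; first by rewrite /time_step ler_pdivlMr// ltW.
rewrite /time_step -natr1 mulrDl mul1r lerBlDr [X in X <= _]addrC lerD2l.
by rewrite ler_pdivrMr.
Qed.

(** The intervals are the sets on which [time_step t k] is constant, so
    exactly one term survives. *)
Lemma step_time_sum (t : R) (k : nat) (s : R) (V : lmodType C) (Phi : nat -> V) :
  0 <= s -> s <= t ->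
  \sum_(j < (Num.truncn (t * k.+1%:R)).+1)
    (\1_(`[0, t] `&` `]t - j.+1%:R / k.+1%:R, t - j%:R / k.+1%:R]) s)%:C *: Phi j =
  Phi (Num.truncn ((t - s) * k.+1%:R)).
Proof.
move=> s0 st; have k0 : 0 < k.+1%:R :> R by rewrite ltr0n.
have ts0 : 0 <= t - s by rewrite subr_ge0.
have x0 : 0 <= (t - s) * k.+1%:R by rewrite mulr_ge0.
set J := Num.truncn _; set j0 := Num.truncn ((t - s) * k.+1%:R).
have jJ : (j0 < J.+1)%N.
  by rewrite ltnS; apply: le_truncn; rewrite ler_wpM2r// gerBl.
have inE (j : nat) : ((`[0, t] `&` `]t - j.+1%:R / k.+1%:R, t - j%:R / k.+1%:R])%classic s) <-> j = j0.
  have -> : (`[0, t] `&` `]t - j.+1%:R / k.+1%:R, t - j%:R / k.+1%:R])%classic s =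
     (`[0, t]%classic s /\ `]t - j.+1%:R / k.+1%:R, t - j%:R / k.+1%:R]%classic s) by [].
  rewrite /= !in_itv/= s0 st/= ltrBlDl -ltrBlDr ltr_pdivlMr// lerBrDl -lerBrDr ler_pdivrMr//.
  split=> [[_ /andP[h1 h2]]|->]; first by apply/esym/truncn_def; rewrite h2.
  by have /andP[-> ->] := truncn_itv x0.
rewrite (bigD1 (Ordinal jJ))//= big1 ?addr0.
  by rewrite indicE (mem_set ((inE j0).2 erefl)) scale1r.
move=> j jn; rewrite indicE (_ : (s \in _) = false) ?scale0r//.
apply/negP => /set_mem/inE jj; move/eqP: jn; apply; exact: val_inj.
Qed.

(** Uniform continuity on the compact interval [0, L], for the pseudo-distance
    w. *)
Lemma heine (L : R) (w : R -> R -> R) : (forall x y, w x y = w y x) ->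
  (forall x y z, w x z <= w x y + w y z) ->
  (forall x, 0 <= x <= L -> forall e : R, 0 < e -> exists2 d : R, 0 < d &
     forall y, 0 <= y <= L -> `|x - y| < d -> w x y < e) ->
  forall e : R, 0 < e -> exists2 d : R, 0 < d &
    forall x y, 0 <= x <= L -> 0 <= y <= L -> `|x - y| < d -> w x y < e.
Proof.
move=> sym tri cont e e0.
pose P (d x : R) := 0 <= x <= L -> forall y, 0 <= y <= L -> `|x - y| < d -> w x y < e.
have /compact_near_coveringP nc := @segment_compact R 0 L.
have : \forall d \near (0 : R)^'+, `[0, L] `<=` P d.
  apply: (nc R) => x; rewrite /= in_itv/= => x0.
  have e2 : 0 < e / 2 by rewrite divr_gt0.
  have [d0 d00 dP] := cont x x0 _ e2.
  have d2 : 0 < d0 / 2 by rewrite divr_gt0.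
  have A : \forall x' \near x, `|x - x'| < d0 / 2 by exact: nbhsx_ballx.
  near=> x' d => x'0 y y0 xy.
  have h1 : `|x - x'| < d0 / 2 by near: x'; exact: A.
  have h2 : d < d0 / 2 by near: d; exact: nbhs_right_lt.
  rewrite [e]splitr (le_lt_trans (tri x' x y))// ltrD//.
    rewrite sym dP// (lt_trans h1)// ltr_pdivrMr// mulr_natr mulr2n ltrDl//.
  rewrite dP// -[x](subrK x') -addrA (le_lt_trans (ler_normD _ _))// [d0]splitr ltrD//.
  exact: lt_trans h2.
move=> [d /= d0 dP]; have d2 : 0 < d / 2 by rewrite divr_gt0.
exists (d / 2) => // x y x0 y0 xy.
have dd : `|0 - d / 2| < d.
  by rewrite sub0r normrN gtr0_norm// ltr_pdivrMr// mulr_natr mulr2n ltrDl.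
by apply: (dP _ dd d2 x _ x0 y y0 xy); rewrite /= in_itv.
Unshelve. all: by end_near.
Qed.
End SimpleApproximation.

(** * The reached state is a Bochner integral *)

Section SimpleSums.
Context {R : realType} {m : nat}.
Local Notation C := R[i].
Local Notation mu := (@lebesgue_measure R).
Variable p : R.
Hypothesis p1 : 1 <= p.
Local Notation X := (@Lpv R p m).
Local Notation N := (@Lpv_norm R p m).
Local Notation "x ~~ y" := (same N x y) (at level 70).

Lemma same_sum (I : finType) (x y : I -> (R -> 'cV[C]_m)) :
  (forall i, X (x i)) -> (forall i, X (y i)) -> (forall i, x i ~~ y i) ->
  [/\ X (\sum_i x i), X (\sum_i y i) & \sum_i x i ~~ \sum_i y i].
Proof.
move=> Xx Xy xy; pose P (a b : R -> 'cV[C]_m) := [/\ X a, X b & a ~~ b].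
apply: (big_rec2 P) => [|i a b _ [Xa Xb ab]].
  by split; [exact: (Lpv0 p1)|exact: (Lpv0 p1)|exact: (same_refl p1)].
split; [exact: (LpvD p1)|exact: (LpvD p1)|exact: (sameD p1)].
Qed.

Lemma simple_fin (D : set R) (I : finType) (E : I -> set R) (x : I -> (R -> 'cV[C]_m)) :
  (forall i, [/\ measurable (E i), E i `<=` D & X (x i)]) ->
  simple_with_integral X D (fun s => \sum_i (\1_(E i) s)%:C *: x i)
    (\sum_i (fine (mu (E i)))%:C *: x i).
Proof.
move=> Ex; exists #|I|, (fun j => E (enum_val j)), (fun j => x (enum_val j)); split => //.
- by apply/funext => s; rewrite (big_enum_val (fun i => (\1_(E i) s)%:C *: x i)).
- by rewrite (big_enum_val (fun i => (fine (mu (E i)))%:C *: x i)).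
Qed.

Lemma step_time_prod (t : R) (k : nat) (I : finType) (E : I -> set R) (c : I -> C)
    (V : lmodType C) (Phi : nat -> V) (s : R) : 0 <= s -> s <= t ->
  \sum_(q : I * 'I_(Num.truncn (t * k.+1%:R)).+1)
    (\1_(E q.1 `&` (`[0, t] `&` `]t - q.2.+1%:R / k.+1%:R, t - q.2%:R / k.+1%:R])) s)%:C
      *: (c q.1 *: Phi q.2) =
  (\sum_i (\1_(E i) s)%:C * c i) *: Phi (Num.truncn ((t - s) * k.+1%:R)).
Proof.
move=> s0 st; rewrite -(step_time_sum _ _ s0 st) scaler_suml.
rewrite -(pair_bigA _ (fun i (j : 'I_(Num.truncn (t * k.+1%:R)).+1) =>
  (\1_(E i `&` (`[0, t] `&` `]t - j.+1%:R / k.+1%:R, t - j%:R / k.+1%:R])) s)%:C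
      *: (c i *: Phi j)))/=.
apply: eq_bigr => i _; rewrite scaler_sumr; apply: eq_bigr => j _.
rewrite !scalerA; congr (_ *: _); rewrite mulrAC -rmorphM; congr (_%:C * _).
by rewrite !indicE !in_setI; case: (s \in E i); rewrite ?mul1r ?mul0r.
Qed.

Lemma Lpv_norm_to0 (q : nat -> R -> 'cV[C]_m) (M : R) : (forall k, X (q k)) ->
  (forall k s, 0 <= s -> s <= 1 -> cvnorm (q k s) <= M) ->
  (forall s, 0 <= s -> s <= 1 -> forall e : R, 0 < e -> exists n0, forall k, (n0 <= k)%N ->
     cvnorm (q k s) < e) ->
  forall e : R, 0 < e -> exists n0, forall k, (n0 <= k)%N -> N (q k) < e.
Proof.
move=> Xq qM qc e e0; have p0 : 0 < p by rewrite (lt_le_trans ltr01).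
have pV : p^-1 * p = 1 by rewrite mulVf// gt_eqF.
have ep0 : 0 < e `^ p by rewrite powR_gt0.
have M0 : 0 <= M := le_trans (cvnorm_ge0 _) (qM 0%N 0 (lexx 0) ler01).
have mI : measurable (`[0, 1]%classic : set R) by exact: measurable_itv.
have main := @dominated_to0 R `[0, 1] (fun k s => cvnorm (q k s) `^ p) (cst (M `^ p)) mI.
have [k|k s _|k s|s|n0 n0P] := main _ (integrable_itv_cst 0 1 (M `^ p)) _ _ _ _ ep0.
- by have /(LpvP p1)[_ ki] := Xq k; apply/measurable_EFinP; exact: measurable_int ki.
- by rewrite powR_ge0.
- rewrite /= in_itv/= => /andP[s0 s1].
  by apply: powR_mono; rewrite ?cvnorm_ge0 ?(ltW p0)// qM.
- rewrite /= in_itv/= => /andP[s0 s1] d d0.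
  have dp : 0 < d `^ p^-1 by rewrite powR_gt0.
  have [n0 n0P] := qc s s0 s1 _ dp; exists n0 => k kn.
  have -> : d = (d `^ p^-1) `^ p by rewrite -powRrM pV powRr1// ltW.
  by apply: (gt0_ltr_powR p0); rewrite ?nnegrE ?cvnorm_ge0 ?powR_ge0// n0P.
exists n0 => k kn; rewrite (Lpv_normE p1 (Xq k)).
have -> : e = (e `^ p) `^ p^-1 by rewrite -powRrM mulrC pV powRr1// ltW.
apply: gt0_ltr_powR; rewrite ?invr_gt0// ?nnegrE ?powR_ge0//; last exact: n0P.
by apply: Rintegral_ge0 => s _; rewrite powR_ge0.
Qed.

End SimpleSums.

Lemma half_share (R : realType) (e M : R) : 0 < e -> 0 <= M -> e / 2 / (M + 1) * M < e / 2.
Proof.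
move=> e0 M0; have M1 : 0 < M + 1 by rewrite ltr_wpDl.
by rewrite -mulrA gtr_pMr ?divr_gt0// ltr_pdivrMl// mulr1 ltrDl.
Qed.

Lemma quarter_share (R : realType) (e U : R) : 0 < e -> 0 <= U ->
  4 * (e / 2 / (4 * U + 1)) * U <= e / 2.
Proof.
move=> e0 U0; rewrite mulrAC mulrC; apply/ltW/half_share => //.
by rewrite mulr_ge0.
Qed.

Section BochnerExistence.
Context {R : realType} {n m : nat}.
Local Notation C := R[i].
Local Notation mu := (@lebesgue_measure R).
Variable p : R.
Hypothesis p1 : 1 <= p.
Variable Net : network R n m.
Local Notation B := (adjB Net).
Local Notation X := (@Lpv R p m).
Local Notation N := (@Lpv_norm R p m).
Local Notation "x ~~ y" := (same N x y) (at level 70).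
Variables (F : R -> 'cV[C]_m) (d : 'cV[C]_m) (lam : C).
Hypothesis XF : X F.
Hypothesis FE : forall rho : R, 0 <= rho ->
  ext B F rho + \sum_(k < Num.truncn rho) iter k (mulmx B) d =
  F 0 + lam *: vintegral `[0, rho] (ext B F).
Local Notation K := (ext B F).
Variables (t : R) (u : R -> C).
Hypothesis t0 : 0 <= t.
Hypothesis Lu : Lp p `[0, t] u.
Local Notation z := (state B F t u).
Let Fi : vintegrable `[0, 1] F := Lpv_vintegrable p1 XF.
Let ui : cintegrable `[0, t] u := Lp_cintegrable p1 t0 Lu.
Variable T : R -> (R -> 'cV[C]_m) -> (R -> 'cV[C]_m).
Hypothesis HT : strongly_continuous_semigroup X N T.
Hypothesis HG : generates X N (op_A p Net) T.
Hypothesis HR : resolvent_set X N (op_A p Net) lam.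
Variable Q : C -> R -> 'cV[C]_m.
Hypothesis XQ : forall c, X (Q c).
Hypothesis QF : forall c, Q c ~~ (c *: F).

Let XT (r : R) : 0 <= r -> X (T r F). Proof. by move=> r0; exact: (semigroup_Lpv HT r0 XF). Qed.
Let XK (r : R) : 0 <= r -> X (fun s => K (s + r)).
Proof. by move=> r0; exact: (kernel_Lpv Fi FE p1 r0). Qed.
Let TK (r : R) : 0 <= r -> T r F ~~ (fun s => K (s + r)).
Proof. by move=> r0; exact: (semigroup_shift p1 HT HG HR XF r0 (XK r0)). Qed.

Lemma orbit_bounded : exists2 M : R, 0 <= M & forall r, 0 <= r -> r <= t + 1 -> N (T r F) <= M.
Proof.
have [M M0 MP] := kernel_bounded Fi FE (t + 2).
exists M => // r r0 rt; rewrite (Lpv_norm_same p1 (XT r0) (XK r0) (TK r0)).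
apply: (Lpv_norm_bound p1); first exact: (Lpv_vmeas p1 (XK r0)).
by move=> s /andP[s0 s1]; apply: MP; [exact: addr_ge0|lra].
Qed.

Lemma orbit_modulus (e : R) : 0 < e -> exists2 dl : R, 0 < dl & forall r r' : R,
  0 <= r -> r <= t + 1 -> 0 <= r' -> r' <= t + 1 -> `|r - r'| < dl -> N (T r F - T r' F) < e.
Proof.
move=> e0; pose w (x y : R) := N (T `|x| F - T `|y| F).
have ws (x y : R) : w x y = w y x by rewrite /w -opprB (Lpv_normN p).
have wt (x y y' : R) : w x y' <= w x y + w y y'.
  by apply: (Lpv_norm_sub p1); exact: XT.
have wc (x : R) : 0 <= x <= t + 1 -> forall e : R, 0 < e -> exists2 d : R, 0 < d &
     forall y, 0 <= y <= t + 1 -> `|x - y| < d -> w x y < e.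
  move=> /andP[x0 x1] a a0; have [b b0 bP] := semigroup_cont HT XF x0 a0.
  exists b => // y /andP[y0 y1] xy; rewrite ws /w !ger0_norm//.
  exact: bP.
have [b b0 bP] := heine ws wt wc e0; exists b => // r r'.
move=> r0 r1 r'0 r'1 rr.
have I1 : 0 <= r <= t + 1 by rewrite r0.
have I2 : 0 <= r' <= t + 1 by rewrite r'0.
by have := bP r r' I1 I2 rr; rewrite /w (ger0_norm r0) (ger0_norm r'0).
Qed.

(** If the input is a simple function and the orbit T (t - s) F is frozen at
    the time [time_step t k s], then the integrand is a simple function, and
    its integral can be computed pointwise because T r F is the class of K (.
    + r). *)
Lemma simple_input (k : nat) (v : R -> C) : step `[0, t] v ->
  exists hI : (R -> R -> 'cV[C]_m) * (R -> 'cV[C]_m),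
  [/\ simple_with_integral X `[0, t] hI.1 hI.2,
      forall s, `[0, t]%classic s -> hI.1 s = v s *: T (time_step t k s) F,
      forall s, 0 <= s -> vintegrable `[0, t] (fun r => v r *: K (s + time_step t k r)),
      X hI.2 /\ X (fun s => vintegral `[0, t] (fun r => v r *: K (s + time_step t k r))) &
      hI.2 ~~ (fun s => vintegral `[0, t] (fun r => v r *: K (s + time_step t k r)))].
Proof.
move=> [I [E [c [Em vE]]]].
have mD : measurable (`[0, t]%classic : set R) by exact: measurable_itv.
pose J := (Num.truncn (t * k.+1%:R)).+1.
pose S (j : nat) : set R := `[0, t] `&` `]t - j.+1%:R / k.+1%:R, t - j%:R / k.+1%:R].
pose tau (j : nat) : R := j.+1%:R / k.+1%:R.
have tau0 j : 0 <= tau j by rewrite divr_ge0.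
pose EE (q : I * 'I_J) := E q.1 `&` S q.2.
pose xx (q : I * 'I_J) := c q.1 *: T (tau q.2) F.
pose yy (q : I * 'I_J) : R -> 'cV[C]_m := c q.1 *: (fun s => K (s + tau q.2)).
have Xx q : X (xx q) by apply: (LpvZ p1); exact: XT.
have Xy q : X (yy q) by apply: (LpvZ p1); exact: XK.
have mE q : measurable (EE q).
  by apply: measurableI; [exact: (Em q.1).1|exact: measurableI].
have ED q : EE q `<=` `[0, t] by move=> s [+ _]; exact: (Em q.1).2.
have vD s r : `[0, t]%classic r ->
    v r *: K (s + time_step t k r) = \sum_q (\1_(EE q) r)%:C *: (c q.1 *: K (s + tau q.2)).
  move=> rD; have := rD; rewrite /= in_itv/= => /andP[r0 rt].
  by rewrite /EE /S (step_time_prod _ _ _ (fun j => K (s + tau j)) r0 rt) -vE.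
have gi s q : vintegrable `[0, t] (fun r => (\1_(EE q) r)%:C *: (c q.1 *: K (s + tau q.2))).
  by apply: vintegrableZl => //; exact: cintegrable_indic.
have JE s : vintegral `[0, t] (fun r => v r *: K (s + time_step t k r)) =
    (\sum_q (fine (mu (EE q)))%:C *: yy q) s.
  rewrite (eq_vintegral (vD s)) vintegral_sum// fct_sumE; apply: eq_bigr => q _.
  by rewrite vintegralZl ?cintegral_indic//; exact: cintegrable_indic.
have Xfx q : X ((fine (mu (EE q)))%:C *: xx q) by exact: (LpvZ p1).
have Xfy q : X ((fine (mu (EE q)))%:C *: yy q) by exact: (LpvZ p1).
have sxy q : (fine (mu (EE q)))%:C *: xx q ~~ (fine (mu (EE q)))%:C *: yy q.
  apply: (sameZ p1 _ (Xx q) (Xy q)); apply: (sameZ p1 _ (XT _) (XK _)) => //.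
  exact: TK.
have [SX SY SS] := same_sum p1 Xfx Xfy sxy.
exists (fun s => \sum_q (\1_(EE q) s)%:C *: xx q, \sum_q (fine (mu (EE q)))%:C *: xx q) => /=.
have -> : (fun s => vintegral `[0, t] (fun r => v r *: K (s + time_step t k r))) =
    \sum_q (fine (mu (EE q)))%:C *: yy q by apply/funext.
split; [by apply: simple_fin => q; split; [exact: mE|exact: ED|exact: Xx]| | |split; [exact: SX|exact: SY]|exact: SS].
- move=> s; rewrite /= in_itv/= => /andP[s0 st].
  rewrite /EE /S /xx (step_time_prod _ _ _ (fun j => T (tau j) F) s0 st) -vE//.
  by rewrite /= in_itv/= s0.
- move=> s s0; apply: (eq_vintegrable mD (fun r rD => esym (vD s r rD))).
  exact: vintegrable_sum.
Qed.

Let step_mem (k : nat) (s : R) : 0 <= s -> s <= t -> [/\ 0 <= t - s, t - s <= t + 1,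
  0 <= time_step t k s & time_step t k s <= t + 1].
Proof.
move=> s0 st; have [h1 h2] := time_step_itv k st.
have k1 : k.+1%:R^-1 <= 1 :> R by rewrite invf_le1// ler1n.
have {h2 k1} h3 : time_step t k s - (t - s) <= 1 := le_trans h2 k1.
by move: (time_step t k s) h1 h3 => x h1 h3; split; lra.
Qed.

Section SimpleInputs.
Variable v : nat -> R -> C.
Hypothesis vs : forall k, step `[0, t] (v k).
Hypothesis vN : forall k s, `[0, t]%classic s -> Normc.normc (v k s) <= 4 * Normc.normc (u s).
Hypothesis vc : forall s, `[0, t]%classic s -> forall e : R, 0 < e ->
  exists n0, forall k, (n0 <= k)%N -> Normc.normc (u s - v k s) < e.
Let mD : measurable (`[0, t]%classic : set R) := measurable_itv _.

(** The first term is the error of the input, times a bound on the orbit; the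
    second one is the error of the time step, times a bound on the simple
    input. *)
Lemma frozen_orbit_error (M w : R) (k : nat) (s : R) :
  (forall r, 0 <= r -> r <= t + 1 -> N (T r F) <= M) -> `[0, t]%classic s ->
  N (T (t - s) F - T (time_step t k s) F) <= w ->
  N (T (t - s) (Q (u s)) - v k s *: T (time_step t k s) F) <=
  M * Normc.normc (u s - v k s) + 4 * w * Normc.normc (u s).
Proof.
move=> MP sD ww; have := sD; rewrite /= in_itv/= => /andP[s0 st].
have [ts0 ts1 r0 r1] := step_mem k s0 st.
set r := time_step t k s in ww r0 r1 *.
have X1 := XT ts0; have X2 := XT r0.
have Xa c : X (c *: T (t - s) F) by exact: (LpvZ p1).
have Xb c : X (c *: T r F) by exact: (LpvZ p1).
have XGs : X (T (t - s) (Q (u s))) by exact: (semigroup_Lpv HT).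
rewrite (Lpv_norm_same p1 (LpvB p1 XGs (Xb (v k s))) (LpvB p1 (Xa (u s)) (Xb (v k s)))); last first.
  apply: (sameB p1 XGs (Xa (u s)) (Xb (v k s)) (Xb (v k s)) _ (same_refl p1 _)).
  exact: (orbit_same p1 XF HT XQ QF).
have -> : u s *: T (t - s) F - v k s *: T r F =
    (u s - v k s) *: T (t - s) F + v k s *: (T (t - s) F - T r F).
  by rewrite scalerBl scalerBr addrA subrK.
have Xd : X (T (t - s) F - T r F) by exact: (LpvB p1).
have Xe : X (v k s *: (T (t - s) F - T r F)) by exact: (LpvZ p1).
rewrite (le_trans (Lpv_normD p1 (Xa _) Xe))// (Lpv_normZ p1 _ X1) (Lpv_normZ p1 _ Xd) lerD//.
  by rewrite mulrC ler_wpM2r ?normc_ge0// MP.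
rewrite mulrAC; apply: ler_pM => //; [exact: normc_ge0|exact: Lpv_norm_ge0|exact: vN].
Qed.

Lemma frozen_orbit_close (w : R) : 0 < w -> exists n0, forall k, (n0 <= k)%N ->
  forall s, `[0, t]%classic s -> N (T (t - s) F - T (time_step t k s) F) <= w.
Proof.
move=> w0; have [dl dl0 dlP] := orbit_modulus w0.
have [n0 n0P] := inv_nat_small dl0; exists n0 => k kn s; rewrite /= in_itv/= => /andP[s0 st].
have [ts0 ts1 r0 r1] := step_mem k s0 st; have [h1 h2] := time_step_itv k st.
apply/ltW/dlP => //; rewrite distrC ger0_norm ?subr_ge0//.
exact: le_lt_trans h2 (n0P k kn).
Qed.

Let di k : cintegrable `[0, t] (fun s => u s - v k s).
Proof.
have [I [E [c [Em vE]]]] := vs k.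
have vi : cintegrable `[0, t] (v k).
  apply: (eq_cintegrable mD (fun s sD => esym (vE s sD))).
  apply: cintegrable_sum => // i.
  apply: (eq_cintegrable (f := fun s => c i * (\1_(E i) s)%:C)) => //.
    by move=> s _; rewrite mulrC.
  by apply: cintegrableZ => //; apply: cintegrable_indic; exact: (Em i).1.
by apply: cintegrableD => //; exact: cintegrableN.
Qed.

Lemma simple_input_L1 (e : R) : 0 < e -> exists n0, forall k, (n0 <= k)%N ->
  \int[mu]_(s in `[0, t]) Normc.normc (u s - v k s) < e.
Proof.
apply: (@dominated_to0 R `[0, t] (fun k s => Normc.normc (u s - v k s))
  (fun s => 5 * Normc.normc (u s)) mD).
- by move=> k; apply/measurable_EFinP; exact: measurable_int (cintegrable_normc mD (di k)).
- by apply: integrableZlR => //; exact: cintegrable_normc.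
- by move=> k s _; exact: normc_ge0.
- by move=> k s sD; rewrite (le_trans (normcB _ _))//; have := vN k sD; lra.
- by move=> s sD; exact: vc.
Qed.

Lemma frozen_orbit_L1 (M : R) (h : nat -> R -> R -> 'cV[C]_m) :
  0 <= M -> (forall r, 0 <= r -> r <= t + 1 -> N (T r F) <= M) ->
  (forall k s, `[0, t]%classic s -> h k s = v k s *: T (time_step t k s) F) ->
  (\int[mu]_(s in `[0%R, t]) (N (T (t - s) (Q (u s)) - h k s))%:E)%E @[k --> \oo] --> (0%E : \bar R).
Proof.
move=> M0 MP hE; pose U := \int[mu]_(s in `[0, t]) Normc.normc (u s).
have Mp : 0 < M + 1 by rewrite ltr_wpDl.
have U0 : 0 <= U by apply: Rintegral_ge0 => s _; exact: normc_ge0.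
have uni := cintegrable_normc mD ui.
apply: ereal_cvg0 => [k|e e0].
  by apply: integral_ge0 => s _; rewrite lee_fin Lpv_norm_ge0.
have w0 : 0 < e / 2 / (4 * U + 1) by rewrite !divr_gt0//; lra.
have e2 : 0 < e / 2 / (M + 1) by rewrite !divr_gt0.
have [n1 n1P] := frozen_orbit_close w0; have [n2 n2P] := simple_input_L1 e2.
exists (maxn n1 n2) => k; rewrite geq_max => /andP[k1 k2].
set w := e / 2 / (4 * U + 1) in w0 n1P.
have dni := cintegrable_normc mD (di k).
have b1 := integrableZlR M mD dni; have b2 := integrableZlR (4 * w) mD uni.
have bi := integrableDR mD b1 b2.
apply: (@le_lt_trans _ _ (\int[mu]_(s in `[0%R, t])
   (M * Normc.normc (u s - v k s) + 4 * w * Normc.normc (u s))%:E)%E).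
  apply: lower_integral_le => s sD; first exact: Lpv_norm_ge0.
  by rewrite hE//; exact: frozen_orbit_error MP sD (n1P k k1 s sD).
rewrite (EFin_Rintegral mD bi) lte_fin.
rewrite RintegralD// RintegralZl// RintegralZl// -/U.
have H1 : M * (\int[mu]_(s in `[0, t]) Normc.normc (u s - v k s)) <= e / 2 / (M + 1) * M.
  by rewrite mulrC ler_wpM2r// ltW// n2P.
have H2 : e / 2 / (M + 1) * M < e / 2 by exact: half_share.
have H3 : 4 * w * U <= e / 2 by exact: quarter_share.
rewrite [X in _ < X]splitr; exact: ltr_leD (le_lt_trans H1 H2) H3.
Qed.

Lemma frozen_orbit_pointwise (M : R) (h : nat -> R -> R -> 'cV[C]_m) (s : R) :
  0 <= M -> (forall r, 0 <= r -> r <= t + 1 -> N (T r F) <= M) -> `[0, t]%classic s ->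
  (forall k, h k s = v k s *: T (time_step t k s) F) ->
  N (T (t - s) (Q (u s)) - h k s) @[k --> \oo] --> (0 : R).
Proof.
move=> M0 MP sD hE; apply: seq0P_cvg => [k|e e0]; first exact: Lpv_norm_ge0.
have Mp : 0 < M + 1 by rewrite ltr_wpDl.
have e2 : 0 < e / 2 / (M + 1) by rewrite !divr_gt0.
have U0 := normc_ge0 (u s).
have U1 : 0 < 4 * Normc.normc (u s) + 1 by lra.
have w0 : 0 < e / 2 / (4 * Normc.normc (u s) + 1) by rewrite !divr_gt0.
have [n1 n1P] := frozen_orbit_close w0; have [n2 n2P] := vc sD e2.
exists (maxn n1 n2) => k; rewrite geq_max => /andP[k1 k2]; rewrite hE.
apply: (le_lt_trans (frozen_orbit_error MP sD (n1P k k1 s sD))).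
have H1 : M * Normc.normc (u s - v k s) <= e / 2 / (M + 1) * M.
  by rewrite mulrC ler_wpM2r// ltW// n2P.
have H2 : e / 2 / (M + 1) * M < e / 2 by exact: half_share.
have H3 : 4 * (e / 2 / (4 * Normc.normc (u s) + 1)) * Normc.normc (u s) <= e / 2.
  exact: quarter_share.
rewrite [X in _ < X]splitr; exact: ltr_leD (le_lt_trans H1 H2) H3.
Qed.

Let frozen k s r := v k r *: K (s + time_step t k r).

Let frozen_bound (L : R) k s r :
  (forall rho, 0 <= rho -> rho <= t + 2 -> cvnorm (K rho) <= L) ->
  0 <= s -> s <= 1 -> `[0, t]%classic r ->
  cvnorm (frozen k s r - u r *: K (t - r + s)) <= 5 * L * Normc.normc (u r).
Proof.
move=> LP s0 s1 rD; have := rD; rewrite /= in_itv/= => /andP[r0 rt].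
have [h1 h2 h3 h4] := step_mem k r0 rt.
have A1 : 0 <= s + time_step t k r by rewrite addr_ge0.
have A2 : s + time_step t k r <= t + 2 by lra.
have A3 : 0 <= t - r + s by rewrite addr_ge0.
have A4 : t - r + s <= t + 2 by lra.
rewrite (le_trans (cvnormB _ _))// !cvnormZ.
have B1 : Normc.normc (v k r) * cvnorm (K (s + time_step t k r)) <= 4 * Normc.normc (u r) * L.
  by apply: ler_pM; [exact: normc_ge0|exact: cvnorm_ge0|exact: vN|exact: LP].
have B2 : Normc.normc (u r) * cvnorm (K (t - r + s)) <= Normc.normc (u r) * L.
  by rewrite ler_wpM2l ?normc_ge0// LP.
have -> : 5 * L * Normc.normc (u r) = 4 * Normc.normc (u r) * L + Normc.normc (u r) * L by ring.
exact: lerD.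
Qed.

Let frozen_cvg (L s r : R) :
  (forall rho, 0 <= rho -> rho <= t + 2 -> cvnorm (K rho) <= L) -> 0 <= L ->
  0 <= s -> s <= 1 -> `[0, t]%classic r -> forall b : R, 0 < b ->
  exists n0, forall k, (n0 <= k)%N -> cvnorm (frozen k s r - u r *: K (t - r + s)) < b.
Proof.
move=> LP L0 s0 s1 rD b b0; have := rD; rewrite /= in_itv/= => /andP[r0 rt].
have A3 : 0 <= t - r + s by rewrite addr_ge0// subr_ge0.
have V0 := normc_ge0 (u r).
have V1 : 0 < 4 * Normc.normc (u r) + 1 by rewrite ltr_wpDl// mulr_ge0.
have b1 : 0 < b / 2 / (4 * Normc.normc (u r) + 1) by rewrite !divr_gt0.
have L1 : 0 < L + 1 by rewrite ltr_wpDl.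
have b2 : 0 < b / 2 / (L + 1) by rewrite !divr_gt0.
have [dl dl0 dlP] := kernel_right_continuous Fi FE A3 b1.
have [n1 n1P] := inv_nat_small dl0; have [n2 n2P] := vc rD b2.
exists (maxn n1 n2) => k; rewrite geq_max => /andP[k1 k2].
have [h1 h2] := time_step_itv k rt.
have hh0 : 0 <= time_step t k r - (t - r) by rewrite subr_ge0.
have hh1 := le_lt_trans h2 (n1P k k1).
have := dlP _ hh0 hh1; rewrite /frozen.
have -> : t - r + s + (time_step t k r - (t - r)) = s + time_step t k r by ring.
set K1 := K (s + _); set K2 := K (t - r + s) => H.
have -> : v k r *: K1 - u r *: K2 = v k r *: (K1 - K2) - (u r - v k r) *: K2.
  by apply/matrixP => i j; rewrite !mxE; ring.
rewrite (le_lt_trans (cvnormB _ _))// !cvnormZ.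
have B1 : Normc.normc (v k r) * cvnorm (K1 - K2) <=
    4 * Normc.normc (u r) * (b / 2 / (4 * Normc.normc (u r) + 1)).
  apply: ler_pM; [exact: normc_ge0|exact: cvnorm_ge0|exact: vN|exact: ltW].
have B2 : 4 * Normc.normc (u r) * (b / 2 / (4 * Normc.normc (u r) + 1)) <= b / 2.
  by rewrite mulrAC; exact: quarter_share.
have B3 : Normc.normc (u r - v k r) * cvnorm K2 <= b / 2 / (L + 1) * L.
  apply: ler_pM; [exact: normc_ge0|exact: cvnorm_ge0|exact: ltW (n2P k k2)|].
  by apply: LP => //; lra.
have B4 : b / 2 / (L + 1) * L < b / 2 by exact: half_share.
rewrite [X in _ < X]splitr; exact: ler_ltD (le_trans B1 B2) (le_lt_trans B3 B4).
Qed.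

(** Dominated convergence is used twice: over the times r, for fixed s, by
    right continuity of K; then over s, for the p-th powers of the errors. *)
Lemma frozen_state_cvg (J : nat -> R -> 'cV[C]_m) :
  (forall k s, J k s = vintegral `[0, t] (frozen k s)) ->
  (forall k s, 0 <= s -> vintegrable `[0, t] (frozen k s)) -> (forall k, X (J k)) ->
  forall e : R, 0 < e -> exists n0, forall k, (n0 <= k)%N -> N (J k - z) < e.
Proof.
move=> JE vi XJ; have [L L0 LP] := kernel_bounded Fi FE (t + 2).
have Xz : X z by exact: (state_Lpv p1 XF FE t0 Lu).
pose U := \int[mu]_(s in `[0, t]) (5 * L * Normc.normc (u s)).
have uni := integrableZlR (5 * L) mD (cintegrable_normc mD ui).
have ji k s : 0 <= s -> s <= 1 ->
    vintegrable `[0, t] (fun r => frozen k s r - u r *: K (t - r + s)).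
  move=> s0 s1; apply: vintegrableB => //; first exact: vi.
  exact: (state_integrable Fi FE ui).
have jE k s : 0 <= s -> s <= 1 -> cvnorm ((J k - z) s) <=
    2 * \int[mu]_(r in `[0, t]) cvnorm (frozen k s r - u r *: K (t - r + s)).
  move=> s0 s1.
  rewrite [X in cvnorm X](_ : _ = vintegral `[0, t] (fun r => frozen k s r - u r *: K (t - r + s))).
    by apply: cvnorm_vintegral_le => //; exact: ji.
  rewrite vintegralB// -?JE//; [exact: vi|exact: (state_integrable Fi FE ui)].
apply: (Lpv_norm_to0 p1 (M := 2 * U)) => [k|k s s0 s1|s s0 s1 a a0].
- exact: (LpvB p1 (XJ k) Xz).
- rewrite (le_trans (jE k s s0 s1))// ler_wpM2l//.
  apply: le_Rintegral => //; first by apply: vintegrable_cvnorm => //; exact: ji.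
  by move=> r rD; exact: frozen_bound.
- have a2 : 0 < a / 2 by rewrite divr_gt0.
  have to0 := @dominated_to0 R `[0, t]
    (fun k r => cvnorm (frozen k s r - u r *: K (t - r + s))) _ mD _ uni.
  have [k|k r _|k r rD|r rD b b0|n0 n0P] := to0 _ _ _ _ _ a2.
  + apply/measurable_EFinP; apply: (measurable_int mu).
    by apply: vintegrable_cvnorm => //; exact: ji.
  + exact: cvnorm_ge0.
  + exact: frozen_bound.
  + exact: (frozen_cvg LP).
  exists n0 => k kn; rewrite (le_lt_trans (jE k s s0 s1))//.
  by rewrite mulrC -ltr_pdivlMr// n0P.
Qed.

End SimpleInputs.

Lemma controlled_state_bochner :
  bochner_integral X N `[0, t] (fun s => T (t - s) (Q (u s))) z.
Proof.
have mD : measurable (`[0, t]%classic : set R) by exact: measurable_itv.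
have [v [vs vN vc]] := step_approx mD (cintegrable_cmeas ui).
have [hI hIP] := choice (fun k => simple_input k (vs k)).
have Xz : X z by exact: (state_Lpv p1 XF FE t0 Lu).
have [M M0 MP] := orbit_bounded.
have hE k s : `[0, t]%classic s -> (hI k).1 s = v k s *: T (time_step t k s) F.
  by have [_ H _ _ _] := hIP k; exact: H.
split => //.
  move=> s; rewrite /= in_itv/= => /andP[s0 st]; apply: (semigroup_Lpv HT) => //; by rewrite subr_ge0.
exists (fun k => (hI k).1), (fun k => (hI k).2); split.
- by move=> k; have [] := hIP k.
- apply: aeW => s sD; exact: (frozen_orbit_pointwise (h := fun k => (hI k).1) vN vc M0 MP sD (fun k => hE k s sD)).
- exact: (frozen_orbit_L1 (h := fun k => (hI k).1) vs vN vc M0 MP hE).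
- apply: seq0P_cvg => [k|e e0]; first exact: Lpv_norm_ge0.
  pose J k : R -> 'cV[C]_m := fun s => vintegral `[0, t] (fun r => v k r *: K (s + time_step t k r)).
  have XJ k : X (J k) by have [_ _ _ [_ XJ] _] := hIP k.
  have vi k s : 0 <= s -> vintegrable `[0, t] (fun r => v k r *: K (s + time_step t k r)).
    by have [_ _ H _ _] := hIP k; exact: H.
  have [n0 n0P] := frozen_state_cvg vN vc (fun k s => erefl (J k s)) vi XJ e0.
  exists n0 => k kn; have [_ _ _ [XI _] IJ] := hIP k.
  rewrite (Lpv_norm_same p1 (LpvB p1 XI Xz) (LpvB p1 (XJ k) Xz)); first exact: n0P.
  exact: (sameB p1 XI (XJ k) Xz Xz IJ (same_refl p1 z)).
Qed.

End BochnerExistence.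

(** * Krylov spaces of the network *)

Section Krylov.
Context {K : fieldType}.

Lemma iter_mulmxE q (M : 'M[K]_q) (x : 'cV_q) k : iter k (mulmx M) x = M ^+ k *m x.
Proof.
elim: k => [|k IH]; first by rewrite expr0 mul1mx.
by rewrite iterS IH exprS mulmxA.
Qed.

(** Reduce 'X^k modulo the characteristic polynomial, which annihilates M by
    Cayley-Hamilton: M ^ k is a polynomial in M of degree less than q. *)
Lemma krylov_span q (M : 'M[K]_q) (x : 'cV_q) k :
  M ^+ k *m x \in <<[seq M ^+ j *m x | j <- iota 0 q]>>%VS.
Proof.
case: q M x => [|q] M x; first by rewrite [_ *m _]flatmx0 mem0v.
have -> : M ^+ k = horner_mx M ('X^k %% char_poly M).
  have e : M ^+ k = horner_mx M 'X^k by rewrite rmorphXn /= horner_mx_X.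
  rewrite e {1}(divp_eq 'X^k (char_poly M)) rmorphD rmorphM /=.
  by rewrite Cayley_Hamilton mulr0 add0r.
set r := _ %% _.
have szr : (size r <= q.+1)%N.
  have cn0 : char_poly M != 0 by rewrite -size_poly_gt0 size_char_poly.
  by have := ltn_modpN0 'X^k cn0; rewrite size_char_poly ltnS.
have -> : horner_mx M r = \sum_(j < q.+1) r`_j *: M ^+ j.
  have {1}-> : r = \sum_(j < q.+1) r`_j *: 'X^j.
    rewrite -poly_def; apply/polyP => j; rewrite coef_poly; case: ltnP => // qj.
    by rewrite nth_default// (leq_trans szr).
  rewrite linear_sum; apply: eq_bigr => j _.
  by rewrite linearZ /= rmorphXn /= horner_mx_X.
rewrite mulmx_suml; apply: memv_suml => j _; rewrite -scalemxAl memvZ// memv_span//.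
by apply/mapP; exists (j : nat); rewrite ?mem_iota ?add0n ?ltn_ord.
Qed.

Lemma span_map_coeff (V : vectType K) (h : nat -> V) l x :
  x \in <<[seq h k | k <- iota 0 l]>>%VS -> exists a : 'I_l -> K, x = \sum_k a k *: h k.
Proof.
move=> xs; pose X := map_tuple h (iota_tuple l 0).
have /coord_span xE : x \in <<X>>%VS by [].
exists (fun k => coord X k x); rewrite {1}xE; apply: eq_bigr => k _; congr (_ *: _).
by rewrite (nth_map 0%N) ?size_iota// nth_iota.
Qed.

End Krylov.

Section NetworkAlgebra.
Context {R : realType} {n m : nat}.
Local Notation C := R[i].
Variable Net : network R n m.

Lemma Psi_adjA : Psi Net *m adjA Net = adjB Net *m Psi Net.
Proof.
apply/matrixP => e j; rewrite !mxE (bigD1 (src Net e))//= !mxE eqxx.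
rewrite [X in _ + X = _]big1 ?addr0; last first.
  by move=> k /negbTE nk; rewrite mxE eq_sym nk mul0r.
rewrite mulr_sumr big_mkcond/=; apply: eq_bigr => e' _; rewrite !mxE.
by case: (src Net e' == j); case: (tgt Net e' == src Net e); rewrite /= ?mul0r ?mulr0.
Qed.

Lemma adjB_exp_Psi k (y : 'cV[C]_n) : adjB Net ^+ k *m (Psi Net *m y) = Psi Net *m (adjA Net ^+ k *m y).
Proof.
elim: k => [|k IH]; first by rewrite !expr0 !mul1mx.
by rewrite !exprS -!mulmxA IH mulmxA -Psi_adjA -!mulmxA.
Qed.

(** Cayley-Hamilton for B if there are at most as many edges as vertices, and
    otherwise for A, because B ^ k Psi y = Psi A ^ k y. *)
Lemma reach_span (y : 'cV[C]_n) k : adjB Net ^+ k *m (Psi Net *m y)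
  \in <<[seq adjB Net ^+ j *m (Psi Net *m y) | j <- iota 0 (minn m n)]>>%VS.
Proof.
case: (leqP m n) => mn; first exact: krylov_span.
have seqE l : [seq adjB Net ^+ j *m (Psi Net *m y) | j <- iota 0 l] =
    [seq linfun (mulmx (Psi Net)) z | z <- [seq adjA Net ^+ j *m y | j <- iota 0 l]].
  by rewrite -map_comp; apply: eq_map => j; rewrite /= lfunE adjB_exp_Psi.
rewrite seqE -limg_span adjB_exp_Psi; apply/memv_imgP.
by exists (adjA Net ^+ k *m y); [exact: krylov_span|rewrite lfunE].
Qed.

Lemma spanB_image (y : 'cV[C]_n) l :
  [set x | x \in <<[seq adjB Net ^+ j *m (Psi Net *m y) | j <- iota 0 l]>>%VS] =
  [set Psi Net *m z | z in [set z | z \in <<[seq adjA Net ^+ j *m y | j <- iota 0 l]>>%VS]].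
Proof.
have seqE : [seq adjB Net ^+ j *m (Psi Net *m y) | j <- iota 0 l] =
    [seq linfun (mulmx (Psi Net)) z | z <- [seq adjA Net ^+ j *m y | j <- iota 0 l]].
  by rewrite -map_comp; apply: eq_map => j; rewrite /= lfunE adjB_exp_Psi.
apply/seteqP; split=> x /=; rewrite seqE -limg_span.
  by move=> /memv_imgP[z zs ->]; exists z => //; rewrite lfunE.
by move=> [z zs <-]; apply/memv_imgP; exists z => //; rewrite lfunE.
Qed.

End NetworkAlgebra.

(** * The reachability space *)

Section ReachabilitySpace.
Context {R : realType} {n m : nat}.
Local Notation C := R[i].
Local Notation mu := (@lebesgue_measure R).
Variable p : R.
Hypothesis p1 : 1 <= p.
Variable Net : network R n m.
Local Notation B := (adjB Net).
Local Notation X := (@Lpv R p m).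
Local Notation N := (@Lpv_norm R p m).
Local Notation "x ~~ y" := (same N x y) (at level 70).
Variable T : R -> (R -> 'cV[C]_m) -> (R -> 'cV[C]_m).
Hypothesis HT : strongly_continuous_semigroup X N T.
Hypothesis HG : generates X N (op_A p Net) T.
Variable lam : C.
Hypothesis HR : resolvent_set X N (op_A p Net) lam.
Variable Ql : 'cV[C]_m -> (R -> 'cV[C]_m).
Hypothesis HQ : is_Qlam p Net lam Ql.
Variable v : 'cV[C]_n.
Local Notation d := (Psi Net *m v).

(** F is the continuous representative of Q_lam d. As c F is in the kernel of
    lam - A_m and has boundary value c d, the uniqueness of Q_lam makes c |->
    Q_lam (c d) homogeneous. *)
Lemma Qlam_kernel : exists F, [/\ X F,
  forall rho : R, 0 <= rho ->
    ext B F rho + \sum_(k < Num.truncn rho) iter k (mulmx B) d =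
    F 0 + lam *: vintegral `[0, rho] (ext B F),
  forall c, X (op_Blam Net Ql v c) & forall c, op_Blam Net Ql v c ~~ (c *: F)].
Proof.
have [HQ1 HQ2] := HQ.
have bd c : boundary_space Net (op_B Net v c).
  by exists (c *: v) => //; rewrite /op_B scalemxAr.
have d1 : op_B Net v 1 = d by rewrite /op_B scale1r.
have [Am0 Q0] := HQ1 _ (bd 1); rewrite d1 in Am0 Q0; rewrite /ker_Am /= in Am0.
have [F [XF QF dE FTC FE]] := op_Am_ext p1 Am0 Q0.
have [XQ XlQ _ _] := Am0.
have XlF : X (lam *: F) by exact: (LpvZ p1).
have lQF : lam *: Ql d ~~ lam *: F by exact: (sameZ p1).
exists F; split; [exact: XF| | |].
- move=> rho r0; rewrite (FE rho r0) (window_same p1 Net (lexx 0) r0 XlQ XlF lQF).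
  by rewrite (window_scale p1 Net rho lam (lexx 0) XF).
- by move=> c; have [[Xc _ _ _] _] := HQ1 _ (bd c).
move=> c.
have XcF : X (c *: F) by exact: (LpvZ p1).
have XlcF : X (lam *: (c *: F)) by exact: (LpvZ p1).
have ci : vintegrable `[0, 1] (lam *: (c *: F)) := Lpv_vintegrable p1 XlcF.
have cFTC (a b : R) : 0 <= a -> a <= b -> b <= 1 ->
    (c *: F) b - (c *: F) a = vintegral `[a, b] (lam *: (c *: F)).
  move=> a0 ab b1; have -> : (c *: F) b - (c *: F) a = c *: (F b - F a) by rewrite scalerBr.
  rewrite FTC// (same_vintegral p1 XlQ XlF lQF a0 b1) scalerA mulrC -scalerA.
  by rewrite -(vintegralZ c (measurable_itv _) (vintegrable_sub p1 XlF a0 b1)).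
have [wF cF] := vFTC_weak_derivative ci cFTC.
have [M BE] := adjB_factor Net.
have Am : op_Am p Net (c *: F) (lam *: (c *: F)).
  split => //; exists (c *: F) => //; exists (c *: (v + M *m F 0)) => //.
  have F1 : F 1 = d + B *m F 0 by rewrite dE subrK.
  by rewrite -scalemxAr mulmxDr mulmxA -BE -F1.
apply: (HQ2 _ _ Am); split; first by exists (lam *: (c *: F)).
exists (c *: F) => //; rewrite /op_B dE scalerBr -scalemxAr; congr (_ - _).
Qed.

(** By [state_op_A] the image of the Bochner integral under lam - A is the
    profile, and both the integral and its image under A are unique as
    classes. *)
Lemma exact_reachP (t : R) f : 0 <= t ->
  exact_reach p Net T lam Ql v t f <->
  X f /\ exists2 u, Lp p `[0, t] u & f ~~ profile B d t u.
Proof.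
move=> t0; have [F [XF FE XQ QF]] := Qlam_kernel.
have AX u : Lp p `[0, t] u -> X (state B F t u) := state_Lpv p1 XF FE t0.
have PX u : Lp p `[0, t] u -> X (profile B d t u).
  by move=> Lu; exact: profile_Lpv.
split=> [[Xf [u Lu [z [Az [bz zA fz]]]]]|[Xf [u Lu fu]]]; split => //; exists u => //.
  have zs := controlled_state_unique p1 XF FE t0 Lu HT HG HR XQ QF bz.
  have sA := state_op_A p1 XF FE t0 Lu.
  have AA := generator_fun p1 HT ((HG _ _).1 zA) ((HG _ _).1 sA) zs.
  have [[Xz XAz _ _] _] := zA; have [[Xs XAs _ _] _] := sA.
  have Xlz : X (lam *: z) by exact: (LpvZ p1).
  have Xls : X (lam *: state B F t u) by exact: (LpvZ p1).
  have := sameB p1 Xlz Xls XAz XAs (sameZ p1 lam Xz Xs zs) AA.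
  rewrite opprB addrCA subrr addr0 => H.
  exact: (same_trans p1 Xf (LpvB p1 Xlz XAz) (PX u Lu) fz H).
exists (state B F t u), (lam *: state B F t u - profile B d t u); split.
- exact: (controlled_state_bochner p1 XF FE t0 Lu HT HG HR XQ QF).
- exact: (state_op_A p1 XF FE t0 Lu).
- by rewrite opprB addrCA subrr addr0.
Qed.

Let l := minn m n.
Let spanB : {vspace 'cV[C]_m} := <<[seq B ^+ k *m d | k <- iota 0 l]>>%VS.

Lemma profile_tensor (t : R) u : Lp p `[0, t] u ->
  Lp_tensor p [set x | x \in spanB] (profile B d t u).
Proof.
move=> Lu; split; first exact: profile_Lpv.
exists (Num.truncn t).+1, (fun k s => cutoff `[0, t] u (s + (t - 1 - k%:R))),
  (fun k => iter k (mulmx B) d); split; last exact: (same_refl p1).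
move=> k; split; first exact: Lp_cutoff_translate.
by rewrite /= iter_mulmxE; exact: reach_span.
Qed.

Lemma Lp_tensor_same W f g : X f -> X g -> f ~~ g -> Lp_tensor p W g -> Lp_tensor p W f.
Proof.
move=> Xf Xg fg [_ [k [c [e [ce gE]]]]]; split => //; exists k, c, e; split => //.
apply: (same_trans p1 Xf Xg _ fg gE).
by apply: (Lpv_sum p1) => j; apply: (LpvZl p1); have [] := ce j.
Qed.

(** The windows t - 1 - k <= r < t - k with k < l are disjoint, and they lie
    in [0, t] because l <= t. On each of them the input copies G k, elsewhere
    it vanishes; so the terms of the profile with k >= l are 0. *)
Lemma profile_windows (t : R) (G : 'I_l -> R -> C) : l%:R <= t ->
  (forall k, Lp p `[0, 1] (G k)) ->
  exists2 u, Lp p `[0, t] u & forall s, 0 <= s -> s < 1 ->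
    profile B d t u s = \sum_(k < l) G k s *: (B ^+ k *m d).
Proof.
move=> lt LG; have m1 : measurable (`[0, 1[%classic : set R) by exact: measurable_itv.
have LG1 k : Lp p `[0, 1[ (G k).
  have /(LpP _ _ p1)[[g1 g2] gi] := LG k.
  have sub : (`[0, 1[%classic : set R) `<=` `[0, 1] by apply: subset_itvl; rewrite bnd_simp.
  apply/(LpP _ _ p1); split; last exact: integrableS gi.
  by split; [exact: measurable_funS g1|exact: measurable_funS g2].
pose u (r : R) : C := \sum_(k < l) cutoff `[0, 1[ (G k) (r + - (t - 1 - k%:R)).
have t0 : 0 <= t := le_trans (ler0n _ _) lt.
exists u; first by apply: Lp_sum => // k; exact: Lp_cutoff_translate.
move=> s s0 s1; have lK : (l <= (Num.truncn t).+1)%N by rewrite leqW// truncn_ge_nat.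
pose gg (k : nat) : C := oapp (fun k' : 'I_l => G k' s) 0 (insub k).
have argE (j k : nat) : s + (t - 1 - k%:R) + - (t - 1 - j%:R) = s + (j%:R - k%:R) by ring.
have out (j : 'I_l) (k : nat) : nat_of_ord j != k -> cutoff `[0, 1[ (G j) (s + (j%:R - k%:R)) = 0.
  move=> jk; rewrite /cutoff mem_setE in_itv/=; case: ifP => // /andP[h1 h2].
  case: (ltngtP j k) jk => // H _; move: H; rewrite -(ler_nat R) -natr1 => H;
    by exfalso; move: h1 h2 H s0 s1; lra.
have uE (k : nat) : cutoff `[0, t] u (s + (t - 1 - k%:R)) = gg k.
  rewrite /gg; case: insubP => [k' kl kk'|]; last first.
    rewrite -leqNgt => lk; rewrite /cutoff; case: ifP => //= _.
    rewrite /u big1// => j _; rewrite argE out//.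
    by rewrite neq_ltn (leq_trans (ltn_ord j) lk).
  have k0 := ler0n R k; have kl1 : k%:R + 1 <= t.
    by rewrite natr1 (le_trans _ lt)// ler_nat.
  rewrite /cutoff mem_setE in_itv/= (_ : _ && _ = true); last by apply/andP; split; lra.
  rewrite /u (bigD1 k')//= big1 ?addr0; last first.
    by move=> j jk; rewrite argE out// -kk'.
  rewrite argE kk' subrr addr0 /cutoff mem_setE in_itv/= s0 s1//.
rewrite /profile; under eq_bigr => k _ do rewrite uE.
have -> : \sum_(k < l) G k s *: (B ^+ k *m d) = \sum_(k < l) gg k *: (B ^+ k *m d).
  by apply: eq_bigr => k _; rewrite /gg valK.
rewrite (big_ord_widen _ (fun k => gg k *: (B ^+ k *m d)) lK) [RHS]big_mkcond/=.
apply: eq_bigr => k _; rewrite iter_mulmxE; case: ltnP => // lk.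
by rewrite /gg insubN ?scale0r// -leqNgt.
Qed.

Lemma tensor_coeff (f : R -> 'cV[C]_m) : Lp_tensor p [set x | x \in spanB] f ->
  exists2 G : 'I_l -> R -> C, (forall k, Lp p `[0, 1] (G k)) &
    f ~~ (fun s => \sum_(k < l) G k s *: (B ^+ k *m d)).
Proof.
move=> [Xf [q [g [e [ge fE]]]]].
have ex j : exists a : 'I_l -> C, e j = \sum_k a k *: (B ^+ k *m d).
  exact: (@span_map_coeff _ _ (fun k => B ^+ k *m d) l _ (ge j).2).
have [a aE] := choice ex.
exists (fun k s => \sum_j a j k * g j s).
  by move=> k; apply: Lp_sum => // j; apply: LpZ => //; exact: (ge j).1.
rewrite (_ : (fun s => \sum_(k < l) _) = (fun s => \sum_j g j s *: e j))//.
apply/funext => s; under [RHS]eq_bigr => j _ do rewrite aE scaler_sumr.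
rewrite exchange_big/=; apply: eq_bigr => k _; rewrite scaler_suml.
by apply: eq_bigr => j _; rewrite scalerA mulrC.
Qed.

Lemma tensor_reached (t : R) f : l%:R <= t ->
  Lp_tensor p [set x | x \in spanB] f -> exact_reach p Net T lam Ql v t f.
Proof.
move=> lt Lf; have t0 : 0 <= t := le_trans (ler0n _ _) lt.
have [Xf _] := Lf; have [G LG fG] := tensor_coeff Lf.
have [u Lu uE] := profile_windows lt LG.
apply/exact_reachP => //; split=> //; exists u => //.
have XS : X (fun s => \sum_(k < l) G k s *: (B ^+ k *m d)).
  by apply: (Lpv_sum p1) => k; exact: (LpvZl p1).
have XP : X (profile B d t u) := profile_Lpv p1 Net d Lu.
apply: (same_trans p1 Xf XS XP fG); apply/(same_aeP p1 XS XP).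
apply: ae_mono (eq_co_ae (fun s s0 s1 => esym (uE s s0 s1))) => s H sI; exact: H.
Qed.

Lemma reached_tensor (t : R) f : 0 <= t ->
  exact_reach p Net T lam Ql v t f -> Lp_tensor p [set x | x \in spanB] f.
Proof.
move=> t0 /(exact_reachP _ t0)[Xf [u Lu fu]].
have [XP _] := profile_tensor Lu.
exact: Lp_tensor_same Xf XP fu (profile_tensor Lu).
Qed.

End ReachabilitySpace.

Theorem corollary5p9 (R : realType) (p : R) (n m : nat) (Net : network R n m)
    (i : 'I_n) (T : R -> (R -> 'cV[R[i]]_m) -> (R -> 'cV[R[i]]_m))
    (lam : R[i]) (Ql : 'cV[R[i]]_m -> (R -> 'cV[R[i]]_m)) (t : R) :
  1 <= p ->
  strongly_continuous_semigroup (Lpv p) (Lpv_norm p) T ->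
  generates (Lpv p) (Lpv_norm p) (op_A p Net) T ->
  resolvent_set (Lpv p) (Lpv_norm p) (op_A p Net) lam ->
  is_Qlam p Net lam Ql ->
  let v : 'cV[R[i]]_n := delta_mx i 0 in
  let l := minn m n in
  (l%:R : R) <= t ->
  let spanB : {vspace 'cV[R[i]]_m} :=
    <<[seq adjB Net ^+ k *m (Psi Net *m v) | k <- iota 0 l]>>%VS in
  let spanA : {vspace 'cV[R[i]]_n} :=
    <<[seq adjA Net ^+ k *m v | k <- iota 0 l]>>%VS in
  [/\ exact_reach p Net T lam Ql v t = exact_reach_all p Net T lam Ql v,
      exact_reach_all p Net T lam Ql v = Lp_tensor p [set d | d \in spanB]
    & Lp_tensor p [set d | d \in spanB] =
      Lp_tensor p [set Psi Net *m y | y in [set y | y \in spanA]]].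
Proof.
move=> p1 HT HG HR HQ v l lt spanB spanA.
have t0 : 0 <= t := le_trans (ler0n _ _) lt.
have RT := reached_tensor p1 HT HG HR HQ (v := v).
have TR := tensor_reached p1 HT HG HR HQ (v := v) lt.
split.
- apply/seteqP; split=> f; first by exists t.
  by move=> [t' /= t'0 /(RT _ _ t'0)]; exact: TR.
- apply/seteqP; split=> f; first by move=> [t' /= t'0]; exact: RT.
  by move=> /TR fr; exists t.
- by congr Lp_tensor; exact: spanB_image.
Qed.
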